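(* Let $Y$ be an oriented $(n-1)$-dimensional simplicial pseudo-manifold, let $\lambda:y\mapsto\tilde y$ be an involution on the vertex set $\mathrm{Vert}(Y)$, and let $\chi_y:\mathrm{star}\,y\to\mathrm{star}\,\tilde y$, $y\in\mathrm{Vert}(Y)$, be anti-isomorphisms (with $\chi_y(y)=\tilde y$) such that $\chi_{\tilde y}=\chi_y^{-1}$. Then there are an oriented $n$-dimensional cubic cell pseudo-manifold $X$ and an isomorphism $\mathcal L(X)\cong Y'\times S$, where $S$ is a finite set, such that (identifying $\mathcal L(X)$ with $Y'\times S$): 1) the subsets $W_j(Y)\times S\subset \mathrm{Vert}(Y')\times S=\mathrm{Vert}(\mathcal L(X))$, $j=1,\dots,n$, are invariant under the involution $\lambda_X$; 2) if $y\in\mathrm{Vert}(Y)$ and $s\in S$, then $\lambda_X(y,s)=(\lambda(y),s_1)$ for some $s_1\in S$ (depending on $(y,s)$); 3) if $y\in\mathrm{Vert}(Y)$ and $s\in S$, then the anti-isomorphism $\chi_{X,(y,s)}:\mathrm{star}_{Y'\times S}(y,s)\to\mathrm{star}_{Y'\times S}(\lambda(y),s_1)$ is induced by the anti-isomorphism $\chi_y:\mathrm{star}_Y y\to\mathrm{star}_Y\lambda(y)$.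
   Context: All complexes are finite. A cubic cell complex is the quotient of a disjoint union of finitely many closed cubes by an equivalence relation $\sim$ such that (1) no two distinct points of the same cube are identified; (2) if a point $x_1$ of one cube is identified with a point $x_2$ of another, then some face of the first cube containing $x_1$ is identified with some face of the second containing $x_2$ along a linear homeomorphism. Images of faces are the cells. A simplicial cell complex is defined in the same way with simplices. An $n$-dimensional simplicial (respectively cubic cell) pseudo-manifold is a simplicial (cubic cell) complex in which every cell is contained in an $n$-dimensional cell and every $(n-1)$-dimensional cell is contained in exactly two $n$-dimensional cells; all pseudo-manifolds are assumed normal, i.e. $H_n(X,X\setminus x;\mathbb Z)\cong\mathbb Z$ for every point $x$. They need not be connected. Isomorphisms of oriented pseudo-manifolds preserve orientation; anti-isomorphisms are orientation-reversing isomorphisms. $\mathrm{star}\,\sigma$ is the subcomplex consisting of all closed simplices containing $\sigma$, together with their faces. $Y'$ is the barycentric subdivision of $Y$, and $W_j(Y)\subset \mathrm{Vert}(Y')$ is the set of barycenters of $(j-1)$-dimensional simplices of $Y$ (so $W_1(Y)=\mathrm{Vert}(Y)$). The link of a vertex $x$ of a cubic cell complex $X$ is the simplicial cell complex formed by the simplices $\Delta_{x,\tau}$, for cells $\tau\ni x$, $\tau\ne x$, where $\Delta_{x,\tau}$ is the convex hull in $\tau$ of the midpoints of the edges of $\tau$ at $x$. It is oriented so that $x*\mathrm{link}\,x$ has the orientation of $X$. Put $\mathcal L(X)=\bigsqcup_{x\in\mathrm{Vert}(X)}\mathrm{link}\,x$. Vertices of $\mathcal L(X)$ are in bijection with directed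 edges of $X$ (a vertex of $\mathrm{link}\,x$ is an edge directed away from $x$). Reversing the direction of edges gives the involution $\lambda_X:z\mapsto\tilde z$ on $\mathrm{Vert}(\mathcal L(X))$. If $z$ is the edge $e$ directed from $x$ to $x_1$, then the anti-isomorphism $\chi_{X,z}:\mathrm{star}\,z\to\mathrm{star}\,\tilde z$ maps, for each cell $\tau\supset e$, the simplex $\Delta_{x,\tau}$ linearly onto $\Delta_{x_1,\tau}$, sending the vertex $e$ to $e$ and each other edge $f$ of $\tau$ at $x$ to the edge of $\tau$ at $x_1$ parallel to $f$. One has $\chi_{X,\tilde z}=\chi_{X,z}^{-1}$. *)

(* Defs.v *)
From HB Require Import structures.
From mathcomp Require Import all_boot all_order all_algebra.

Set Implicit Arguments.
Unset Strict Implicit.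
Unset Printing Implicit Defensive.

Import Order.TTheory GRing.Theory.

Local Open Scope order_scope.

Fact cell_display : Order.disp_t.
Proof. exact: Order.Disp tt tt. Qed.

(* A finite simplicial or cubic cell complex is represented by its set of     *)
(* (nonempty) closed cells ordered by inclusion.  By the axioms of a cell     *)
(* complex, the closed cells are embedded cubes or simplices glued along      *)
(* linear homeomorphisms of faces, so that this poset determines the complex. *)

Section CellPosets.

Context {disp : Order.disp_t} {T : finPOrderType disp}.
Implicit Types (a b c : T) (C : {set T}).

Definition is_chain C : bool := [forall a in C, forall b in C, a >=< b].

(* The height of a cell in the face poset, i.e. its geometric dimension. *)
Definition cell_dim c : nat :=
  \max_(C : {set T} | is_chain C && [forall a in C, a <= c]) #|C|.-1.

Definition star a : {set T} := [set b | [exists c, (a <= c) && (b <= c)]].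

(* c_0 < c_1 < ... < c_(k-1) with dim c_i = i. *)
Definition is_flag k (t : k.-tuple T) : bool :=
  sorted <%O t && (map cell_dim t == iota 0 k).

Definition differ_only_at k (i : 'I_k) (t u : k.-tuple T) : Prop :=
  forall j, (tnth t j == tnth u j) = (j != i).

(* A flag c_0 < ... < c_k of a k-cell c_k amounts to a frame at the vertex    *)
(* c_0: for a simplex, the ordering v_0, ..., v_k of its vertices for which   *)
(* c_i is spanned by v_0, ..., v_i; for a cube, the ordering of the edges at  *)
(* c_0 for which c_i is spanned by the first i of them.  Two flags of the     *)
(* same cell that differ in one place define opposite orientations of it.     *)
(* An orientation of an n-dimensional complex is thus a rule telling which    *)
(* full flags are positive: the clause i < n says that it orients every       *)
(* n-cell, the clause i = n that the two n-cells at an (n-1)-cell induce      *)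
(* opposite orientations on it.  There are no (n-1)-cells if n = 0.           *)
Definition is_orientation n (o : n.+1.-tuple T -> bool) : Prop :=
  (0 < n)%N ->
  forall (i : 'I_n.+1) (t u : n.+1.-tuple T),
    is_flag t -> is_flag u -> differ_only_at i t u -> o u = ~~ o t.

(* Cellular chains.  A (k-1)-chain with integer coefficients, that is, a      *)
(* Z-valued function of an oriented (k-1)-cell which is odd under reversal of *)
(* the orientation, is encoded as a function on k-tuples.  It is supported    *)
(* by the flags, and is odd under the changes of a flag inside its top cell.  *)
(* We need the chains of the pair (X, X \ x) for x in the open cell a; it     *)
(* deformation retracts to the pair formed by X and its subcomplex of all     *)
(* the cells not containing a, so that only cells containing a are kept.      *)

Definition is_flag_over a k (t : k.-tuple T) : bool :=
  is_flag t && has (fun c => a <= c) t.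

Definition is_local_chain a k (f : {ffun k.-tuple T -> int}) : Prop :=
  (forall t, ~~ is_flag_over a t -> f t = 0%R)
  /\ (forall (i : 'I_k) t u, (i.+1 < k)%N -> is_flag_over a t ->
        is_flag_over a u -> differ_only_at i t u -> f u = (- f t)%R).

Definition local_boundary a k (f : {ffun k.+1.-tuple T -> int}) :
    {ffun k.-tuple T -> int} :=
  [ffun t => if is_flag_over a t then (\sum_(c : T) f [tuple of rcons t c])%R
             else 0%R].

Definition is_local_cycle a k (f : {ffun k.+1.-tuple T -> int}) : Prop :=
  is_local_chain a f /\ local_boundary a f = 0%R.

Definition is_local_boundary a k (f : {ffun k.+1.-tuple T -> int}) : Prop :=
  exists2 g : {ffun k.+2.-tuple T -> int},
    is_local_chain a g & f = local_boundary a g.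

(* H_n(X, X \ x; Z) is infinite cyclic for x in the open cell a; the class of *)
(* g is a generator.                                                          *)
Definition local_homology_is_Z n a : Prop :=
  exists2 g : {ffun n.+1.-tuple T -> int}, is_local_cycle a g &
    forall f : {ffun n.+1.-tuple T -> int}, is_local_cycle a f ->
      exists! k : int, is_local_boundary a (f - g *~ k)%R.

End CellPosets.

Definition pseudomanifold disp (T : finPOrderType disp) (n : nat) : Prop :=
  [/\ forall a : T, exists2 c : T, a <= c & cell_dim c = n,
      forall a : T, (cell_dim a).+1 = n ->
        #|[set c : T | (a <= c) && (cell_dim c == n)]| = 2
    & forall a : T, local_homology_is_Z n a].

(* Isomorphisms of cell complexes, linear on cells, are isomorphisms of the   *)
(* face posets.                                                               *)
Definition oriented_iso disp (T : finPOrderType disp) disp'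
    (T' : finPOrderType disp') n
    (o : n.+1.-tuple T -> bool) (o' : n.+1.-tuple T' -> bool) (f : T -> T') :
    Prop :=
  [/\ bijective f, {mono f : a b / a <= b}
    & forall t : n.+1.-tuple T, is_flag t -> o' (map_tuple f t) = o t].

(* Simplicial complexes with vertex set V. *)

Section SimplicialComplexes.

Variable V : finType.

Definition simplicial_complex (K : {set {set V}}) : Prop :=
  [/\ set0 \notin K,
      forall v : V, [set v] \in K
    & forall s t : {set V}, t \in K -> s \subset t -> s != set0 -> s \in K].

Variable K : {set {set V}}.

Record simplex : Type :=
  Simplex { simplex_set : {set V}; _ : simplex_set \in K }.

HB.instance Definition _ := [isSub for simplex_set].
HB.instance Definition _ := [Finite of simplex by <:].

Definition simplex_le (s t : simplex) : bool := val s \subset val t.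

Fact simplex_le_refl : reflexive simplex_le.
Proof. by move=> s; exact: subxx. Qed.

Fact simplex_le_anti : antisymmetric simplex_le.
Proof. by move=> s t st; apply/val_inj/eqP; rewrite eqEsubset. Qed.

Fact simplex_le_trans : transitive simplex_le.
Proof. by move=> t s u; exact: subset_trans. Qed.

HB.instance Definition _ := Order.Le_isPOrder.Build cell_display
  simplex simplex_le_refl simplex_le_anti simplex_le_trans.

Definition vertex_star (v : V) : {set {set V}} :=
  [set s in K | [exists t in K, (v \in t) && (s \subset t)]].

(* The vertex map f restricts to an anti-isomorphism star v -> star w taking  *)
(* v to w; its values outside of star v are irrelevant.                       *)
Definition star_antiiso n (o : n.+1.-tuple simplex -> bool)
    (v w : V) (f : V -> V) : Prop :=
  [/\ {in cover (vertex_star v) &, injective f},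
      [set f @: s | s : {set V} in vertex_star v] = vertex_star w,
      f v = w
    & forall t u : n.+1.-tuple simplex,
        is_flag t -> (forall i, val (tnth t i) \in vertex_star v) ->
        (forall i, val (tnth u i) = f @: val (tnth t i)) -> o u = ~~ o t].

End SimplicialComplexes.

(* The barycentric subdivision: a simplex is a nonempty chain of cells (the   *)
(* set of its vertices, each cell standing for its barycenter).               *)

Section Subdivision.

Context {disp : Order.disp_t}.

Variable T : finPOrderType disp.

Record sd : Type :=
  Sd { sd_set : {set T}; _ : is_chain sd_set && (sd_set != set0) }.

HB.instance Definition _ := [isSub for sd_set].
HB.instance Definition _ := [Finite of sd by <:].

Definition sd_le (C D : sd) : bool := val C \subset val D.

Fact sd_le_refl : reflexive sd_le.
Proof. by move=> s; exact: subxx. Qed.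

Fact sd_le_anti : antisymmetric sd_le.
Proof. by move=> s t st; apply/val_inj/eqP; rewrite eqEsubset. Qed.

Fact sd_le_trans : transitive sd_le.
Proof. by move=> t s u; exact: subset_trans. Qed.

HB.instance Definition _ := Order.Le_isPOrder.Build cell_display
  sd sd_le_refl sd_le_anti sd_le_trans.

(* The barycenters of the (j-1)-dimensional cells. *)
Definition W (j : nat) : {set sd} :=
  [set C : sd | [exists a : T, (val C == [set a]) && ((cell_dim a).+1 == j)]].

(* A flag t of the subdivision orders the vertices of its top simplex, by the *)
(* place where they enter t.  These are pairs of vertices ordered by t        *)
(* contrary to the order of T.                                                *)
Definition inversions n (t : n.-tuple sd) : {set T * T} :=
  [set p : T * T | [&& p.1 < p.2, has (fun C : sd => p.1 \in val C) t
    & has (fun C : sd => (p.2 \in val C) && (p.1 \notin val C)) t]].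

(* For a flag u = (a_0 < ... < a_n) of T, the ordered simplex [a_0, ..., a_n] *)
(* of the subdivision is oriented as the frame u, because the i-th barycenter *)
(* lies in a_i, off a_(i-1).  Other orderings get the sign of the permutation *)
(* which is read off the number of inversions.                                *)
Definition sd_orientation n (o : n.+1.-tuple T -> bool)
    (t : n.+1.-tuple sd) : bool :=
  [exists u : n.+1.-tuple T,
    [&& is_flag u, [set a in u] == val (tnth t ord_max)
      & o u (+) odd #|inversions t|]].

End Subdivision.

(* T x S for a finite set S: the disjoint union of copies of T. *)

Section Copies.

Context {disp : Order.disp_t}.

Definition copies (T : finPOrderType disp) (S : finType) : Type := (T * S)%type.

Variables (T : finPOrderType disp) (S : finType).

HB.instance Definition _ := Finite.on (copies T S).

Definition copies_le (p q : copies T S) : bool := (p.1 <= q.1) && (p.2 == q.2).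

Fact copies_le_refl : reflexive copies_le.
Proof. by move=> p; rewrite /copies_le lexx eqxx. Qed.

Fact copies_le_anti : antisymmetric copies_le.
Proof.
move=> [a r] [b s] /andP[/andP[/= ab /eqP ->] /andP[/= ba _]].
by congr pair; apply/eqP; rewrite eq_le ab.
Qed.

Fact copies_le_trans : transitive copies_le.
Proof.
move=> q p r /andP[pq /eqP epq] /andP[qr /eqP eqr].
by rewrite /copies_le (le_trans pq qr) epq eqr eqxx.
Qed.

HB.instance Definition _ := Order.Le_isPOrder.Build cell_display
  (copies T S) copies_le_refl copies_le_anti copies_le_trans.

Definition copies_orientation n (o : n.+1.-tuple T -> bool)
    (t : n.+1.-tuple (copies T S)) : bool :=
  o (map_tuple fst t).

End Copies.

(* A simplex of the subdivision of K, as a set of simplices of K. *)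
Definition chain_of (V : finType) (K : {set {set V}}) (C : sd (simplex K)) :
    {set {set V}} :=
  [set simplex_set a | a in sd_set C].

(* The vertex (y, s) of Y' x S, for a vertex y of Y. *)
Definition is_copy_vertex (V S : finType) (K : {set {set V}})
    (q : copies (sd (simplex K)) S) (y : V) (s : S) : Prop :=
  chain_of q.1 = [set [set y]] /\ q.2 = s.

(* A face of the cube [0,1]^d: the coordinate x_i is equal to b if F i is     *)
(* Some b, and is free if F i is None.                                        *)

Definition cube_face (d : nat) : Type := {ffun 'I_d -> option bool}.

Definition cube_face_le d (F G : cube_face d) : bool :=
  [forall i, (G i == None) || (F i == G i)].

Definition free_coords d (F : cube_face d) : {set 'I_d} :=
  [set i | F i == None].

Section CubicComplexes.

Context {disp : Order.disp_t}.

(* phi is the characteristic map of the cell c, on faces.  It is injective, as*)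
(* no two points of a cube are identified.                                    *)
Definition cube_chart (T : finPOrderType disp) (c : T) d
    (phi : cube_face d -> T) : Prop :=
  (forall F G, (phi F <= phi G) = cube_face_le F G)
  /\ (forall a : T, a <= c <-> exists F, phi F = a).

Definition cubic_cell_complex (T : finPOrderType disp) : Prop :=
  forall c : T, exists d (phi : cube_face d -> T), cube_chart c phi.

Definition parallel_in (T : finPOrderType disp) (c e f : T) : Prop :=
  exists d (phi : cube_face d -> T) (F G : cube_face d),
    [/\ cube_chart c phi, phi F = e, phi G = f
      & free_coords F = free_coords G].

Variable T : finPOrderType disp.

(* The cells of the disjoint union of the links of all vertices: the simplex  *)
(* Delta_(x, c) of the link of the vertex x is the pair (x, c).               *)
Record links : Type :=
  Links { link_pair : T * T;
          _ : (cell_dim link_pair.1 == 0) && (link_pair.1 < link_pair.2) }.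

HB.instance Definition _ := [isSub for link_pair].
HB.instance Definition _ := [Finite of links by <:].

Definition link_vertex (p : links) : T := (link_pair p).1.
Definition link_cell (p : links) : T := (link_pair p).2.

Definition links_le (p q : links) : bool :=
  (link_vertex p == link_vertex q) && (link_cell p <= link_cell q).

Fact links_le_refl : reflexive links_le.
Proof. by move=> p; rewrite /links_le lexx eqxx. Qed.

Fact links_le_anti : antisymmetric links_le.
Proof.
move=> p q /andP[/andP[/eqP exy ab] /andP[_ ba]]; apply/val_inj.
rewrite [LHS]surjective_pairing [RHS]surjective_pairing; congr pair => //.
by apply/eqP; rewrite eq_le ab.
Qed.

Fact links_le_trans : transitive links_le.
Proof.
move=> q p r /andP[/eqP epq pq] /andP[/eqP eqr qr].
by rewrite /links_le (le_trans pq qr) epq eqr eqxx.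
Qed.

HB.instance Definition _ := Order.Le_isPOrder.Build cell_display
  links links_le_refl links_le_anti links_le_trans.

(* x * link x has the orientation of T. *)
Definition links_orientation n (o : n.+2.-tuple T -> bool)
    (t : n.+1.-tuple links) : bool :=
  o [tuple of link_vertex (thead t) :: map link_cell t].

(* A vertex z of links, i.e. an edge with an initial vertex, goes to the      *)
(* same edge with the other end as initial vertex.                            *)
Definition reverse_edge (z : links) : links :=
  odflt z [pick z' : links | (link_cell z' == link_cell z)
                               && (link_vertex z' != link_vertex z)].

(* The graph of chi_z : star z -> star (reverse_edge z) on simplices.  If z   *)
(* is the edge e directed from x to x1, then p = Delta_(x, c) and             *)
(* p' = Delta_(x1, c) for some cell c containing e, and w |-> w' if w' is the *)
(* face of p' whose vertices are the images of the vertices of w under the    *)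
(* linear map p -> p', which takes an edge of c at x to the parallel edge of  *)
(* c at x1; as e is the edge at x1 parallel to e, it need not be singled out. *)
Definition edge_transport (z w w' : links) : Prop :=
  exists p p' : links,
    [/\ link_cell p' = link_cell p,
        (z <= p) && (w <= p),
        (reverse_edge z <= p') && (w' <= p')
      & forall v' : links, cell_dim v' = 0 ->
          (v' <= w' <-> exists v : links,
             [/\ cell_dim v = 0, v <= w
               & (link_vertex v' = link_vertex p') /\
                 parallel_in (link_cell p) (link_cell v) (link_cell v')])].

End CubicComplexes.

(* Main.v *)
Require Import Defs.
From HB Require Import structures.
From mathcomp Require Import all_boot all_order all_algebra all_fingroup.
From mathcomp Require Import zify.

(* The directions of edges at a vertex of X are labelled by sets A of vertices *)
(* of Y, which stay constant along cubes; a frame f, which is a permutation of *)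
(* Vert(Y) depending on the vertex, turns A into the simplex f(A) of Y.  The   *)
(* cubes at a vertex are spanned by nested families of labels, so that links   *)
(* are copies of components of Y'.  One needs involutions u_A of the set of    *)
(* states, u_A commuting with u_B for A included in B, such that f(B) |->      *)
(* (u_A f)(B) reverses the orientation of the star of f(A).  For A = {a} this  *)
(* is t_a : f |-> gamma_(f(a)) f, where gamma_y is a permutation extending     *)
(* chi_y.  For larger A, choose b in A and add to the state, for every A, an   *)
(* element p_A of the group generated by the t_a, a in A.  Then u_A is the     *)
(* conjugate of t_b by p_A, and u_A multiplies by itself the frame and all the *)
(* p_B with A included in B; this turns u_B into its conjugate by u_A, which   *)
(* is what commutation requires.  A last component, a set of labels in which   *)
(* u_A toggles A, makes all cubes embedded.                                    *)
(*   Given an orientation, the local homology of a pseudo-manifold at a cell   *)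
(* is Z if and only if the flags above the cell are connected by changes of    *)
(* one element.  This is how the normality of Y is used and that of X is       *)
(* proved.                                                                     *)

Set Implicit Arguments.
Unset Strict Implicit.
Unset Printing Implicit Defensive.

Import Order.TTheory GRing.Theory Num.Theory.

(** * Flags and local homology *)

(** A vertex of the cubic complex is a pair of a component of Y, given by a canonical simplex, and a
    state s; for m = 0 a component is an orbit of [lam]. The edges at it are labelled by the sets A
    whose image under the frame of s is a simplex of that component, and the cubes at it by nested
    families of labels. So its link is the barycentric subdivision of the component, and the links
    of all vertices with state s together form one copy of Y'. Hence S is the set of states, and
    crossing the edge labelled A means applying [shift A] to the state.

    What has to be found is a set of states with involutions [shift A] that commute for nested
    labels ([shiftK], [shiftC]), that change the frame by a map reversing the orientation of the
    star of the simplex labelled A ([frame_shift_flag]), and that for A = {a} change it by an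
    extension of the given anti-isomorphism at y = [frame s a] ([frame_shift1], [gam_chi]). For
    singletons the twists f |-> f * gam (f a) do this. A larger A uses a conjugate of the twist of
    one of its elements by a product of twists of elements of A: a conjugate of a reversing map by
    reversing maps is reversing ([push_reverses]), and conjugation supplies the commutation
    ([push_shift]). For a singleton the conjugating element is a power of the twist itself, so the
    prescribed map is not disturbed ([push_set1]).

    The rest is local. Commuting flips which toggle bits always span embedded cubes ([cells_cubic]).
    At a vertex, a nested family one short of full has exactly two extensions
    ([codim1_chain_extensions]), and the full families above a given one are connected by changes of
    one member ([full_chains_connected]). The latter gives normality, since for oriented complexes
    integral local homology Z amounts to connectedness of flags ([local_homology_of_star_connected],
    [star_connected_of_local_homology]). A flag at a vertex is oriented as a flag of Y'; moving the
    vertex reverses the sign because frames change by reversing maps ([oX_orientation]).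

    Finally, parallel edges carry equal labels, so transport across an edge keeps labels and only
    changes the frame ([edge_transportE]). Keeping the size of labels gives 1), and the value of the
    frame on singletons gives 2) and 3) ([W_reverse], [vertex_reverse], [transport_chi]). *)

Section PosetFlags.

Local Open Scope order_scope.

Context {disp : Order.disp_t} {T : finPOrderType disp}.

(** A strictly increasing rank is injective on chains, which bounds the dimension from above;
    descending one rank at a time builds a chain attaining the bound. *)
Lemma cell_dim_rank (r : T -> nat) :
  (forall a b, a < b -> (r a < r b)%N) ->
  (forall a, (0 < r a)%N -> exists2 b, b < a & (r b).+1 = r a) ->
  forall a, cell_dim a = r a.
Proof.
move=> r_lt r_pred a; apply/eqP; rewrite eqn_leq; apply/andP; split.
  apply/bigmax_leqP => C /andP[/forall_inP chC /forall_inP leC].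
  have r_le b : b \in C -> (r b <= r a)%N.
    by move=> /leC; rewrite le_eqVlt => /predU1P[-> // | /r_lt/ltnW].
  have inj : {in C &, injective (fun b => inord (r b) : 'I_(r a).+1)}.
    move=> b c Cb Cc /(congr1 val); rewrite /= !inordK ?ltnS ?r_le // => e.
    have /forall_inP/(_ _ Cc) := chC _ Cb.
    by case: (comparableP b c) => // /r_lt; rewrite e ltnn.
  have := max_card (mem ((fun b => inord (r b) : 'I_(r a).+1) @: C)).
  by rewrite card_in_imset // card_ord; case: #|C|.
have [C [chC Ca leC cardC]] : exists C : {set T},
    [/\ is_chain C, a \in C, [forall b in C, b <= a] & #|C| = (r a).+1].
  move: {2}(r a) (erefl (r a)) => k; elim: k a => [|k IHk] a ra.
    exists [set a]; rewrite set11 cards1 ra; split=> //.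
      by apply/forall_inP=> b /set1P->; apply/forall_inP=> c /set1P->; exact: comparablexx.
    by apply/forall_inP=> b /set1P->.
  have [|b ltba rb] := r_pred a; first by rewrite ra.
  have [|C [/forall_inP chC Cb /forall_inP leC cardC]] := IHk b; first lia.
  have ltC c : c \in C -> c < a by move=> /leC /le_lt_trans; apply.
  exists (a |: C); split; last by rewrite cardsU1 cardC -rb; case: (boolP (a \in C)) => // /ltC; rewrite ltxx.
  - apply/forall_inP=> c /setU1P[->|Cc]; apply/forall_inP=> d /setU1P[->|Cd].
    + exact: comparablexx.
    + by rewrite comparable_sym lt_comparable ?ltC.
    + by rewrite lt_comparable ?ltC.
    + by have /forall_inP := chC _ Cc; apply.
  - exact: setU11.
  - by apply/forall_inP=> c /setU1P[->|/ltC/ltW].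
have := @leq_bigmax_cond _ (fun C : {set T} => is_chain C && [forall a0 in C, a0 <= a]) (fun C => #|C|.-1) C.
by rewrite chC leC cardC; apply.
Qed.

Lemma is_flagP k (t : k.-tuple T) :
  reflect ((forall i j : 'I_k, (i <= j)%N -> tnth t i <= tnth t j) /\
           (forall i : 'I_k, cell_dim (tnth t i) = i)) (is_flag t).
Proof.
have dimE : (map cell_dim t == iota 0 k) <-> (forall i : 'I_k, cell_dim (tnth t i) = i).
  split=> [/eqP e i|e].
    have x0 := tnth t i.
    by rewrite (tnth_nth x0) -(nth_map x0 0%N) ?size_tuple // e nth_iota.
  apply/eqP; apply: (@eq_from_nth _ 0%N) => [|j]; rewrite size_map size_tuple ?size_iota // => jk.
  rewrite nth_iota // add0n (nth_map (tnth t (Ordinal jk))) ?size_tuple //.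
  by rewrite -[X in nth _ _ X]/(nat_of_ord (Ordinal jk)) -tnth_nth e.
apply: (iffP andP) => [[st /dimE dt]|[le_t dt]]; split => //; last exact/dimE.
  move=> i j; rewrite leq_eqVlt => /predU1P[/val_inj->// | lt_ij].
  have x0 := tnth t i; rewrite !(tnth_nth x0) ltW //.
  by apply: sorted_ltn_nth lt_ij; rewrite ?inE ?size_tuple //; exact: lt_trans.
case: k t le_t dt {dimE} => [|k] t le_t dt; first by rewrite tuple0.
apply/(sortedP (tnth t ord0)) => i; rewrite size_tuple => lt_ik.
have lt_ik' := ltnW lt_ik.
rewrite -[X in nth _ _ X]/(val (Ordinal lt_ik')) -[X in _ < nth _ _ X]/(val (Ordinal lt_ik)).
rewrite -!tnth_nth lt_neqAle le_t //= andbT.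
by apply: contra_eqN (dt (Ordinal lt_ik)) => /eqP<-; rewrite dt /= -(eqn_add2r 1) addn1; lia.
Qed.

Lemma is_flag_rcons n (r : n.-tuple T) c :
  is_flag [tuple of rcons r c] =
  [&& is_flag r, all (fun b => b < c) r & cell_dim c == n].
Proof.
have sE (s : seq T) : sorted <%O (rcons s c) = sorted <%O s && all (fun b => b < c) s.
  rewrite !(sorted_pairwise lt_trans) -cats1 pairwise_cat allrel1r /= andbT.
  by rewrite andbC.
have iE : iota 0 n.+1 = rcons (iota 0 n) n by rewrite -[n.+1]addn1 iotaD cats1.
rewrite /is_flag iE sE map_rcons eqseq_rcons.
by rewrite -!andbA; congr andb; rewrite andbCA.
Qed.

Lemma flag_exists k a :
  (forall b : T, (0 < cell_dim b)%N -> exists2 c, c < b & (cell_dim c).+1 = cell_dim b) ->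
  cell_dim a = k ->
  exists2 t : k.+1.-tuple T, is_flag t & tnth t ord_max = a.
Proof.
move=> predT; elim: k a => [|k IHk] a dima.
  exists [tuple a] => //.
  by rewrite /is_flag /= dima.
have [|b ltba dimb] := predT a; first by rewrite dima.
have [|t flt tmax] := IHk b; first by move: dimb; rewrite dima => -[].
exists [tuple of rcons t a].
  rewrite is_flag_rcons flt dima eqxx andbT /=; have [le_t _] := is_flagP _ flt.
  apply/allP=> c /tnthP[i ->]; apply: le_lt_trans ltba; rewrite -tmax; apply: le_t.
  by rewrite -ltnS.
by rewrite (tnth_nth a) /= nth_rcons size_tuple ltnn eqxx.
Qed.

(** Connectedness of the flags over [a] under changes of one element, expressed by invariants
    instead of paths. A change of the top cell must cross a ridge that itself contains [a]. *)
Definition star_connected n a : Prop := forall h : n.+1.-tuple T -> int,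
  (forall (i : 'I_n.+1) t u, (i < n)%N -> is_flag_over a t -> is_flag_over a u ->
     differ_only_at i t u -> h t = h u) ->
  (forall (r : n.-tuple T) c c', is_flag_over a r ->
     is_flag [tuple of rcons r c] -> is_flag [tuple of rcons r c'] ->
     h [tuple of rcons r c] = h [tuple of rcons r c']) ->
  forall t u, is_flag_over a t -> is_flag_over a u -> h t = h u.

Lemma ffun_mulrz (I : finType) (g : {ffun I -> int}) k x : ((g *~ k) x = g x * k)%R.
Proof.
rewrite -[X in (_ * X)%R]intz mulrzr; case: k => k; first by rewrite -!pmulrn ffunMnE.
by rewrite NegzE !mulrNz -!pmulrn ffunE ffunMnE.
Qed.

Lemma differ_rcons n (r : n.-tuple T) c c' : c != c' ->
  differ_only_at ord_max [tuple of rcons r c] [tuple of rcons r c'].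
Proof.
move=> neq_c j; rewrite !(tnth_nth c) /= !nth_rcons size_tuple.
case: (ltngtP j n) => [lt_jn|lt_nj|ejn].
- by rewrite eqxx; apply/esym/eqP=> /(congr1 val)/= e; rewrite e ltnn in lt_jn.
- by have := ltn_ord j; rewrite ltnS leqNgt lt_nj.
- by rewrite (negPf neq_c) (_ : j = ord_max) ?eqxx //; apply/val_inj.
Qed.

(** * Local homology Z and connectedness of the flags over a cell *)

Section LocalHomology.

Variables (n : nat) (o : n.+1.-tuple T -> bool) (a : T).
Hypothesis ori : is_orientation o.
Hypothesis dim_le : forall c : T, (cell_dim c <= n)%N.
Hypothesis two : forall b : T, (cell_dim b).+1 = n ->
  #|[set c : T | (b <= c) && (cell_dim c == n)]| = 2%N.

(** The last element of [r] has dimension n - 1, and the two n-cells at it give the extensions. The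
    empty flag lies over no cell, which excludes n = 0. *)
Lemma two_extensions (r : n.-tuple T) : is_flag_over a r ->
  (0 < n)%N /\ exists c1 c2, [/\ c1 != c2, is_flag_over a [tuple of rcons r c1],
    is_flag_over a [tuple of rcons r c2] &
    forall c, is_flag [tuple of rcons r c] -> c = c1 \/ c = c2].
Proof.
case: n two r => [|k] two' r; first by rewrite tuple0 /is_flag_over andbF.
move=> fr; split=> //; have /andP[flr hasr] := fr; have [le_r dim_r] := is_flagP _ flr.
set b := tnth r ord_max.
have /eqP/cards2P[c1 [c2 [neq_c Eb]]] : #|[set c : T | (b <= c) && (cell_dim c == k.+1)]| = 2%N.
  by apply: two'; rewrite dim_r.
have ext c : c \in [set c1; c2] -> is_flag_over a [tuple of rcons r c].
  rewrite -Eb inE => /andP[le_bc dimc].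
  rewrite /is_flag_over is_flag_rcons flr dimc andbT has_rcons hasr orbT andbT /=.
  apply/allP => x /tnthP[i ->]; have : tnth r i <= c by apply: le_trans le_bc; apply: le_r; rewrite -ltnS.
  rewrite le_eqVlt => /predU1P[e|//].
  by have := dim_r i; rewrite e (eqP dimc) => e'; have := ltn_ord i; rewrite -e' ltnn.
exists c1, c2; split=> //; try by apply: ext; rewrite !inE eqxx ?orbT.
move=> c; rewrite is_flag_rcons => /and3P[_ /allP lt_rc dimc].
have : c \in [set c1; c2] by rewrite -Eb inE dimc andbT ltW ?lt_rc ?mem_tnth.
by rewrite !inE => /orP[]/eqP; [left | right].
Qed.

(** The part of the local fundamental chain carried by the flags satisfying [P]. *)
Definition signed_flags (P : n.+1.-tuple T -> bool) : {ffun n.+1.-tuple T -> int} :=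
  [ffun t => if is_flag_over a t && P t then ((-1) ^+ o t)%R else 0%R].

(** Flags that differ in one place have opposite signs. Inside a top cell this is the oddness of a
    chain; at a ridge it makes the two terms of the boundary cancel. *)
Lemma signed_flags_cycle (P : n.+1.-tuple T -> bool) :
  (forall (i : 'I_n.+1) t u, (i < n)%N -> is_flag_over a t -> is_flag_over a u ->
     differ_only_at i t u -> P t = P u) ->
  (forall (r : n.-tuple T) c c', is_flag_over a r ->
     is_flag [tuple of rcons r c] -> is_flag [tuple of rcons r c'] ->
     P [tuple of rcons r c] = P [tuple of rcons r c']) ->
  is_local_cycle a (signed_flags P).
Proof.
move=> P1 P2; split; [split|].
- by move=> t nt; rewrite ffunE (negPf nt).
- move=> i t u; rewrite ltnS => lt_in ft fu dtu; rewrite !ffunE ft fu /= (P1 _ _ _ lt_in ft fu dtu).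
  case: (P u); last by rewrite oppr0.
  rewrite (@ori (leq_trans _ lt_in) i t u) //; first by case: (o t).
    by case/andP: ft.
  by case/andP: fu.
apply/ffunP=> r; rewrite !ffunE; case: ifP => // fr.
have [n0 [c1 [c2 [neq_c f1 f2 fc]]]] := two_extensions fr.
rewrite (bigD1 c1) //= (bigD1 c2) 1?eq_sym //= big1 ?addr0 => [|c /andP[nc1 nc2]]; last first.
  rewrite ffunE; case: ifP => // /andP[/andP[flc _] _].
  by case: (fc _ flc) => e; rewrite e eqxx in nc1 nc2.
have /andP[fl1 _] := f1; have /andP[fl2 _] := f2.
rewrite !ffunE f1 f2 /= (P2 _ c1 c2) //; case: (P _); last by rewrite addr0.
rewrite (@ori n0 ord_max [tuple of rcons r c1] [tuple of rcons r c2]) //.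
  by case: (o _).
exact: differ_rcons.
Qed.

(** For a cycle f, the product of f and the orientation sign is unchanged when one element of a flag
    changes, so it is constant and f is a multiple of the fundamental chain. The multiple is unique
    because there are no cells of dimension n + 1, hence no nonzero boundaries. *)
Lemma local_homology_of_star_connected :
  (exists t : n.+1.-tuple T, is_flag_over a t) ->
  star_connected n a -> local_homology_is_Z n a.
Proof.
move=> [t0 ft0] conn; exists (signed_flags xpredT) => [|f [[f_supp f_odd] f_bd]].
  exact: signed_flags_cycle.
pose sg (t : n.+1.-tuple T) : int := ((-1) ^+ o t)%R.
have sg2 t : (sg t * sg t = 1)%R by rewrite -expr2 sqrr_sign.
have const t : is_flag_over a t -> (f t * sg t = f t0 * sg t0)%R.
  move=> ft; apply: (conn (fun t => f t * sg t)%R) => // [i u v lt_in fu fv duv|r c c' fr fl fl'].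
    rewrite (f_odd i u v) // /sg (@ori (leq_trans _ lt_in) i u v) ?signrN ?mulrNN //.
      by case/andP: fu.
    by case/andP: fv.
  have [n0 [c1 [c2 [neq_c f1 f2 fc]]]] := two_extensions fr.
  have eq12 : (f [tuple of rcons r c1] * sg [tuple of rcons r c1] =
               f [tuple of rcons r c2] * sg [tuple of rcons r c2])%R.
    have /ffunP/(_ r) := f_bd; rewrite !ffunE fr (bigD1 c1) //= (bigD1 c2) 1?eq_sym //=.
    rewrite big1 ?addr0 => [/eqP|c'' /andP[nc1 nc2]]; last first.
      apply: f_supp; apply/negP=> /andP[flc _].
      by case: (fc _ flc) => e; rewrite e eqxx in nc1 nc2.
    rewrite addr_eq0 => /eqP->; rewrite /sg.
    have /andP[fl1 _] := f1; have /andP[fl2 _] := f2.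
    rewrite (@ori n0 ord_max [tuple of rcons r c1] [tuple of rcons r c2]) ?signrN ?mulrN ?mulNr //.
    exact: differ_rcons.
  by case: (fc _ fl) => ->; case: (fc _ fl') => ->.
have f_eq : f = (signed_flags xpredT *~ (f t0 * sg t0))%R.
  apply/ffunP=> t; rewrite ffun_mulrz ffunE; case: (boolP (is_flag_over a t)) => ft /=.
    by rewrite -(const t ft) -/(sg t) mulrCA sg2 mulr1.
  by rewrite mul0r f_supp.
have bd0 (g : {ffun n.+2.-tuple T -> int}) : is_local_chain a g -> local_boundary a g = 0%R.
  move=> [g_supp _]; apply/ffunP=> t; rewrite !ffunE; case: ifP => // _.
  apply: big1 => c _; apply: g_supp; apply/negP=> /andP[].
  rewrite is_flag_rcons => /and3P[_ _ /eqP dimc] _.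
  by have := dim_le c; rewrite dimc ltnn.
exists (f t0 * sg t0)%R; split.
  exists 0%R; last rewrite bd0.
  - split=> [t _|i t u _ _ _]; by rewrite !ffunE ?oppr0.
  - by rewrite -f_eq subrr.
  - split=> [t _|i t u _ _ _]; by rewrite !ffunE ?oppr0.
move=> k [g g_ch]; rewrite (bd0 g g_ch) => /eqP; rewrite subr_eq0 => /eqP/ffunP/(_ t0).
rewrite ffun_mulrz ffunE ft0 /= => ->.
by rewrite mulrAC sg2 mul1r.
Qed.

(** The signed indicator of the level set of [h] through [t] is a cycle, hence a multiple of the
    generator, and a nonzero one since it does not vanish at [t]. The whole fundamental chain is a
    multiple too, so the generator does not vanish at [u]. Therefore the indicator does not vanish
    at [u], which thus lies in the level set. *)
Lemma star_connected_of_local_homology :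
  local_homology_is_Z n a -> star_connected n a.
Proof.
move=> [g _ gen] h h1 h2 t u ft fu.
have gen' f : is_local_cycle a f -> exists k, f = (g *~ k)%R.
  move=> /gen[k [[b [b_supp _]]]]; exists k; apply/eqP; rewrite -subr_eq0; apply/eqP.
  rewrite q.
  apply/ffunP=> t'; rewrite !ffunE; case: ifP => // _.
  apply: big1 => c _; apply: b_supp; apply/negP=> /andP[].
  rewrite is_flag_rcons => /and3P[_ _ /eqP dimc] _.
  by have := dim_le c; rewrite dimc ltnn.
have [|k fk] := gen' (signed_flags (fun v => h v == h t)).
  by apply: signed_flags_cycle => [i v w|r c c'] *; rewrite ?(h1 i v w) ?(h2 r c c').
have [|l fl] := gen' (signed_flags xpredT); first exact: signed_flags_cycle.
move/ffunP: fk => fk; move/ffunP: fl => fl; apply/esym/eqP.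
move: (fk t) (fk u) (fl t) (fl u); rewrite !ffunE !ffun_mulrz ft fu /= eqxx.
by case: eqP => // _; case: (o t); case: (o u) => /=; nia.
Qed.

End LocalHomology.

End PosetFlags.

(** * Nested families of sets *)

Section NestedFamilies.

Variable E : finType.
Implicit Types (A B R : {set E}) (C : {set {set E}}) (l : seq E).

Definition nested A B : bool := (A \subset B) || (B \subset A).

Definition all_nested C : bool := [forall A in C, forall B in C, nested A B].

Lemma nested_refl A : nested A A. Proof. by rewrite /nested subxx. Qed.

Lemma nested_sym A B : nested A B = nested B A. Proof. exact: orbC. Qed.

Lemma all_nestedP C : reflect {in C &, forall A B, nested A B} (all_nested C).
Proof.
apply: (iffP forall_inP) => [nC A B CA CB|nC A CA]; last by apply/forall_inP=> B; exact: nC.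
by have /forall_inP := nC A CA; apply.
Qed.

Lemma all_nestedS C C' : C \subset C' -> all_nested C' -> all_nested C.
Proof. by move=> /subsetP sC /all_nestedP nC; apply/all_nestedP=> A B /sC ? /sC ?; exact: nC. Qed.

Lemma nested_card_eq A B : nested A B -> #|A| = #|B| -> A = B.
Proof.
by case/orP=> sAB eAB; apply/eqP; [|rewrite eq_sym]; rewrite eqEcard sAB eAB leqnn.
Qed.

Lemma nested_card_leq A B : nested A B -> #|A| <= #|B| -> A \subset B.
Proof.
case/orP=> // sBA leAB; suff -> : B = A by [].
by apply/eqP; rewrite eqEcard sBA.
Qed.

Lemma all_nested_max C : C != set0 -> all_nested C ->
  exists2 M, M \in C & forall A, A \in C -> A \subset M.
Proof.
move=> /set0Pn[A0 CA0] /all_nestedP nC; have := arg_maxnP (fun A : {set E} => #|A|) CA0.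
case=> M CM maxM; exists M => // A CA; apply: nested_card_leq (nC _ _ CA CM) _.
exact: maxM.
Qed.

(** Maximal chains of subsets are handled as words: the nonempty initial segments of a
    repetition-free word form a maximal chain of nonempty subsets of its letters. *)
Definition is_prefix l A : bool := A == [set x in take #|A| l].

Definition prefixes l : {set {set E}} := [set A | (A != set0) && is_prefix l A].

Lemma card_set_uniq l : uniq l -> #|[set x in l]| = size l.
Proof. by move=> ul; rewrite cardsE (card_uniqP ul). Qed.

Lemma is_prefix_take l k : uniq l -> is_prefix l [set x in take k l].
Proof.
move=> ul; rewrite /is_prefix card_set_uniq ?take_uniq // size_take_min.
by rewrite /minn; case: ltnP => // le; rewrite !take_oversize.
Qed.

Lemma is_prefix_self l : uniq l -> is_prefix l [set x in l].
Proof. by move=> ul; rewrite /is_prefix card_set_uniq // take_size. Qed.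

Lemma is_prefixP l A : uniq l -> reflect (exists2 k, k <= size l & A = [set x in take k l]) (is_prefix l A).
Proof.
move=> ul; apply: (iffP eqP) => [eA|[k lek ->]]; last by apply/eqP/is_prefix_take.
exists (minn #|A| (size l)); rewrite ?geq_minr // /minn; case: ltnP => // le.
by rewrite take_size {1}eA take_oversize.
Qed.

Lemma prefix_sub l A : is_prefix l A -> A \subset [set x in l].
Proof. by move=> /eqP->; apply/subsetP=> x; rewrite !inE => /mem_take. Qed.

Lemma prefix_nested l A B : is_prefix l A -> is_prefix l B -> nested A B.
Proof.
wlog le : A B / #|A| <= #|B| => [wl pA pB|/eqP-> /eqP->].
  by case/orP: (leq_total #|A| #|B|) => le; [|rewrite nested_sym]; apply: wl.
apply/orP; left; apply/subsetP=> x; rewrite !inE -(subnKC le) takeD mem_cat.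
by move->.
Qed.

Lemma prefixes_nested l : all_nested (prefixes l).
Proof.
apply/all_nestedP => A B; rewrite !inE => /andP[_ pA] /andP[_ pB].
exact: prefix_nested pA pB.
Qed.

Lemma card_prefixes l : uniq l -> #|prefixes l| = size l.
Proof.
move=> ul; pose f (k : 'I_(size l)) := [set x in take k.+1 l].
have cf k : #|f k| = k.+1.
  by rewrite card_set_uniq ?take_uniq // size_take_min; apply/minn_idPl.
have inj_f : injective f by move=> k k' /(congr1 (fun A : {set E} => #|A|)); rewrite !cf => -[/val_inj].
rewrite -[RHS]card_ord -(card_codom inj_f); apply: eq_card => A; rewrite inE.
apply/andP/codomP => [[nzA /(is_prefixP _ ul)[[|k] lek eA]]|[k ->]].
- by rewrite eA take0 in nzA; case/set0Pn: nzA => x; rewrite inE.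
- by exists (Ordinal lek).
- by rewrite -card_gt0 cf is_prefix_take.
Qed.

Lemma perm_swap (x y : seq E) v w : perm_eq (x ++ w :: v :: y) (x ++ v :: w :: y).
Proof. by rewrite perm_cat2l; apply/seq.permP=> z /=; rewrite addnCA. Qed.

Lemma prefix_swap (x : seq E) (v w : E) (y : seq E) A :
  uniq (x ++ v :: w :: y) -> is_prefix (x ++ v :: w :: y) A ->
  A != [set z in rcons x v] -> is_prefix (x ++ w :: v :: y) A.
Proof.
move=> ul; have ul' : uniq (x ++ w :: v :: y).
  by rewrite (perm_uniq (perm_swap x y v w)).
move=> /(is_prefixP _ ul)[k lek eA] neA; apply/is_prefixP => //.
exists k; first by move: lek; rewrite !size_cat.
rewrite eA; apply/setP=> z; rewrite !inE !take_cat; case: ltnP => // le.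
case ek: (k - size x) => [|[|j]] /=; rewrite ?take0 ?mem_cat //; last first.
  by rewrite !inE; case: (z \in x); case: (z == v); case: (z == w).
by case/eqP: neA; rewrite eA take_cat ltnNge le ek /= ?take0 cats1.
Qed.

(* Bubble sort: moving the first letter of the target leftwards one step at a *)
(* time never destroys a prefix which both words have in common.              *)
Lemma bubble_sort (R : Type) C (l0 : seq E) (f : seq E -> R) :
  uniq l0 ->
  (forall x v w y, perm_eq (x ++ v :: w :: y) l0 ->
     {in C, forall A, is_prefix (x ++ v :: w :: y) A} ->
     {in C, forall A, is_prefix (x ++ w :: v :: y) A} ->
     f (x ++ v :: w :: y) = f (x ++ w :: v :: y)) ->
  forall l l', perm_eq l l0 -> perm_eq l' l0 ->
    {in C, forall A, is_prefix l A} -> {in C, forall A, is_prefix l' A} -> f l = f l'.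
Proof.
move=> ul0 f_swap l l' pl pl' Cl Cl'.
suff gen r l1 l1' : perm_eq l1 l1' -> perm_eq (r ++ l1) l0 ->
    {in C, forall A, is_prefix (r ++ l1) A} -> {in C, forall A, is_prefix (r ++ l1') A} ->
    f (r ++ l1) = f (r ++ l1').
  by apply: (gen [::]) => //; rewrite (perm_trans pl) // perm_sym.
elim: l1' r l1 => [|w l1' IH] r l1.
  by move=> /perm_nilP->.
move=> p1 p0 C1 C1'; have [x [y el1]] : exists x y, l1 = x ++ w :: y.
  have : w \in l1 by rewrite (perm_mem p1) mem_head.
  by case/splitPr => x y; exists x, y.
have ul : uniq (r ++ l1) by rewrite (perm_uniq p0).
have ul' : uniq (r ++ w :: l1').
  by rewrite -(perm_uniq (_ : perm_eq (r ++ l1) _)) // perm_cat2l.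
have step : f (r ++ l1) = f (r ++ w :: x ++ y) /\ {in C, forall A, is_prefix (r ++ w :: x ++ y) A}.
  rewrite el1 in p0 C1 p1 ul *; clear l1 el1.
  elim/last_ind: x y p0 C1 p1 ul => [|x v IHx] y p0 C1 p1 ul //.
  have e1 : r ++ rcons x v ++ w :: y = (r ++ x) ++ v :: w :: y by rewrite -cats1 -!catA.
  have e2 : r ++ x ++ w :: v :: y = (r ++ x) ++ w :: v :: y by rewrite -!catA.
  have pvw : perm_eq ((r ++ x) ++ w :: v :: y) ((r ++ x) ++ v :: w :: y).
    exact: perm_swap.
  have C2 : {in C, forall A, is_prefix ((r ++ x) ++ w :: v :: y) A}.
    move=> A CA; apply: prefix_swap; [by rewrite -e1|by rewrite -e1; exact: C1|].
    (* A member of [C] destroyed by this exchange would contain [v] and not [w]. But it is an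
       initial segment of the target r w ..., so as soon as it contains [v], which is not in [r], it
       contains [w]. *)
    have /eqP eA := C1' _ CA; apply/eqP=> eA2.
    have wA : w \notin A.
      move: ul; rewrite e1 eA2 inE mem_rcons inE cat_uniq /= !inE => /and3P[_ H].
      rewrite negb_or => /andP[/andP[nvw _] _].
      by rewrite eq_sym negb_or nvw; apply: contra H => ->; rewrite orbT.
    have vA : v \in A by rewrite eA2 inE mem_rcons mem_head.
    have vr : v \notin r.
      by move: ul; rewrite e1 -catA cat_uniq => /and3P[_ /hasPn/(_ v)]; rewrite !mem_cat mem_head orbT => /(_ isT).
    move: vA wA; rewrite eA !inE take_cat; case: ltnP => [_ /mem_take|le]; first by rewrite (negPf vr).
    case: (_ - _) => [|j] /=; first by rewrite cats0 (negPf vr).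
    by rewrite !mem_cat mem_head orbT.
  rewrite e1 in p0 C1 ul *.
  rewrite cat_rcons; have [||||<- H] := IHx (v :: y).
  - by rewrite e2 (perm_trans pvw).
  - by rewrite e2.
  - by move: p1; rewrite -cats1 -!catA => /(perm_trans _); apply; exact: perm_swap.
  - by rewrite e2 (perm_uniq pvw).
  - by split=> //; rewrite e2; apply: f_swap.
case: step => -> C2; rewrite -!cat_rcons; apply: IH.
- by move: p1; rewrite el1 -cat1s perm_catCA perm_cons.
- by rewrite cat_rcons; apply: perm_trans p0; rewrite el1 perm_cat2l -cat1s perm_catCA.
- by move=> A CA; rewrite cat_rcons; exact: C2.
- by move=> A CA; rewrite cat_rcons; exact: C1'.
Qed.

(** Some letter of [R] lies in no member of [C] other than [R]: take it outside the largest proper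
    member. It is put last, and the remaining letters are ordered by induction. *)
Lemma nested_prefix_seq C R : all_nested C -> {in C, forall A, A \subset R} ->
  exists l, [/\ uniq l, [set x in l] = R & {in C, forall A, is_prefix l A}].
Proof.
move: {2}#|R| (erefl #|R|) => n; elim: n C R => [|n IHn] C R cR nC sC.
  have R0 : R = set0 by apply/eqP; rewrite -cards_eq0 cR.
  exists [::]; split; rewrite ?R0 //.
  by move=> A /sC; rewrite R0 subset0 => /eqP->; apply/eqP/setP=> x; rewrite !inE.
have [v vR vC] : exists2 v, v \in R & forall A, A \in C -> A != R -> v \notin A.
  have [e0|nz] := eqVneq (C :\ R) set0.
    have /card_gt0P[v vR] : 0 < #|R| by rewrite cR.
    exists v => // A CA neA; have : A \in C :\ R by rewrite !inE neA.
    by rewrite e0 inE.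
  have [M] := all_nested_max nz (all_nestedS (subsetDl _ _) nC).
  rewrite !inE => /andP[neM CM] maxM.
  have : M \proper R by rewrite properEneq neM sC.
  case/properP=> _ [v vR vM]; exists v => // A CA neA.
  by apply: contra vM; apply/subsetP/maxM; rewrite !inE neA.
have [||A|l [ul el pl]] := IHn (C :\ R) (R :\ v).
- by apply/eqP; rewrite -eqSS -cR (cardsD1 v R) vR.
- exact: all_nestedS (subsetDl _ _) nC.
- rewrite !inE => /andP[neA CA]; by rewrite subsetD1 sC ?vC.
have vl : v \notin l by move/setP/(_ v): el; rewrite !inE eqxx => ->.
exists (rcons l v); split; first by rewrite rcons_uniq vl.
  by apply/setP=> x; move/setP/(_ x): el; rewrite !inE mem_rcons inE => ->; case: eqP => // ->.
move=> A CA; have [->|neA] := eqVneq A R.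
  have sz : #|R| = (size l).+1 by rewrite (cardsD1 v) vR -el card_set_uniq.
  rewrite /is_prefix take_oversize ?size_rcons ?sz //; apply/eqP/setP=> x.
  by move/setP/(_ x): el; rewrite !inE mem_rcons inE => ->; case: eqP => // ->.
have /pl/eqP eA : A \in C :\ R by rewrite !inE neA.
rewrite /is_prefix -cats1 takel_cat -?eA //.
by rewrite -(card_set_uniq ul) el subset_leq_card // subsetD1 sC ?vC.
Qed.

Lemma swap_codim1 (x : seq E) (v w : E) (y : seq E) : uniq (x ++ v :: w :: y) ->
  #|prefixes (x ++ v :: w :: y) :&: prefixes (x ++ w :: v :: y)| = (size x + size y).+1.
Proof.
move=> ul; set A0 := [set z in rcons x v]; set l := x ++ _.
have A0l : A0 \in prefixes l.
  have eA0 : A0 = [set z in take (size x).+1 l].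
    by rewrite /l -cat_rcons takel_cat ?size_rcons // take_oversize ?size_rcons.
  rewrite inE {2}eA0 is_prefix_take // andbT; apply/set0Pn; exists v.
  by rewrite inE mem_rcons mem_head.
have vx : v \notin rcons x w.
  by move: ul; rewrite cat_uniq /= !inE mem_rcons inE !negb_or => /and3P[_ /andP[-> _] /andP[/andP[-> _] _]].
have -> : prefixes l :&: prefixes (x ++ w :: v :: y) = prefixes l :\ A0.
  apply/setP=> A; rewrite !inE; have [->|neA] := eqVneq A A0; rewrite /=.
    rewrite andbC; apply/negP => /andP[/andP[_ /eqP]] + _.
    have uA : uniq (rcons x v).
      by move: ul; rewrite /l -cat_rcons cat_uniq => /andP[].
    rewrite card_set_uniq // size_rcons -cat_rcons.
    rewrite takel_cat ?size_rcons // take_oversize ?size_rcons // => /setP/(_ v).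
    by rewrite !inE mem_rcons mem_head (negPf vx).
  have [nzA|] //= := boolP (A != set0).
  by apply/andP/idP => [[]//|pA]; split=> //; apply: prefix_swap neA.
have := cardsD1 A0 (prefixes l); rewrite A0l card_prefixes // /l size_cat /= !addnS.
by move=> [].
Qed.

(** All sizes up to the length of the word except [(size x).+1] are taken in the chain, and nested
    sets of equal size are equal. So [B] has this size and lies between the segments x and x v w; it
    adds [v] or [w] to x. *)
Lemma codim1_extensions (x : seq E) (v w : E) (y : seq E) B :
  uniq (x ++ v :: w :: y) ->
  let C := prefixes (x ++ v :: w :: y) :\ [set z in rcons x v] in
  [&& B != set0, B \notin C, all_nested (B |: C) & #|B| <= (size x + size y).+2] =
  (B \in [set [set z in rcons x v]; [set z in rcons x w]]).
Proof.
move=> ul /=; set l := x ++ _ in ul *; set C := prefixes l :\ _; have szl : size l = (size x + size y).+2.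
  by rewrite size_cat /= !addnS.
have pC A : A \in prefixes l -> A != [set z in rcons x v] -> A \in C by move=> lA nA; rewrite !inE nA; move: lA; rewrite inE.
have uv : uniq (rcons x v) by move: ul; rewrite /l -cat_rcons cat_uniq => /andP[].
have vx : v \notin rcons x w.
  by move: ul; rewrite cat_uniq /= !inE mem_rcons inE !negb_or => /and3P[_ /andP[-> _] /andP[/andP[-> _] _]].
have ul' : uniq (x ++ w :: v :: y).
  by rewrite (perm_uniq (perm_swap x y v w)).
have uw : uniq (rcons x w) by move: ul'; rewrite -cat_rcons cat_uniq => /andP[].
have cv : #|[set z in rcons x v]| = (size x).+1 by rewrite card_set_uniq // size_rcons.
have cw : #|[set z in rcons x w]| = (size x).+1 by rewrite card_set_uniq // size_rcons.
apply/idP/idP => [/and4P[nzB nCB /all_nestedP nest leB]|].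
  have nB A : A \in C -> nested B A by move=> CA; apply: nest; rewrite !inE ?eqxx //; move: CA; rewrite !inE => ->; rewrite orbT.
  have ptake j : 0 < j <= size l -> [set z in take j l] \in prefixes l /\ #|[set z in take j l]| = j.
    move=> /andP[j0 jl]; have cj : #|[set z in take j l]| = j.
      by rewrite card_set_uniq ?take_uniq // size_take_min; apply/minn_idPl.
    by rewrite inE -card_gt0 cj j0 is_prefix_take.
  have tv : [set z in take (size x).+1 l] = [set z in rcons x v].
    by rewrite /l -cat_rcons takel_cat ?size_rcons // take_oversize ?size_rcons.
  have cB : #|B| = (size x).+1.
    apply: contraNeq nCB => ne; have [|p c] := ptake #|B|.
      by rewrite card_gt0 nzB szl.
    have inC : [set z in take #|B| l] \in C.
      by apply: pC => //; apply: contraNneq ne => e; rewrite -c e cv.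
    by rewrite {1}(nested_card_eq (nB _ inC)).
  have sxB : [set z in x] \subset B.
    have [x0|/eqP nx] := eqVneq (size x) 0.
      by rewrite (size0nil x0); apply/subsetP=> z; rewrite inE.
    have [|p c] := ptake (size x); first by rewrite szl; lia.
    have ex : take (size x) l = x by rewrite take_size_cat.
    rewrite ex in p c; apply: nested_card_leq; last by rewrite c cB.
    rewrite nested_sym; apply/nB/pC => //.
    by apply/eqP=> e; move: c; rewrite e cv; lia.
  have sB : B \subset [set z in rcons (rcons x v) w].
    have [|p c] := ptake (size x).+2; first by rewrite szl; lia.
    have ex : take (size x).+2 l = rcons (rcons x v) w.
      by rewrite /l -!cat_rcons takel_cat ?size_rcons // take_oversize ?size_rcons.
    rewrite ex in p c; apply: nested_card_leq; last by rewrite c cB.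
    apply/nB/pC => //.
    by apply/eqP=> e; move: c; rewrite e cv; lia.
  have cx : #|[set z in x]| = size x.
    by rewrite card_set_uniq //; move: uv; rewrite rcons_uniq => /andP[].
  have /properP[_ [z zB zx]] : [set z in x] \proper B by rewrite properEcard sxB cx cB leqnn.
  have eB : B = z |: [set z in x].
    apply/esym/eqP; rewrite eqEcard subUset sub1set zB sxB cardsU1 zx cx cB.
    by rewrite add1n leqnn.
  have /subsetP/(_ z zB) := sB; rewrite !(inE, mem_rcons).
  rewrite inE in zx; rewrite (negPf zx) orbF eB => /orP[]/eqP->; apply/orP; [right|left];
    by apply/eqP/setP=> t; rewrite !inE mem_rcons inE.
rewrite in_set2 => H.
have nC : all_nested (B |: C).
  case/orP: H => /eqP->.
    apply: all_nestedS (prefixes_nested l); apply/subsetP=> A; rewrite in_setU1 => /predU1P[->|].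
      rewrite inE -card_gt0 cv /l -cat_rcons.
      have := is_prefix_take (size (rcons x v)) (_ : uniq (rcons x v ++ w :: y)).
      by rewrite take_size_cat // => ->; rewrite // cat_rcons.
    by rewrite in_setD1 => /andP[].
  apply: all_nestedS (prefixes_nested (x ++ w :: v :: y)); apply/subsetP=> A; rewrite in_setU1 => /predU1P[->|].
    rewrite inE -card_gt0 cw -cat_rcons.
    have := is_prefix_take (size (rcons x w)) (_ : uniq (rcons x w ++ v :: y)).
    by rewrite take_size_cat // => ->; rewrite // cat_rcons.
  rewrite in_setD1 inE => /andP[nA /andP[nz pA]]; rewrite inE nz.
  exact: prefix_swap pA nA.
rewrite nC /=; case/orP: H => /eqP e; rewrite e -card_gt0 ?cv ?cw ltnS leqW ?leq_addr // andbT.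
  by rewrite in_setD1 eqxx.
rewrite in_setD1 inE negb_and -[_ == set0]negbK -card_gt0 cw /=.
apply/orP; right; rewrite /is_prefix cw /l -cat_rcons takel_cat ?size_rcons // take_oversize ?size_rcons //.
by apply/eqP=> /setP/(_ v); rewrite !in_set (negPf vx) mem_rcons mem_head.
Qed.

End NestedFamilies.

(** * Cube complexes from commuting flips *)

Definition symd (D : finType) (T U : {set D}) : {set D} := (T :\: U) :|: (U :\: T).

Lemma in_symd (D : finType) (T U : {set D}) x : (x \in symd T U) = (x \in T) (+) (x \in U).
Proof. by rewrite !inE; case: (x \in T); case: (x \in U). Qed.

Lemma symd_sub (D : finType) (C T U : {set D}) : T \subset C -> U \subset C -> symd T U \subset C.
Proof.
move=> /subsetP sT /subsetP sU; apply/subsetP=> A; rewrite in_symd.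
by case: (boolP (A \in T)) => [/sT //|_] /sU.
Qed.

Lemma symdK (D : finType) (T U : {set D}) : symd T (symd T U) = U.
Proof. by apply/setP=> A; rewrite !in_symd addKb. Qed.

(** Abstract data for a cube complex: [dirs q] labels the edges at [q], [flip A] goes to the other
    end of the edge labelled [A], and pairwise compatible labels span a cube. The bits in [parity]
    record the flips made, which forces distinct vertices of a cube to stay distinct. *)
Record flip_system := FlipSystem {
  vtx : finType;
  dir : finType;
  dirs : vtx -> {set dir};
  cmp : rel dir;
  parity : vtx -> {set dir};
  flip : dir -> vtx -> vtx;
  cmp_refl : forall A, cmp A A;
  flipK : forall q A, A \in dirs q -> flip A (flip A q) = q;
  dirs_flip : forall q A B, A \in dirs q -> B \in dirs q -> cmp A B -> B \in dirs (flip A q);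
  flipC : forall q A B, A \in dirs q -> B \in dirs q -> cmp A B ->
    flip A (flip B q) = flip B (flip A q);
  parity_flip : forall q A, A \in dirs q -> parity (flip A q) = symd [set A] (parity q) }.

Arguments cmp_refl {f}.
Arguments flip {f}.

Section Cubes.

Variable X : flip_system.
Implicit Types (q x y : vtx X) (A B : dir X) (C T U : {set dir X}) (s : seq (dir X)).

Definition clique q C : bool := (C \subset dirs q) && [forall A in C, forall B in C, cmp A B].

Lemma cliqueP q C : reflect ({in C, forall A, A \in dirs q} /\ {in C &, forall A B, cmp A B}) (clique q C).
Proof.
apply: (iffP andP) => [[/subsetP sC /forall_inP cC]|[sC cC]]; split=> //.
- by move=> A B CA CB; have /forall_inP := cC A CA; apply.
- exact/subsetP.
- by apply/forall_inP=> A CA; apply/forall_inP=> B CB; apply: cC.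
Qed.

Lemma cliqueS q C C' : C \subset C' -> clique q C' -> clique q C.
Proof.
move=> /subsetP sC /cliqueP[dC cC]; apply/cliqueP; split=> [A /sC /dC //|A B /sC CA /sC CB].
exact: cC.
Qed.

Lemma clique_flip q C A : clique q C -> A \in C -> clique (flip A q) C.
Proof.
move=> /cliqueP[dC cC] CA; apply/cliqueP; split=> // B CB.
by apply: dirs_flip; rewrite ?dC ?cC.
Qed.

Definition flips T q := foldr flip q (enum T).

Lemma clique_foldr q C s : clique q C -> {subset s <= C} -> clique (foldr flip q s) C.
Proof.
move=> cl; elim: s => //= A s IH sC; apply: clique_flip; last by rewrite sC ?mem_head.
by apply: IH => B sB; rewrite sC // inE sB orbT.
Qed.

Lemma foldr_flip_mid q C s1 A s2 : clique q C -> {subset s1 ++ A :: s2 <= C} ->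
  foldr flip q (s1 ++ A :: s2) = flip A (foldr flip q (s1 ++ s2)).
Proof.
move=> cl; elim: s1 => //= B s1 IH sC; rewrite IH => [|A' sA']; last by rewrite sC // inE sA' orbT.
have CB : B \in C by rewrite sC ?mem_head.
have CA : A \in C by rewrite sC // inE mem_cat mem_head !orbT.
have /cliqueP[dC cC] : clique (foldr flip q (s1 ++ s2)) C.
  apply: clique_foldr => // A' sA'; rewrite sC // inE mem_cat inE; move: sA'.
  by rewrite mem_cat => /orP[]->; rewrite !orbT.
by rewrite flipC ?dC ?cC.
Qed.

Lemma foldr_flip_perm q C s s' : clique q C -> {subset s <= C} -> perm_eq s s' ->
  foldr flip q s = foldr flip q s'.
Proof.
move=> cl; elim: s s' => [|A s IH] s' sC; first by rewrite perm_sym => /perm_nilP->.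
move=> ps; have [s1 [s2 es]] : exists s1 s2, s' = s1 ++ A :: s2.
  have : A \in s' by rewrite -(perm_mem ps) mem_head.
  by case/splitPr => s1 s2; exists s1, s2.
rewrite {s'}es in ps *.
rewrite (foldr_flip_mid cl) => [|B]; last by rewrite -(perm_mem ps); apply: sC.
rewrite /= (IH (s1 ++ s2)) // => [B sB|]; first by rewrite sC // inE sB orbT.
by rewrite -(perm_cons A) (perm_trans ps) // -cat1s perm_catCA.
Qed.

Lemma flip_flips q C T A : clique q C -> T \subset C -> A \in C ->
  flip A (flips T q) = flips (symd [set A] T) q.
Proof.
move=> cl; have add U : U \subset C -> A \in C -> A \notin U -> flip A (flips U q) = flips (A |: U) q.
  move=> sUC CA nUA; rewrite /flips -[LHS]/(foldr flip q (A :: enum U)).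
  apply: (foldr_flip_perm cl) => [B|].
    by rewrite inE mem_enum => /predU1P[-> //|]; apply: (subsetP sUC).
  apply: uniq_perm; rewrite /= ?enum_uniq ?mem_enum ?nUA // => B.
  by rewrite inE !mem_enum !inE.
move=> sTC CA; have [TA|nTA] := boolP (A \in T); last first.
  by rewrite add //; congr flips; apply/setP=> B; rewrite in_symd !inE; case: eqP => [->|]; rewrite ?(negPf nTA).
have sT'C : T :\ A \subset C by rewrite (subset_trans _ sTC) ?subsetDl.
rewrite -{1}(setD1K TA) -add ?setD11 // flipK.
  by congr flips; apply/setP=> B; rewrite in_symd !inE; case: eqP => [->|]; rewrite ?TA.
have /cliqueP[dC _] : clique (flips (T :\ A) q) C.
  by apply: clique_foldr => // B; rewrite mem_enum; apply: (subsetP sT'C).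
exact: dC.
Qed.

Lemma flips0 q : flips set0 q = q.
Proof. by rewrite /flips enum_set0. Qed.

Lemma clique_flips q C T : clique q C -> T \subset C -> clique (flips T q) C.
Proof. by move=> cl /subsetP sT; apply: clique_foldr => // A; rewrite mem_enum => /sT. Qed.

(** Inside a cube, the subsets of its clique act as an elementary abelian 2-group under symmetric
    difference. *)
Lemma flips_flips q C T U : clique q C -> T \subset C -> U \subset C ->
  flips T (flips U q) = flips (symd T U) q.
Proof.
move=> cl sT sU; suff gen s : uniq s -> {subset s <= C} ->
    foldr flip (flips U q) s = flips (symd [set A in s] U) q.
  rewrite {1}/flips gen ?enum_uniq // => [|A]; last by rewrite mem_enum => /(subsetP sT).
  by congr flips; congr symd; apply/setP=> A; rewrite inE mem_enum.
elim: s => [_ _|A s IH /= /andP[nA us] sC] /=.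
  by congr flips; apply/setP=> A; rewrite in_symd inE.
have sC' : {subset s <= C} by move=> B sB; rewrite sC // inE sB orbT.
rewrite IH // (flip_flips cl) ?sC ?mem_head //.
  congr flips; apply/setP=> B; rewrite !in_symd !inE.
  by case: eqP => [->|//]; rewrite (negPf nA).
apply/subsetP=> B; rewrite in_symd inE; case: (boolP (B \in s)) => [/sC' //|_] /=.
exact: (subsetP sU).
Qed.

Lemma parity_flips q C T : clique q C -> T \subset C -> parity (flips T q) = symd T (parity q).
Proof.
move=> cl sT; suff gen s : uniq s -> {subset s <= C} ->
    parity (foldr flip q s) = symd [set A in s] (parity q).
  rewrite {1}/flips gen ?enum_uniq // => [|A]; last by rewrite mem_enum => /(subsetP sT).
  by congr symd; apply/setP=> A; rewrite inE mem_enum.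
elim: s => [_ _|A s IH /= /andP[nA us] sC] /=.
  by apply/setP=> A; rewrite in_symd inE.
have sC' : {subset s <= C} by move=> B sB; rewrite sC // inE sB orbT.
have /cliqueP[dC _] := clique_foldr cl sC'.
rewrite parity_flip ?dC ?sC ?mem_head // IH //; apply/setP=> B; rewrite !in_symd !inE.
by case: eqP => [->|//]; rewrite (negPf nA).
Qed.

Definition cube q C : {set vtx X} := [set flips T q | T : {set dir X} in powerset C].

Lemma cubeP q C x : reflect (exists2 T : {set dir X}, T \subset C & x = flips T q) (x \in cube q C).
Proof.
by apply: (iffP imsetP) => -[T]; [rewrite powersetE|]; exists T; rewrite ?powersetE.
Qed.

Lemma cube_refl q C : q \in cube q C.
Proof. by apply/cubeP; exists set0; rewrite ?sub0set ?flips0. Qed.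

Lemma clique_cube q C x : clique q C -> x \in cube q C -> clique x C.
Proof. by move=> cl /cubeP[T sT ->]; apply: clique_flips. Qed.

Lemma cube_eq q C x : clique q C -> x \in cube q C -> cube x C = cube q C.
Proof.
move=> cl /cubeP[T sT ->]; apply/setP=> y; apply/cubeP/cubeP => -[U sU ->].
  by exists (symd U T); rewrite ?symd_sub // (flips_flips cl).
exists (symd T U); rewrite ?symd_sub // (flips_flips cl) ?symd_sub //.
by congr flips; apply/setP=> A; rewrite !in_symd addbC addKb.
Qed.

(** The bits tell which labels were flipped, so the vertices of a cube correspond bijectively to the
    subsets of its clique. *)
Lemma cube_parity q C x : clique q C -> x \in cube q C ->
  symd (parity x) (parity q) \subset C /\ x = flips (symd (parity x) (parity q)) q.
Proof.
move=> cl /cubeP[T sT ->]; rewrite (parity_flips cl sT).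
suff -> : symd (symd T (parity q)) (parity q) = T by [].
by apply/setP=> A; rewrite !in_symd addbK.
Qed.

Lemma flip_in_cube q C A : clique q C -> A \in C -> flip A q \in cube q C.
Proof.
move=> cl CA; apply/cubeP; exists [set A]; rewrite ?sub1set //.
by rewrite /flips enum_set1.
Qed.

Lemma cube_sub q q' C C' : clique q C -> clique q' C' ->
  (cube q C \subset cube q' C') = (q \in cube q' C') && (C \subset C').
Proof.
move=> cl cl'; apply/subsetP/andP => [sub|[qq' sC] x /cubeP[T sT ->]].
  have qq' := sub _ (cube_refl q C); split=> //; apply/subsetP=> A CA.
  have := sub _ (flip_in_cube cl CA); rewrite -(cube_eq cl' qq').
  move=> /(cube_parity (clique_cube cl' qq'))[+ _].
  have /cliqueP[dC _] := cl; rewrite parity_flip ?dC // => /subsetP; apply.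
  by rewrite !in_symd addbK inE.
rewrite -(cube_eq cl' qq'); apply/cubeP; exists T => //; exact: subset_trans sC.
Qed.

Definition is_cell (O : {set vtx X}) : bool :=
  [exists q, exists C : {set dir X}, clique q C && (O == cube q C)].

(** A cell is stored as its set of vertices, so that faces are subsets and no quotient has to be
    taken; [cdirs] recovers its labels from the bits. *)
Record cell : Type := Cell { cell_set : {set vtx X}; _ : is_cell cell_set }.

HB.instance Definition _ := [isSub for cell_set].
HB.instance Definition _ := [Finite of cell by <:].

Definition cell_le (c d : cell) : bool := val c \subset val d.

Fact cell_le_refl : reflexive cell_le.
Proof. by move=> c; exact: subxx. Qed.

Fact cell_le_anti : antisymmetric cell_le.
Proof. by move=> c d cd; apply/val_inj/eqP; rewrite eqEsubset. Qed.

Fact cell_le_trans : transitive cell_le.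
Proof. by move=> d c f; exact: subset_trans. Qed.

HB.instance Definition _ := Order.Le_isPOrder.Build cell_display
  cell cell_le_refl cell_le_anti cell_le_trans.

Definition cdirs (c : cell) : {set dir X} :=
  [set A | [exists x in val c, exists y in val c, A \in symd (parity x) (parity y)]].

Lemma cell_cube (c : cell) x : x \in val c ->
  clique x (cdirs c) /\ val c = cube x (cdirs c).
Proof.
have /existsP[q /existsP[C /andP[cl /eqP ec]]] := valP c.
suff eC : cdirs c = C.
  by rewrite eC ec => xq; rewrite (cube_eq cl) // (clique_cube cl).
apply/setP=> A; rewrite inE; apply/exists_inP/idP => [[y cy /exists_inP[z cz Ayz]]|CA].
  rewrite ec in cy cz; have [/subsetP sy _] := cube_parity cl cy.
  have [/subsetP sz _] := cube_parity cl cz; move: (sy A) (sz A) Ayz; rewrite !in_symd.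
  by case: (A \in parity y) (A \in parity z) (A \in parity q) => [] [] [] //= => [|_]; apply.
exists (flip A q); first by rewrite ec flip_in_cube.
apply/exists_inP; exists q; first by rewrite ec cube_refl.
by have /cliqueP[dC _] := cl; rewrite parity_flip ?dC // !in_symd addbK inE.
Qed.

Lemma cell_nonempty (c : cell) : exists x, x \in val c.
Proof. by have /existsP[q /existsP[C /andP[cl /eqP ->]]] := valP c; exists q; apply: cube_refl. Qed.

Lemma exists_cell q C : clique q C -> exists2 c : cell, q \in val c & cdirs c = C.
Proof.
move=> cl; have isc : is_cell (cube q C).
  by apply/existsP; exists q; apply/existsP; exists C; rewrite cl eqxx.
exists (Cell isc); first exact: cube_refl.
have [cl' /= e] := cell_cube (cube_refl q C : q \in val (Cell isc)).
apply/eqP; rewrite eqEsubset; move: (cube_sub cl cl') (cube_sub cl' cl).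
by rewrite -e subxx => /esym/andP[_ ->] /esym/andP[_ ->].
Qed.

Lemma cell_leE (c d : cell) x : x \in val c ->
  (c <= d)%O = (x \in val d) && (cdirs c \subset cdirs d).
Proof.
move=> cx; have [cl e] := cell_cube cx; have [y dy] := cell_nonempty d.
have [cl' e'] := cell_cube dy.
by rewrite -[LHS]/(val c \subset val d) e e' (cube_sub cl cl') -e'.
Qed.

Lemma cell_eq (c d : cell) x : x \in val c -> x \in val d -> cdirs c = cdirs d -> c = d.
Proof.
move=> cx dx e; apply/val_inj; have [_ ->] := cell_cube cx; have [_ ->] := cell_cube dx.
by rewrite e.
Qed.

Lemma cdirs_lt (c d : cell) : (c < d)%O -> #|cdirs c| < #|cdirs d|.
Proof.
move=> ltcd; have [x cx] := cell_nonempty c; apply: proper_card.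
have := ltW ltcd; rewrite (cell_leE _ cx) => /andP[dx sub]; rewrite properEneq sub andbT.
by apply: contraTneq ltcd => e; rewrite (cell_eq cx dx e) ltxx.
Qed.

Lemma cell_face (c : cell) x C : x \in val c -> C \subset cdirs c ->
  exists d : cell, [/\ x \in val d, cdirs d = C & (d <= c)%O].
Proof.
move=> cx sC; have [cl _] := cell_cube cx; have [d dx eC] := exists_cell (cliqueS sC cl).
by exists d; split=> //; rewrite (cell_leE _ dx) cx eC.
Qed.

Lemma cell_dimE (c : cell) : cell_dim c = #|cdirs c|.
Proof.
apply: (@cell_dim_rank _ cell (fun c => #|cdirs c|)) => [|{}c /card_gt0P[A cA]]; first exact: cdirs_lt.
have [x cx] := cell_nonempty c.
have [d [dx ed led]] := cell_face cx (subsetDl _ [set A] : cdirs c :\ A \subset _).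
exists d; last by rewrite ed (cardsD1 A (cdirs c)) cA.
by rewrite lt_neqAle led andbT; apply: contraTneq cA => <-; rewrite ed setD11.
Qed.

Definition mkcell (c0 : cell) x C : cell :=
  odflt c0 [pick d : cell | (x \in val d) && (cdirs d == C)].

Lemma mkcellP (c0 : cell) x C : clique x C ->
  x \in val (mkcell c0 x C) /\ cdirs (mkcell c0 x C) = C.
Proof.
move=> cl; rewrite /mkcell; case: pickP => [d /andP[? /eqP]//|no].
by have [d dx ed] := exists_cell cl; have := no d; rewrite dx ed eqxx.
Qed.

(** * Charts of the cells *)

Section Chart.

Variables (c : cell) (q : vtx X).
Hypothesis cq : q \in val c.
Let d := #|cdirs c|.
Implicit Types F G : cube_face d.

Definition on_dirs F : {set dir X} := [set enum_val i | i : 'I_d & F i == Some true].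
Definition free_dirs F : {set dir X} := [set enum_val i | i : 'I_d & F i == None].
Definition chart F : cell := mkcell c (flips (on_dirs F) q) (free_dirs F).

Lemma mem_on_dirs F i : (enum_val i \in on_dirs F) = (F i == Some true).
Proof. by rewrite mem_imset ?inE //; apply: enum_val_inj. Qed.

Lemma mem_free_dirs F i : (enum_val i \in free_dirs F) = (F i == None).
Proof. by rewrite mem_imset ?inE //; apply: enum_val_inj. Qed.

Lemma on_dirs_sub F : on_dirs F \subset cdirs c.
Proof. by apply/subsetP=> _ /imsetP[i _ ->]; apply: enum_valP. Qed.

Lemma free_dirs_sub F : free_dirs F \subset cdirs c.
Proof. by apply/subsetP=> _ /imsetP[i _ ->]; apply: enum_valP. Qed.

Lemma chartE F : flips (on_dirs F) q \in val (chart F) /\ cdirs (chart F) = free_dirs F.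
Proof.
have [cl _] := cell_cube cq; apply: mkcellP; apply: cliqueS (free_dirs_sub F) _.
exact: clique_flips (on_dirs_sub F).
Qed.

Lemma chart_le F G : (chart F <= chart G)%O = cube_face_le F G.
Proof.
have [cl _] := cell_cube cq; have [xF dF] := chartE F; have [xG dG] := chartE G.
have [clG eG] := cell_cube xG.
have memE : (flips (on_dirs F) q \in val (chart G)) = (symd (on_dirs F) (on_dirs G) \subset free_dirs G).
  rewrite eG dG; apply/idP/idP => [|sub].
    move=> /cube_parity; rewrite -dG => /(_ clG)[+ _].
    rewrite !(parity_flips cl) ?on_dirs_sub // => /subsetP sub; apply/subsetP=> A.
    by rewrite in_symd => H; apply: sub; rewrite !in_symd addbACA addbb addbF.
  apply/cubeP; exists (symd (on_dirs F) (on_dirs G)) => //.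
  rewrite (flips_flips cl) ?symd_sub ?on_dirs_sub //; congr flips.
  by apply/setP=> A; rewrite !in_symd addbK.
rewrite (cell_leE _ xF) memE dF dG; apply/andP/forallP => [[/subsetP s1 /subsetP s2] i|H].
  have := s1 (enum_val i); have := s2 (enum_val i).
  rewrite in_symd !mem_on_dirs !mem_free_dirs.
  by case: (F i) (G i) => [[]|] [[]|] //= H1 H2; first [have := H1 isT | have := H2 isT].
split; apply/subsetP=> A hA.
  have cA : A \in cdirs c by apply: subsetP hA; rewrite symd_sub ?on_dirs_sub.
  move: hA; rewrite -(enum_rankK_in cA cA) in_symd !mem_on_dirs !mem_free_dirs.
  by have := H (enum_rank_in cA A); case: (F _) (G _) => [[]|] [[]|].
have cA : A \in cdirs c by apply: subsetP hA; rewrite free_dirs_sub.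
move: hA; rewrite -(enum_rankK_in cA cA) !mem_free_dirs.
by have := H (enum_rank_in cA A); case: (F _) (G _) => [[]|] [[]|].
Qed.

Lemma chart_onto (a : cell) : (a <= c)%O -> exists F, chart F = a.
Proof.
move=> le_ac; have [cl ec] := cell_cube cq; have [x ax] := cell_nonempty a.
have := le_ac; rewrite (cell_leE _ ax) => /andP[cx sub].
rewrite ec in cx; have /cubeP[T sT ex] := cx.
pose F : cube_face d := [ffun i => if enum_val i \in cdirs a then None else Some (enum_val i \in T)].
exists F; have [xF dF] := chartE F.
have eF : free_dirs F = cdirs a.
  apply/setP=> A; apply/idP/idP => [/imsetP[i]|aA].
    by rewrite inE ffunE => + ->; case: ifP.
  have cA := subsetP sub _ aA.
  by rewrite -(enum_rankK_in cA cA) mem_free_dirs ffunE enum_rankK_in ?aA.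
apply: (cell_eq xF _ (etrans dF eF)).
have [cla ea] := cell_cube ax; rewrite ea ex.
have sTF : on_dirs F \subset cdirs c := on_dirs_sub F.
apply/cubeP; exists (symd (on_dirs F) T).
  apply/subsetP=> A; rewrite in_symd => hA.
  have cA : A \in cdirs c by apply: (subsetP (symd_sub sTF sT)); rewrite in_symd.
  move: hA; rewrite -(enum_rankK_in cA cA) mem_on_dirs ffunE; case: ifP => // _.
  by case: (_ \in T).
rewrite (flips_flips cl) ?symd_sub //; congr flips.
by apply/setP=> A; rewrite !in_symd addbK.
Qed.

Lemma chartP : cube_chart c chart.
Proof.
split=> [F G|a]; first exact: chart_le.
split=> [/chart_onto//|[F <-]]; have [xF dF] := chartE F; have [cl ec] := cell_cube cq.
rewrite (cell_leE _ xF) dF free_dirs_sub andbT ec; apply/cubeP.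
by exists (on_dirs F); rewrite ?on_dirs_sub.
Qed.

End Chart.

Theorem cells_cubic : cubic_cell_complex cell.
Proof.
move=> c; have [q cq] := cell_nonempty c.
by exists #|cdirs c|, (@chart c q); apply: chartP.
Qed.

(** If the facets had different labels, together they would have all labels of [h]. The labels
    separating a vertex of [a] from one of [b] could then be split into a part flipped inside [a]
    and a part flipped inside [b], which gives a common vertex. *)
Lemma disjoint_facets_parallel (a b h : cell) : (a <= h)%O -> (b <= h)%O ->
  #|cdirs h| = #|cdirs a|.+1 -> #|cdirs h| = #|cdirs b|.+1 ->
  [disjoint val a & val b] -> cdirs a = cdirs b.
Proof.
move=> leah lebh ca cb; apply: contraTeq => neab.
have [x ax] := cell_nonempty a; have [y by_] := cell_nonempty b.
have := leah; rewrite (cell_leE _ ax) => /andP[hx sa].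
have := lebh; rewrite (cell_leE _ by_) => /andP[hy sb].
have [cla ea] := cell_cube ax; have [clb eb] := cell_cube by_; have [clh eh] := cell_cube hy.
have uni : cdirs h \subset cdirs a :|: cdirs b.
  suff /eqP<- : cdirs a :|: cdirs b == cdirs h by [].
  rewrite eqEcard subUset sa sb ca; apply: proper_card.
  rewrite properE subsetUl; apply: contra neab => sba.
  rewrite eq_sym eqEcard (subset_trans (subsetUr _ _) sba).
  by rewrite -ltnS -ca -cb leqnn.
rewrite eh in hx; have [sS ex] := cube_parity clh hx; set S := symd _ _ in sS ex.
pose S1 := S :&: cdirs a.
apply/pred0Pn; exists (flips S1 x); rewrite /=.
rewrite ea eb; apply/andP; split; first by apply/cubeP; exists S1; rewrite ?subsetIr.
apply/cubeP; exists (symd S1 S); last first.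
  have sS1 : S1 \subset cdirs h by apply: subset_trans (subsetIl _ _) sS.
  by rewrite {1}ex (flips_flips clh).
apply/subsetP=> A; rewrite in_symd inE; case: (boolP (A \in S)) => //= /(subsetP sS)/(subsetP uni).
by rewrite inE; case: (A \in cdirs a).
Qed.

(** * Parallel faces in an arbitrary chart *)

Section Parallel.

Variables (c : cell) (d : nat) (phi : cube_face d -> cell).
Hypothesis chart_phi : cube_chart c phi.
Implicit Types F G : cube_face d.

Let le_phi F G : (phi F <= phi G)%O = cube_face_le F G.
Proof. by have [] := chart_phi. Qed.

Let onto (a : cell) F : (a <= phi F)%O -> exists2 G, phi G = a & cube_face_le G F.
Proof.
have [_ im] := chart_phi => le_aF.
have [|G eG] := proj1 (im a).
  by apply: le_trans le_aF _; apply/im; exists F.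
by exists G; rewrite // -le_phi eG.
Qed.

Let fix_coord F i b : cube_face d := [ffun j => if j == i then b else F j].

Let face_free F G : cube_face_le F G -> free_coords F \subset free_coords G.
Proof.
move=> /forallP leFG; apply/subsetP=> i; rewrite !inE => /eqP Fi.
by have := leFG i; rewrite Fi; case: (G i).
Qed.

Lemma chart_dim F : #|cdirs (phi F)| = #|free_coords F|.
Proof.
move: {2}#|free_coords F|.+1 (ltnSn #|free_coords F|) => k; elim: k F => // k IH F.
rewrite ltnS => leFk; apply/eqP; rewrite eqn_leq; apply/andP; split.
  have [->//|] := posnP #|cdirs (phi F)|; case/card_gt0P=> A cA.
  have [x cx] := cell_nonempty (phi F).
  have [a [_ ea lea]] := cell_face cx (subsetDl _ [set A] : cdirs (phi F) :\ A \subset _).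
  have [G eG leGF] := onto lea; rewrite (cardsD1 A) cA -ea -eG add1n.
  have ltGF : #|free_coords G| < #|free_coords F|.
    rewrite ltn_neqAle subset_leq_card ?face_free // andbT.
    apply: contraTneq cA => e; suff eGF : G = F by rewrite -eGF eG ea setD11.
    have /eqP/setP efree : free_coords G == free_coords F.
      by rewrite eqEcard face_free ?e ?leqnn.
    apply/ffunP=> i; move/forallP/(_ i): leGF; move: (efree i); rewrite !inE.
    by case: (F i) => [b|/eqP->] //= _ /eqP.
  by rewrite (IH _ (leq_trans ltGF leFk)).
have [->//|] := posnP #|free_coords F|; case/card_gt0P=> i iF.
have eG : free_coords (fix_coord F i (Some false)) = free_coords F :\ i.
  by apply/setP=> j; rewrite !inE ffunE; case: (j =P i).
have ltGF : (phi (fix_coord F i (Some false)) < phi F)%O.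
  rewrite lt_neqAle le_phi; apply/andP; split; last first.
    apply/forallP=> j; rewrite ffunE; case: (j =P i) => [->|_]; last by rewrite eqxx orbT.
    by move: iF; rewrite inE => ->.
  apply: contraTneq isT => e; have := lexx (phi F); rewrite -{1}e => _.
  have : cube_face_le F (fix_coord F i (Some false)) by rewrite -le_phi e.
  by move/forallP/(_ i); rewrite ffunE eqxx /=; move: iF; rewrite inE => /eqP->.
apply: leq_trans (cdirs_lt ltGF); rewrite (cardsD1 i) iF -eG add1n ltnS IH //.
by rewrite (leq_trans _ leFk) // (cardsD1 i (free_coords F)) iF -eG add1n.
Qed.

Let fix_free F i b : cube_face_le (fix_coord F i (Some b)) (fix_coord F i None).
Proof.
by apply/forallP=> j; rewrite !ffunE; case: (j =P i) => [_|_]; rewrite ?eqxx ?orbT.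
Qed.

(** Opposite values of coordinate [i] give disjoint facets of the face where [i] is free: a common
    vertex would be a face in the chart whose coordinate [i] has both values. *)
Lemma opposite_facets F i b : F i != None -> cdirs (phi (fix_coord F i (Some b))) = cdirs (phi F).
Proof.
move=> Fi; case eF: (F i) => [b'|]; last by rewrite eF in Fi.
have FE : fix_coord F i (Some b') = F.
  by apply/ffunP=> j; rewrite ffunE; case: (j =P i) => // ->.
have [->|neb] := eqVneq b b'; first by rewrite FE.
have free b0 : free_coords (fix_coord F i None) = i |: free_coords (fix_coord F i (Some b0)).
  by apply/setP=> j; rewrite !inE !ffunE; case: (j =P i).
have nfree b0 : i \notin free_coords (fix_coord F i (Some b0)).
  by rewrite inE ffunE eqxx.
rewrite -{2}FE; apply: (@disjoint_facets_parallel _ _ (phi (fix_coord F i None))).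
- by rewrite le_phi fix_free.
- by rewrite le_phi fix_free.
- by rewrite !chart_dim (free b) cardsU1 nfree.
- by rewrite !chart_dim (free b') cardsU1 nfree.
apply/pred0Pn => -[x /= /andP[x1 x2]].
have [a [ax ea le1]] := cell_face x1 (sub0set _).
have le2 : (a <= phi (fix_coord F i (Some b')))%O by rewrite (cell_leE _ ax) x2 ea sub0set.
have [G eG /forallP/(_ i)] := onto le1; rewrite ffunE eqxx /= => /eqP Gb.
rewrite -eG le_phi in le2; have /forallP/(_ i) := le2; rewrite ffunE eqxx /= Gb => /eqP[e].
by rewrite e eqxx in neb.
Qed.

(** Since [parallel_in] allows every chart, this cannot be read off [chart]. The coordinates where
    [F] and [G] disagree are changed one at a time, each step passing to an opposite facet. *)
Lemma parallel_chart F G : free_coords F = free_coords G -> cdirs (phi F) = cdirs (phi G).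
Proof.
move: {2}#|[set i | F i != G i]| (erefl #|[set i | F i != G i]|) => k.
elim: k F => [|k IH] F eFG efree.
  congr (cdirs (phi _)); apply/ffunP=> i; apply/eqP; apply: contraT => ne.
  by move/eqP: eFG; rewrite cards_eq0 => /eqP/setP/(_ i); rewrite !inE ne.
have /card_gt0P[i] : 0 < #|[set i | F i != G i]| by rewrite eFG.
rewrite inE => neFG; have freeE : (F i == None) = (G i == None).
  by move/setP/(_ i): efree; rewrite !inE.
case eG: (G i) freeE => [b|] freeE; last by rewrite eG in neFG; rewrite freeE in neFG.
rewrite -(@opposite_facets F i b) ?freeE //; apply: IH.
  apply/eqP; rewrite -eqSS -eFG (cardsD1 i [set i | F i != G i]) inE neFG add1n eqSS.
  apply/eqP/eq_card=> j; rewrite !inE ffunE; case: (j =P i) => [->|//].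
  by rewrite eG eqxx.
apply/setP=> j; move/setP/(_ j): efree; rewrite !inE ffunE.
by case: (j =P i) => [->|//]; rewrite eG.
Qed.

End Parallel.

Lemma parallelP (c a b : cell) :
  parallel_in c a b <-> [/\ (a <= c)%O, (b <= c)%O & cdirs a = cdirs b].
Proof.
split=> [[d [phi [F [G [ch <- <- efree]]]]]|[leac lebc eab]].
  have [_ im] := ch; split; [by apply/im; exists F|by apply/im; exists G|].
  exact: parallel_chart ch _ _ efree.
have [q cq] := cell_nonempty c; exists #|cdirs c|, (@chart c q).
have [F eF] := chart_onto cq leac; have [G eG] := chart_onto cq lebc.
exists F, G; split=> //; first exact: chartP.
have [_ dF] := chartE cq F; have [_ dG] := chartE cq G.
by apply/setP=> i; rewrite !inE -!mem_free_dirs -dF -dG eF eG eab.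
Qed.

(** * Links of the vertices in terms of labels *)

Definition base (c : cell) : vtx X := xchoose (cell_nonempty c).

Lemma baseP c : base c \in val c. Proof. exact: xchooseP. Qed.

Definition lq (p : links cell) : vtx X := base (link_vertex p).
Definition ldir (p : links cell) : {set dir X} := cdirs (link_cell p).

Implicit Types p z w : links cell.

Lemma cell_vertex (c : cell) q : q \in val c -> cdirs c = set0 -> val c = [set q].
Proof.
move=> cq e; have [_ ->] := cell_cube cq; apply/setP=> x; rewrite e inE.
apply/cubeP/eqP => [[T]|->]; first by rewrite subset0 => /eqP->; rewrite flips0.
by exists set0; rewrite ?flips0.
Qed.

Lemma link_vertexE p : cdirs (link_vertex p) = set0 /\ val (link_vertex p) = [set lq p].
Proof.
have /andP[dim0 _] := valP p; have e : cdirs (link_vertex p) = set0.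
  by apply/eqP; rewrite -cards_eq0 -cell_dimE.
by split=> //; apply: cell_vertex e; apply: baseP.
Qed.

Lemma lqP p : lq p \in val (link_cell p).
Proof.
have /andP[_ /ltW] := valP p; rewrite -/(link_vertex p) -/(link_cell p).
by rewrite (cell_leE _ (baseP _)) => /andP[].
Qed.

Lemma ldir_nonempty p : ldir p != set0.
Proof. have /andP[_ /cdirs_lt lt] := valP p; rewrite -card_gt0; exact: leq_ltn_trans lt. Qed.

Lemma ldir_clique p : clique (lq p) (ldir p).
Proof. by have [] := cell_cube (lqP p). Qed.

Lemma link_cellE p : val (link_cell p) = cube (lq p) (ldir p).
Proof. by have [] := cell_cube (lqP p). Qed.

Lemma link_cell_le p p' : lq p \in val (link_cell p') ->
  (link_cell p <= link_cell p')%O = (ldir p \subset ldir p').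
Proof. by move=> H; rewrite (cell_leE _ (lqP p)) H. Qed.

Lemma links_leE p p' : (p <= p')%O = (lq p == lq p') && (ldir p \subset ldir p').
Proof.
rewrite -[LHS]/((link_vertex p == link_vertex p') && (link_cell p <= link_cell p')%O).
have [e0 e] := link_vertexE p; have [e0' e'] := link_vertexE p'.
have -> : (link_vertex p == link_vertex p') = (lq p == lq p').
  by rewrite -val_eqE e e' (inj_eq set1_inj).
by case: eqP => // eq; rewrite link_cell_le ?eq ?lqP.
Qed.

Lemma link_ext p p' : lq p = lq p' -> ldir p = ldir p' -> p = p'.
Proof. by move=> eq ed; apply/le_anti; rewrite !links_leE eq ed eqxx subxx. Qed.

Lemma link_exists q C : clique q C -> C != set0 -> exists2 p, lq p = q & ldir p = C.
Proof.
move=> cl nC; have [c cq ec] := exists_cell cl.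
have [v [vq ev le]] := cell_face cq (sub0set _).
have h : (cell_dim (v, c).1 == 0) && ((v, c).1 < (v, c).2)%O.
  rewrite cell_dimE /= ev cards0 eqxx lt_neqAle le andbT /=.
  by apply: contraNneq nC => e; rewrite -ec -e ev.
exists (Links h) => //; have [_] := link_vertexE (Links h).
by rewrite /= /link_vertex /= (cell_vertex vq ev) => /set1_inj.
Qed.

Lemma links_dimE p : cell_dim p = #|ldir p|.-1.
Proof.
apply: (@cell_dim_rank _ (links cell) (fun p => #|ldir p|.-1)) => [a b|{}p].
  rewrite lt_neqAle links_leE => /and3P[ne /eqP eq sub].
  have : ldir a \proper ldir b.
    rewrite properEneq sub andbT; apply: contra ne => /eqP ed.
    by apply/eqP/link_ext.
  move/proper_card; have := ldir_nonempty a; rewrite -card_gt0; lia.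
move=> dp; have /card_gt0P[A pA] : 0 < #|ldir p| by lia.
have cD := cardsD1 A (ldir p); rewrite pA add1n in cD.
have [||p' eq ed] := @link_exists (lq p) (ldir p :\ A).
- exact: cliqueS (subsetDl _ _) (ldir_clique p).
- by rewrite -card_gt0; lia.
exists p'; last by rewrite ed; lia.
rewrite lt_neqAle links_leE eq ed eqxx subsetDl !andbT.
by apply: contraTneq pA => <-; rewrite ed setD11.
Qed.

Lemma same_link_cell p p' : lq p' \in val (link_cell p) -> ldir p' = ldir p ->
  link_cell p' = link_cell p.
Proof. by move=> H1 H2; apply: (cell_eq (lqP p')). Qed.

Lemma reverse_edgeE z A : ldir z = [set A] ->
  lq (reverse_edge z) = flip A (lq z) /\ ldir (reverse_edge z) = [set A].
Proof.
move=> ez; have cl := ldir_clique z; have [dC _] := cliqueP _ _ cl.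
have zA : A \in ldir z by rewrite ez set11.
have neq : flip A (lq z) != lq z.
  apply: contraT; rewrite negbK => /eqP e; have := parity_flip (dC _ zA); rewrite e.
  by move/setP/(_ A); rewrite in_symd inE eqxx; case: (_ \in _).
have vE p : (link_vertex p == link_vertex z) = (lq p == lq z).
  have [_ e] := link_vertexE p; have [_ e'] := link_vertexE z.
  by rewrite -val_eqE e e' (inj_eq set1_inj).
rewrite /reverse_edge; case: pickP => [p /andP[/eqP ec]|no] /=.
  rewrite vE => ne; have ed : ldir p = ldir z by rewrite /ldir ec.
  split; last by rewrite ed.
  have := lqP p; rewrite ec link_cellE ez => /cubeP[T].
  rewrite subset1 => /orP[]/eqP-> e; last by rewrite e flips0 eqxx in ne.
  by rewrite e /flips enum_set1.
have [p ep1 ep2] := link_exists (clique_flip cl zA) (ldir_nonempty z).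
have pz : lq p \in val (link_cell z) by rewrite ep1 link_cellE flip_in_cube.
by have := no p; rewrite vE ep1 neq andbT (same_link_cell pz ep2) eqxx.
Qed.

(** Parallel edges of a cube are those with equal labels, so the transport along the edge [A] keeps
    the labels of a simplex and only replaces its vertex by the other end. *)
Lemma edge_transportE z w w' A : ldir z = [set A] -> w \in star z ->
  (edge_transport z w w' <-> lq w' = flip A (lq z) /\ ldir w' = ldir w).
Proof.
move=> ez; rewrite inE => /existsP[p0 /andP[]]; rewrite !links_leE.
move=> /andP[/eqP ep0 s0] /andP[/eqP ew0 s1].
have [rq rd] := reverse_edgeE ez.
have link1 q C B : clique q C -> B \in C -> exists p, [/\ lq p = q, ldir p = [set B] & cell_dim p = 0].
  move=> cl CB; have [||p e1 e2] := @link_exists q [set B].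
  - by apply: cliqueS cl; rewrite sub1set.
  - by apply/set0Pn; exists B; rewrite inE.
  by exists p; rewrite links_dimE e2 cards1.
have dim0 v : cell_dim v = 0 -> exists B, ldir v = [set B].
  rewrite links_dimE => e; apply/cards1P; have := ldir_nonempty v; rewrite -card_gt0.
  by case: #|_| e => // -[].
split=> [[p [p' [epp']]]|[ew' ed]].
  rewrite !links_leE => /andP[/andP[/eqP zp szp] /andP[/eqP wp swp]].
  move=> /andP[/andP[/eqP zp' szp'] /andP[/eqP wp' swp']] H.
  have eq' : lq w' = flip A (lq z) by rewrite wp' -zp' rq.
  split=> //; have edp : ldir p' = ldir p by rewrite /ldir epp'.
  apply/setP=> B; apply/idP/idP => [wB|wB].
    have [v' [q1 d1 dim1]] := link1 _ _ _ (ldir_clique w') wB.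
    have [|v [dimv]] := proj1 (H v' dim1); first by rewrite links_leE q1 eqxx d1 sub1set.
    rewrite links_leE => /andP[_ svw] [_ /parallelP[_ _ e]].
    by apply: (subsetP svw); rewrite /ldir e -/(ldir v') d1 set11.
  have [v [q1 d1 dim1]] := link1 _ _ _ (ldir_clique w) wB.
  have p'B : B \in ldir p' by rewrite edp (subsetP swp).
  have [v' [q2 d2 dim2]] := link1 _ _ _ (ldir_clique p') p'B.
  suff : (v' <= w')%O by rewrite links_leE d2 sub1set => /andP[].
  apply/(H v' dim2); exists v; rewrite dim1 links_leE q1 eqxx d1 sub1set wB; split=> //.
  have ve : link_vertex v' = link_vertex p'.
    apply/val_inj; have [_ ->] := link_vertexE v'; have [_ ->] := link_vertexE p'.
    by rewrite q2.
  split=> //; apply/parallelP; split.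
  - by rewrite link_cell_le ?d1 ?sub1set ?(subsetP swp) // q1 wp lqP.
  - by rewrite -epp' link_cell_le ?d2 ?sub1set // q2 lqP.
  - by rewrite -[LHS]/(ldir v) d1 -d2.
have zA : A \in ldir p0 by rewrite (subsetP s0) // ez set11.
have [p' ep' edp'] := link_exists (clique_flip (ldir_clique p0) zA) (ldir_nonempty p0).
have ecell : link_cell p' = link_cell p0.
  by apply: same_link_cell; rewrite // ep' link_cellE flip_in_cube // ldir_clique.
exists p0, p'; split=> //.
- by rewrite !links_leE ep0 s0 s1 ew0 eqxx.
- by rewrite !links_leE rq rd ep' ep0 eqxx sub1set edp' zA ew' ep0 eqxx ed.
move=> v' dimv'; have [B eB] := dim0 v' dimv'; split.
  rewrite links_leE eB sub1set ed => /andP[/eqP ev' wB].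
  have [v [q1 d1 dim1]] := link1 _ _ _ (ldir_clique w) wB.
  exists v; rewrite dim1 links_leE q1 d1 eqxx sub1set wB; split=> //; split.
    apply/val_inj; have [_ ->] := link_vertexE v'; have [_ ->] := link_vertexE p'.
    by rewrite ev' ew' ep' ep0.
  apply/parallelP; split.
  - by rewrite link_cell_le ?d1 ?sub1set ?(subsetP s1) // q1 ew0 lqP.
  - rewrite -ecell link_cell_le ?eB ?sub1set ?edp' ?(subsetP s1) //.
    by rewrite ev' ew' ep0 -ep' lqP.
  - by rewrite -[LHS]/(ldir v) d1 -eB.
move=> [v [dimv]]; rewrite links_leE => /andP[/eqP evw svw] [ve /parallelP[_ _ e]].
rewrite links_leE ed -[ldir v']e svw andbT ew' ep0 -ep'.
have [_ e1] := link_vertexE v'; have [_ e2] := link_vertexE p'.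
by rewrite -(inj_eq set1_inj) -e1 -e2 ve.
Qed.

End Cubes.

(** * Flags of cubes: a vertex and an ordering of labels *)

Section CubeFlags.

Variables (X : flip_system) (n : nat).
Implicit Types (a c : cell X) (x y : vtx X) (l : seq (dir X)) (C : {set dir X}).

(** The flag starting at [x] that adds the labels of [l] one by one; by [flag_mkflag] every flag has
    this form. The cell [c0] is only the default of [mkcell]. *)
Definition mkflag c0 x l : n.+1.-tuple (cell X) :=
  [tuple mkcell c0 x [set z in take i l] | i < n.+1].

Lemma clique_take x l i : clique x [set z in l] -> clique x [set z in take i l].
Proof. by apply: cliqueS; apply/subsetP=> z; rewrite !inE => /mem_take. Qed.

Lemma mkflagE c0 x l (i : 'I_n.+1) : clique x [set z in l] ->
  x \in val (tnth (mkflag c0 x l) i) /\ cdirs (tnth (mkflag c0 x l) i) = [set z in take i l].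
Proof. by move=> cl; rewrite tnth_mktuple; apply: mkcellP; apply: clique_take. Qed.

Lemma mkflag_flag c0 x l : clique x [set z in l] -> uniq l -> size l = n -> is_flag (mkflag c0 x l).
Proof.
move=> cl ul sl; apply/is_flagP; split=> [i j le_ij|i].
  have [xi ei] := mkflagE c0 i cl; have [xj ej] := mkflagE c0 j cl.
  rewrite (cell_leE _ xi) xj ei ej /=; apply/subsetP=> z; rewrite !inE -(subnKC le_ij) takeD mem_cat.
  by move->.
have [_ ei] := mkflagE c0 i cl.
rewrite cell_dimE ei card_set_uniq ?take_uniq // size_take_min sl.
by apply/minn_idPl; rewrite -ltnS.
Qed.

Lemma mkflag_last c0 x l : clique x [set z in l] -> size l = n ->
  x \in val (tnth (mkflag c0 x l) ord_max) /\ cdirs (tnth (mkflag c0 x l) ord_max) = [set z in l].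
Proof. by move=> cl sl; have [? ->] := mkflagE c0 ord_max cl; rewrite take_oversize //= sl. Qed.

Lemma flag_mkflag c0 x (t : n.+1.-tuple (cell X)) : is_flag t -> x \in val (tnth t ord0) ->
  exists l, [/\ uniq l, size l = n, clique x [set z in l],
    [set z in l] = cdirs (tnth t ord_max) & t = mkflag c0 x l].
Proof.
move=> /is_flagP[le_t dim_t] x0.
have xt i : x \in val (tnth t i) by apply: (subsetP (le_t ord0 i (leq0n i))).
have sub (i j : 'I_n.+1) : i <= j -> cdirs (tnth t i) \subset cdirs (tnth t j).
  by move=> /le_t; rewrite (cell_leE _ (xt i)) => /andP[].
pose F := [set cdirs (tnth t i) | i : 'I_n.+1].
have nF : all_nested F.
  apply/all_nestedP=> _ _ /imsetP[i _ ->] /imsetP[j _ ->]; apply/orP.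
  by case/orP: (leq_total i j) => /sub; [left|right].
have sF : {in F, forall A : {set dir X}, A \subset cdirs (tnth t ord_max)}.
  by move=> _ /imsetP[i _ ->]; apply: sub; rewrite -ltnS.
have [l [ul el pl]] := nested_prefix_seq nF sF.
have sl : size l = n by rewrite -card_set_uniq // el -cell_dimE dim_t.
have cl : clique x [set z in l] by rewrite el; have [] := cell_cube (xt ord_max).
exists l; split=> //; apply: eq_from_tnth => i; have [xi ei] := mkflagE c0 i cl.
apply: (cell_eq (xt i) xi); rewrite ei.
have /pl/eqP : cdirs (tnth t i) \in F by apply: imset_f.
by rewrite -cell_dimE dim_t.
Qed.

Variables (a : cell X) (h : n.+1.-tuple (cell X) -> int).
Hypothesis h_cube : forall (i : 'I_n.+1) t u, (i < n)%N -> is_flag_over a t -> is_flag_over a u ->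
  differ_only_at i t u -> h t = h u.

Lemma flag_over_last k (t : k.+1.-tuple (cell X)) : is_flag t -> is_flag_over a t = (a <= tnth t ord_max)%O.
Proof.
move=> ft; have [le_t _] := is_flagP _ ft; rewrite /is_flag_over ft.
apply/hasP/idP => [[c /tnthP[i ->] le_a]|le_a]; last by exists (tnth t ord_max); rewrite ?mem_tnth.
by apply: le_trans le_a (le_t _ _ _); rewrite -ltnS.
Qed.

Lemma mkflag_over c0 x l : clique x [set z in l] -> uniq l -> size l = n -> x \in val a ->
  is_flag_over a (mkflag c0 x l) = (cdirs a \subset [set z in l]).
Proof.
move=> cl ul sl ax; have [xl el] := mkflag_last c0 cl sl.
by rewrite flag_over_last ?mkflag_flag // (cell_leE _ ax) xl el.
Qed.

Lemma mkflag_swap c0 x p1 v w p2 : clique x [set z in p1 ++ v :: w :: p2] ->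
  uniq (p1 ++ v :: w :: p2) -> size (p1 ++ v :: w :: p2) = n ->
  is_flag_over a (mkflag c0 x (p1 ++ v :: w :: p2)) ->
  h (mkflag c0 x (p1 ++ v :: w :: p2)) = h (mkflag c0 x (p1 ++ w :: v :: p2)).
Proof.
set l := p1 ++ _; set l' := p1 ++ w :: _ => cl ul sl ft.
have pl : perm_eq l' l by apply: perm_swap.
have el : [set z in l'] = [set z in l] by apply/setP=> z; rewrite !inE (perm_mem pl).
have cl' : clique x [set z in l'] by rewrite el.
have lt_i : (size p1).+1 < n.+1.
  by rewrite ltnS -sl /l size_cat /= !addnS ltnS leqW ?leq_addr.
have ul' : uniq l' by rewrite (perm_uniq pl).
have sl' : size l' = n by rewrite (perm_size pl).
have fu : is_flag_over a (mkflag c0 x l').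
  have [xl e1] := mkflag_last c0 cl sl; have [xl' e2] := mkflag_last c0 cl' sl'.
  rewrite flag_over_last ?mkflag_flag //.
  rewrite (_ : tnth _ ord_max = tnth (mkflag c0 x l) ord_max) -?flag_over_last ?mkflag_flag //.
  by apply: (cell_eq xl' xl); rewrite e1 e2.
apply: (@h_cube (Ordinal lt_i)) => //.
  by rewrite /= -sl /l size_cat /= !addnS !ltnS leq_addr.
move=> j; have [xj ej] := mkflagE c0 j cl; have [xj' ej'] := mkflagE c0 j cl'.
have -> : (tnth (mkflag c0 x l) j == tnth (mkflag c0 x l') j) = ([set z in take j l] == [set z in take j l']).
  by apply/eqP/eqP => [e|e]; [rewrite -ej -ej' e|apply: (cell_eq xj xj'); rewrite ej ej'].
rewrite -[j != _]/(nat_of_ord j != (size p1).+1) /l /l' !take_cat; case: ltnP => [lt|le].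
  by rewrite eqxx ltn_eqF // ltnW.
have := subnKC le; case: (j - size p1) => [|[|k]] /= <-.
- by rewrite addn0 eqxx ltn_eqF.
- rewrite ?take0 addn1 eqxx; apply/eqP=> /setP/(_ v); rewrite !inE !mem_cat !inE eqxx orbT.
  move: ul; rewrite /l cat_uniq /= !inE !negb_or => /and3P[_ /andP[/negPf-> _] /andP[/andP[/negPf-> _] _]].
  by [].
- rewrite !addnS !eqSS gtn_eqF ?leq_addr //; apply/eqP/setP=> z; rewrite !inE !mem_cat !inE.
  by congr orb; rewrite orbCA.
Qed.

Lemma mkflag_perm c0 x l l' : clique x [set z in l] -> uniq l -> size l = n -> perm_eq l' l ->
  is_flag_over a (mkflag c0 x l) -> h (mkflag c0 x l) = h (mkflag c0 x l').
Proof.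
move=> cl ul sl pl ft.
apply: (@bubble_sort _ _ set0 l (fun l => h (mkflag c0 x l))) => //; try by move=> A; rewrite inE.
move=> p1 v w p2 p _ _.
have el : [set z in p1 ++ v :: w :: p2] = [set z in l] by apply/setP=> z; rewrite !inE (perm_mem p).
have sl' : size (p1 ++ v :: w :: p2) = n by rewrite (perm_size p).
have ul' : uniq (p1 ++ v :: w :: p2) by rewrite (perm_uniq p).
have cl' : clique x [set z in p1 ++ v :: w :: p2] by rewrite el.
apply: mkflag_swap => //.
have [xl e1] := mkflag_last c0 cl sl; have [xl' e2] := mkflag_last c0 cl' sl'.
rewrite flag_over_last ?mkflag_flag //.
rewrite (_ : tnth _ ord_max = tnth (mkflag c0 x l) ord_max) -?flag_over_last ?mkflag_flag //.
by apply: (cell_eq xl' xl); rewrite e1 e2.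
Qed.

(** Once [A] is moved to the front, [x] and [flip A x] lie on the first edge, so the two flags
    differ only in their vertex. *)
Lemma mkflag_flip c0 x l A : clique x [set z in l] -> uniq l -> size l = n -> A \in l ->
  is_flag_over a (mkflag c0 x l) -> h (mkflag c0 x l) = h (mkflag c0 (flip A x) l).
Proof.
move=> cl ul sl Al ft; have := perm_to_rem Al; set l1 := A :: rem A l => pl1.
have e1 : [set z in l1] = [set z in l] by apply/setP=> z; rewrite !inE (perm_mem pl1) inE.
have setA : A \in [set z in l] by rewrite inE.
have cl' := clique_flip cl setA.
have ul1 : uniq l1 by rewrite -(perm_uniq pl1).
have sl1 : size l1 = n by rewrite -(perm_size pl1).
have cl1 : clique x [set z in l1] by rewrite e1.
have cl1' : clique (flip A x) [set z in l1] by rewrite e1.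
have over y k : clique y [set z in k] -> uniq k -> size k = n -> [set z in k] = [set z in l] ->
    y \in cube x [set z in l] -> is_flag_over a (mkflag c0 y k).
  move=> cly uk sk ek yx; move: ft; rewrite !flag_over_last ?mkflag_flag //.
  have [x1 d1] := mkflag_last c0 cl sl; have [x2 d2] := mkflag_last c0 cly sk.
  rewrite (_ : tnth _ ord_max = tnth (mkflag c0 y k) ord_max) //.
  have [_ ev] := cell_cube x1; apply: (cell_eq _ x2); first by rewrite ev d1.
  by rewrite d1 d2.
rewrite (mkflag_perm cl ul sl _ ft (l' := l1)) 1?perm_sym //.
have fl : is_flag_over a (mkflag c0 (flip A x) l) by apply: over; rewrite ?flip_in_cube.
rewrite (mkflag_perm cl' ul sl _ fl (l' := l1)) 1?perm_sym //.
have n0 : 0 < n by rewrite -sl1.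
apply: (@h_cube ord0) => //; try by apply: over; rewrite ?cube_refl ?flip_in_cube.
have [dC _] := cliqueP _ _ cl.
have nx : flip A x != x.
  apply: contraT; rewrite negbK => /eqP e; have := parity_flip (dC _ setA); rewrite e.
  by move/setP/(_ A); rewrite in_symd inE eqxx; case: (_ \in _).
move=> j; have [xj ej] := mkflagE c0 j cl1; have [xj' ej'] := mkflagE c0 j cl1'.
have [->|j0] := eqVneq j ord0; rewrite ?eqxx /=.
  have [x0 e0] := mkflagE c0 ord0 cl1; have [x0' e0'] := mkflagE c0 ord0 cl1'.
  apply: contraNF nx => /eqP ec; rewrite -ec in x0'; rewrite take0 in e0.
  by move: x0'; rewrite (cell_vertex x0) ?inE // e0; apply/setP=> z; rewrite !inE.
apply/eqP/(cell_eq _ xj'); last by rewrite ej ej'.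
have [clj evj] := cell_cube xj; rewrite evj flip_in_cube // ej inE.
case: j j0 {xj ej xj' ej' clj evj} => [[|j] lt_j] //= _.
exact: mem_head.
Qed.

(** Orderings are connected by adjacent exchanges and the vertices of a cube by flips; hence [h]
    depends on the top cell only. *)
Lemma h_same_last c0 x y l l' : clique x [set z in l] -> uniq l -> size l = n -> uniq l' ->
  [set z in l] = [set z in l'] -> y \in cube x [set z in l] ->
  is_flag_over a (mkflag c0 x l) -> h (mkflag c0 x l) = h (mkflag c0 y l').
Proof.
move=> cl ul sl ul' ell' yx ft.
have pl : perm_eq l' l by apply: uniq_perm => // z; move/setP/(_ z): ell'; rewrite !inE.
have over z : z \in cube x [set z in l] -> is_flag_over a (mkflag c0 z l).
  move=> zx; move: ft; have clz := clique_cube cl zx; rewrite !flag_over_last ?mkflag_flag //.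
  have [x1 d1] := mkflag_last c0 cl sl; have [x2 d2] := mkflag_last c0 clz sl.
  rewrite (_ : tnth _ ord_max = tnth (mkflag c0 z l) ord_max) //.
  have [_ ev] := cell_cube x1; apply: (cell_eq _ x2); first by rewrite ev d1.
  by rewrite d1 d2.
rewrite -(mkflag_perm (clique_cube cl yx) ul sl pl (over _ yx)).
have /cubeP[T sT ->] := yx; rewrite /flips.
have sub : {subset enum T <= [set z in l]} by move=> A; rewrite mem_enum => /(subsetP sT).
elim: (enum T) sub => //= A s IH sub.
have sub' : {subset s <= [set z in l]} by move=> B sB; apply: sub; rewrite inE sB orbT.
rewrite (IH sub'); apply: mkflag_flip => //; first exact: clique_foldr.
  by have := sub A (mem_head _ _); rewrite inE.
apply: over; elim: s sub' {IH sub} => [_|B s IH sub] /=; first exact: cube_refl.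
have sub' : {subset s <= [set z in l]} by move=> B' sB; apply: sub; rewrite inE sB orbT.
rewrite -(cube_eq cl (IH sub')); apply: flip_in_cube; first exact: clique_foldr.
by apply: sub; apply: mem_head.
Qed.

End CubeFlags.

(** The top cells over [a] all contain [x], so they are given by their labels at [x], and crossing a
    ridge over [a] replaces one label. Connectedness thus becomes a question about label sets at one
    vertex. *)
Lemma star_connected_cell (X : flip_system) n (a : cell X) x : x \in val a ->
  (forall H : {set dir X} -> int,
     let full C := [&& clique x C, #|C| == n.+1 & cdirs a \subset C] in
     (forall C1 C2 : {set dir X}, full C1 -> full C2 -> #|C1 :&: C2| = n -> H C1 = H C2) ->
     forall C1 C2 : {set dir X}, full C1 -> full C2 -> H C1 = H C2) ->
  star_connected n.+1 a.
Proof.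
move=> ax conn h h1 h2.
have setE (C : {set dir X}) : [set z in enum C] = C by apply/setP=> z; rewrite inE mem_enum.
pose H (C : {set dir X}) := h (mkflag n.+1 a x (enum C)).
have hH t : is_flag_over a t -> exists2 C : {set dir X},
    [&& clique x C, #|C| == n.+1 & cdirs a \subset C] & h t = H C.
  move=> ft; have /andP[flt _] := ft.
  have := ft; rewrite flag_over_last // (cell_leE _ ax) => /andP[tx sa].
  have [l [ul sl cl el et]] := flag_mkflag a flt (baseP (tnth t ord0)).
  set y := base _ in cl et; have [cx ec] := cell_cube tx.
  exists (cdirs (tnth t ord_max)); first by rewrite cx sa -el card_set_uniq // sl eqxx.
  have [ly ey] := mkflag_last a cl sl.
  have xy : x \in cube y [set z in l].
    by have [_] := cell_cube ly; rewrite ey => <-; rewrite -et.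
  rewrite {1}et; apply: (h_same_last h1) => //; rewrite ?enum_uniq ?setE //.
  by rewrite -et.
move=> t u /hH[C1 f1 ->] /hH[C2 f2 ->]; apply: conn f1 f2 => {}C1 {}C2 f1 f2 cI.
have /and3P[cl1 /eqP c1 s1] := f1; have /and3P[cl2 /eqP c2 s2] := f2.
set D := C1 :&: C2 in cI.
have sD : cdirs a \subset D by rewrite subsetI s1 s2.
have ext C : clique x C -> #|C| = n.+1 -> D \subset C -> exists2 A, A \notin D & C = A |: D.
  move=> cl cC sDC; have /cards1P[A eA] : #|C :\: D| == 1.
    by rewrite cardsD (setIidPr sDC) cC cI subSnn.
  have /setDP[CA DA] : A \in C :\: D by rewrite eA set11.
  by exists A => //; rewrite -eA setUC -{1}(setIidPr sDC) setID.
have [A1 nA1 e1] := ext C1 cl1 c1 (subsetIl _ _).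
have [A2 nA2 e2] := ext C2 cl2 c2 (subsetIr _ _).
have setR A : [set z in rcons (enum D) A] = A |: D.
  by apply/setP=> z; rewrite in_set mem_rcons in_cons mem_enum in_setU1.
have uR A : A \notin D -> uniq (rcons (enum D) A) by rewrite rcons_uniq enum_uniq mem_enum => ->.
have sR A : size (rcons (enum D) A) = n.+1 by rewrite size_rcons -cardE cI.
have HE C A : clique x C -> C = A |: D -> A \notin D -> #|C| = n.+1 -> cdirs a \subset C ->
    H C = h (mkflag n.+1 a x (rcons (enum D) A)).
  move=> cl eC nA cC sC; have sz : size (enum C) = n.+1 by rewrite -cardE.
  apply: (h_same_last h1); rewrite ?setE ?setR ?enum_uniq ?uR ?cube_refl //.
  by rewrite mkflag_over ?setE ?enum_uniq.
rewrite (HE C1 A1) // (HE C2 A2) //.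
(* A flag of the common ridge, spanned by the shared labels [D]; its extensions by the two top cells
   are compared. *)
pose r : n.+1.-tuple (cell X) := [tuple mkcell a x [set z in take i (enum D)] | i < n.+1].
have rE A : clique x (A |: D) -> mkflag n.+1 a x (rcons (enum D) A) =
    [tuple of rcons r (mkcell a x (A |: D))].
  move=> cl; apply: eq_from_tnth => i; rewrite tnth_mktuple (tnth_nth a) /= nth_rcons size_tuple card_ord.
  case: ltngtP => [lt|gt|ei].
  - have le_i : i <= size (enum D) by rewrite -cardE cI; move: lt; rewrite ltnS.
    rewrite -cats1 takel_cat //.
    by rewrite -[nat_of_ord i]/(nat_of_ord (Ordinal lt)) -(tnth_nth a r (Ordinal lt)) tnth_mktuple.
  - by have := ltn_ord i; rewrite ltnS leqNgt gt.
  - by rewrite ei -(sR A) take_size setR.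
rewrite !rE -?e1 -?e2 //; have clD : clique x [set z in enum D].
  by apply: cliqueS cl1; rewrite setE subsetIl.
have szD : size (enum D) = n by rewrite -cardE.
apply: h2.
- have -> : r = mkflag n a x (enum D) by [].
  by rewrite mkflag_over ?enum_uniq // setE.
- by rewrite e1 -rE -?e1 //; apply: mkflag_flag; rewrite ?setR ?uR -?e1.
- by rewrite e2 -rE -?e2 //; apply: mkflag_flag; rewrite ?setR ?uR -?e2.
Qed.

(** * Chains of simplices of a pseudo-manifold *)

Section SimplicialPseudomanifold.

Variables (m : nat) (V : finType) (K : {set {set V}}).
Hypothesis hK : simplicial_complex K.
Implicit Types (A B R : {set V}) (C : {set {set V}}) (a b : simplex K).

Lemma K_nonempty A : A \in K -> A != set0.
Proof. by apply: contraTneq => ->; have [] := hK. Qed.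

Lemma K_sub A B : A \in K -> B \subset A -> B != set0 -> B \in K.
Proof. by have [_ _ h] := hK => KA sBA nB; apply: h sBA nB. Qed.

Lemma simplex_leE a b : (a <= b)%O = (val a \subset val b). Proof. by []. Qed.

Lemma simplex_of A : A \in K -> exists a : simplex K, val a = A.
Proof. by move=> KA; exists (Simplex KA). Qed.

Lemma simplex_ltE a b : (a < b)%O = (val a \proper val b).
Proof. by rewrite lt_neqAle properEneq simplex_leE val_eqE. Qed.

Lemma simplex_pred a : 0 < #|val a|.-1 -> exists2 b, (b < a)%O & (#|val b|.-1).+1 = #|val a|.-1.
Proof.
move=> da; have /card_gt0P[v av] : 0 < #|val a| by lia.
have cD := cardsD1 v (val a); rewrite av add1n in cD.
have [|b eb] := simplex_of (K_sub (valP a) (subsetDl _ [set v]) _).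
  by rewrite -card_gt0; lia.
exists b; last by rewrite eb; lia.
by rewrite simplex_ltE eb properEcard subsetDl; lia.
Qed.

Lemma simplex_dim a : cell_dim a = #|val a|.-1.
Proof.
apply: (@cell_dim_rank _ (simplex K) (fun a => #|val a|.-1)) => [b c|]; last exact: simplex_pred.
by rewrite simplex_ltE => /proper_card; have := K_nonempty (valP b); rewrite -card_gt0; lia.
Qed.

Lemma simplex_card a : #|val a| = (cell_dim a).+1.
Proof. by rewrite simplex_dim prednK // card_gt0 (K_nonempty (valP a)). Qed.

Lemma simplex_flagP k (t : k.-tuple (simplex K)) :
  is_flag t <-> (forall i j : 'I_k, i <= j -> val (tnth t i) \subset val (tnth t j)) /\
                (forall i : 'I_k, #|val (tnth t i)| = i.+1).
Proof.
split=> [/is_flagP[le_t dim_t]|[le_t card_t]].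
  split=> [i j|i]; first exact: le_t.
  by rewrite simplex_card dim_t.
by apply/is_flagP; split=> // i; rewrite simplex_dim card_t.
Qed.

Hypothesis hY : pseudomanifold (simplex K) m.
Variable oY : m.+1.-tuple (simplex K) -> bool.
Hypothesis hoY : is_orientation oY.

Lemma K_facet A : A \in K -> exists B, [/\ B \in K, A \subset B & #|B| = m.+1].
Proof.
move=> KA; have [hpure _ _] := hY; have [a ea] := simplex_of KA.
have [b leab dimb] := hpure a; exists (val b); rewrite -ea; split=> //; first exact: valP.
by rewrite simplex_card dimb.
Qed.

Lemma K_card A : A \in K -> 0 < #|A| <= m.+1.
Proof.
move=> KA; rewrite card_gt0 K_nonempty //=.
by have [B [_ sAB <-]] := K_facet KA; apply: subset_leq_card.
Qed.

Lemma K_ridge A : A \in K -> #|A| = m -> #|[set B in K | (A \subset B) && (#|B| == m.+1)]| = 2.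
Proof.
move=> KA cA; have [_ htwo _] := hY; have [a ea] := simplex_of KA.
have cA0 : 0 < m by rewrite -cA card_gt0 K_nonempty.
have <- := htwo a; last by rewrite simplex_dim ea cA prednK.
rewrite -[RHS](card_imset _ (@val_inj _ _ (simplex K))).
apply: eq_card => B; rewrite inE.
apply/and3P/imsetP => [[KB sAB cB]|[b]].
  have [b eb] := simplex_of KB; exists b => //.
  by rewrite inE simplex_leE ea eb sAB simplex_dim eb (eqP cB) /=.
rewrite inE simplex_leE ea => /andP[sab /eqP cb] ->; split=> //; first exact: valP.
by rewrite simplex_card cb.
Qed.

Lemma flag_of_facet B : B \in K -> #|B| = m.+1 ->
  exists2 t : m.+1.-tuple (simplex K), is_flag t & val (tnth t ord_max) = B.
Proof.
move=> KB cB; have [b eb] := simplex_of KB.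
have [c||t ft tb] := @flag_exists _ (simplex K) m b.
- by rewrite simplex_dim => /simplex_pred[d ltd ed]; exists d => //; rewrite simplex_dim.
- by rewrite simplex_dim eb cB.
by exists t; rewrite ?tb.
Qed.

(** This is the normality of Y at [S]: the function sending a flag to [h] of its top simplex is
    unchanged by the moves allowed in [star_connected]. *)
Lemma K_star_connected S (h : {set V} -> int) : S \in K ->
  (forall R B B', R \in K -> S \subset R -> #|R| = m -> B \in K -> B' \in K ->
     R \subset B -> R \subset B' -> #|B| = m.+1 -> #|B'| = m.+1 -> h B = h B') ->
  forall B B', B \in K -> B' \in K -> S \subset B -> S \subset B' ->
    #|B| = m.+1 -> #|B'| = m.+1 -> h B = h B'.
Proof.
move=> KS h_ridge; have [_ htwo hloc] := hY; have [s es] := simplex_of KS.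
have dim_le c : cell_dim (c : simplex K) <= m.
  by rewrite simplex_dim; have := K_card (valP c); lia.
have conn := star_connected_of_local_homology hoY dim_le htwo (hloc s).
have flag_of B : B \in K -> S \subset B -> #|B| = m.+1 ->
    exists2 t : m.+1.-tuple (simplex K), is_flag_over s t & val (tnth t ord_max) = B.
  move=> KB sSB cB; have [t ft tb] := flag_of_facet KB cB; exists t => //.
  rewrite /is_flag_over ft; apply/hasP; exists (tnth t ord_max); first exact: mem_tnth.
  by rewrite simplex_leE es tb.
move=> B B' KB KB' sB sB' cB cB'.
have [t ft <-] := flag_of B KB sB cB; have [u fu <-] := flag_of B' KB' sB' cB'.
apply: (conn (fun t => h (val (tnth t ord_max)))) => // [i t' u' lt_im _ _ dtu|r c c'].
  have := dtu ord_max; rewrite [ord_max == i](_ : _ = false) ?negbK => [/eqP-> //|].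
  by apply: contraTF lt_im => /eqP<-; rewrite ltnn.
move=> fr fl fl'; have lastE (d : simplex K) : tnth [tuple of rcons r d] ord_max = d.
  by rewrite (tnth_nth d) /= nth_rcons size_tuple ltnn eqxx.
rewrite !lastE; have /andP[flr /hasP[c0 rc0 le0]] := fr.
have /tnthP[i0 _] := rc0.
have m0 : m.-1 < m by rewrite prednK // (leq_ltn_trans (leq0n i0)).
have [le_r card_r] := (simplex_flagP _).1 flr.
pose R := tnth r (Ordinal m0); have rR : R \in (r : seq _) := mem_tnth _ _.
have cR : #|val R| = m by rewrite card_r /= prednK // (leq_trans _ m0).
move: fl fl'; rewrite !is_flag_rcons => /and3P[_ /allP lt_c /eqP dc] /and3P[_ /allP lt_c' /eqP dc'].
apply: (h_ridge (val R)); rewrite ?cR ?(simplex_card c) ?(simplex_card c') ?dc ?dc' //; try exact: valP.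
- rewrite -es; apply: subset_trans (le0) _; have /tnthP[i ->] := rc0.
  by apply: le_r; rewrite /= -ltnS prednK // (leq_trans _ m0).
- by have := lt_c R rR; rewrite lt_neqAle => /andP[].
- by have := lt_c' R rR; rewrite lt_neqAle => /andP[].
Qed.

(** * Components, and chains of simplices inside a component *)

Variable lam : V -> V.
Hypothesis lamK : involutive lam.
Hypothesis lam_neq : m = 0 -> forall y, lam y != y.

(* In dimension 0 the link of a vertex of a 1-manifold is a pair of points, so *)
(* that the points y and lam y are to be put together.                         *)
Definition adjK A B : bool :=
  [&& A \in K, B \in K & nested A B || ((m == 0) && (B == lam @: A))].

Definition component A : {set V} := fingraph.root adjK A.

Lemma lam_imset A : lam @: (lam @: A) = A.
Proof. by rewrite -imset_comp (eq_imset _ (g := id)) ?imset_id // => x /=; rewrite lamK. Qed.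

Lemma adjK_sym A B : adjK A B = adjK B A.
Proof.
rewrite /adjK nested_sym andbCA; congr [&& _, _ & _ || (_ && _)].
by apply/eqP/eqP => ->; rewrite lam_imset.
Qed.

Lemma adjK_connect_sym : connect_sym adjK.
Proof. by exact: sym_connect_sym adjK_sym. Qed.

Lemma component_root A : component (component A) = component A.
Proof. exact: root_root adjK_connect_sym A. Qed.

Lemma component_nested A B : A \in K -> B \in K -> nested A B -> component A = component B.
Proof.
move=> KA KB nAB; apply/eqP; rewrite /component (root_connect adjK_connect_sym).
by apply: connect1; rewrite /adjK KA KB nAB.
Qed.

Lemma component_in A : A \in K -> component A \in K.
Proof.
move=> KA; have cl : closed adjK K.
  by apply: intro_closed => [|B B' /and3P[]]; [exact: adjK_connect_sym|].
by rewrite -(closed_connect cl (connect_root adjK A)).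
Qed.

Definition good_chain kap C : bool :=
  (C \subset [set A in K | component A == kap]) && all_nested C.

Lemma good_chainP kap C :
  reflect [/\ {in C, forall A, A \in K}, {in C, forall A, component A = kap} & all_nested C] (good_chain kap C).
Proof.
apply: (iffP andP) => [[/subsetP sC nC]|[KC cC nC]]; split=> //.
- by move=> A /sC; rewrite inE => /andP[].
- by move=> A /sC; rewrite inE => /andP[_ /eqP].
- by apply/subsetP=> A CA; rewrite inE KC // cC ?eqxx.
Qed.

Lemma prefixes_good kap l : [set x in l] \in K -> component [set x in l] = kap ->
  good_chain kap (prefixes l).
Proof.
move=> Kl cl; apply/good_chainP; split; last exact: prefixes_nested.
  by move=> A; rewrite inE => /andP[nA pA]; apply: K_sub Kl (prefix_sub pA) nA.
move=> A; rewrite inE => /andP[nA pA]; rewrite -cl; apply: component_nested => //.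
  exact: K_sub Kl (prefix_sub pA) nA.
by rewrite /nested prefix_sub.
Qed.

Lemma good_chain_top kap C : kap \in K -> component kap = kap -> good_chain kap C ->
  exists S, [/\ S \in K, component S = kap, {in C, forall A, A \subset S} & C != set0 -> S \in C].
Proof.
move=> Kk ck /good_chainP[KC cC nC]; have [->|nz] := eqVneq C set0.
  by exists kap; split=> // A; rewrite ?inE ?eqxx.
have [M CM maxM] := all_nested_max nz nC.
by exists M; split=> //; [apply: KC|apply: cC].
Qed.

Lemma good_chain_seq kap C B : good_chain kap C -> B \in K -> {in C, forall A, A \subset B} ->
  component B = kap -> exists l, [/\ uniq l, [set x in l] = B, good_chain kap (prefixes l) & C \subset prefixes l].
Proof.
move=> gC KB sCB cB; have /good_chainP[KC cC nC] := gC.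
have [l [ul el pl]] := nested_prefix_seq nC sCB.
exists l; split=> //; first by apply: prefixes_good; rewrite el.
by apply/subsetP=> A CA; rewrite inE pl // K_nonempty ?KC.
Qed.

Lemma good_chain_extend kap C : kap \in K -> component kap = kap -> good_chain kap C ->
  exists l, [/\ uniq l, size l = m.+1, [set x in l] \in K, good_chain kap (prefixes l) & C \subset prefixes l].
Proof.
move=> Kk ck gC; have [S [KS cS sCS _]] := good_chain_top Kk ck gC.
have [B [KB sSB cB]] := K_facet KS.
have compB : component B = kap by rewrite -cS; apply: component_nested; rewrite // nested_sym /nested sSB.
have [|l [ul el gl sl]] := good_chain_seq gC KB _ compB.
  by move=> A /sCS sAS; apply: subset_trans sSB.
by exists l; split=> //; rewrite ?el // -card_set_uniq // el.
Qed.

Lemma good_chain_card kap C : kap \in K -> component kap = kap -> good_chain kap C -> #|C| <= m.+1.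
Proof.
move=> Kk ck gC; have [l [ul sl _ _ sC]] := good_chain_extend Kk ck gC.
by rewrite -sl -card_prefixes // subset_leq_card.
Qed.

Lemma full_chain_seq kap C : kap \in K -> component kap = kap -> good_chain kap C -> #|C| = m.+1 ->
  exists l, [/\ uniq l, size l = m.+1, [set x in l] \in K & C = prefixes l].
Proof.
move=> Kk ck gC cC; have [l [ul sl Kl _ sC]] := good_chain_extend Kk ck gC.
by exists l; split=> //; apply/eqP; rewrite eqEcard sC card_prefixes // sl cC leqnn.
Qed.

(** All simplices are points, nested points coincide, and only the clause of [adjK] with [lam] joins
    different ones. *)
Lemma component_dim0 y B : m = 0 -> (B \in K) && (component B == component [set y]) = (B \in [set [set y]; [set lam y]]).
Proof.
move=> m0; have [_ K1 _] := hK.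
have sgl A : A \in K -> #|A| = 1 by move=> /K_card; rewrite m0; case: #|A| => [|[]].
have Ky z : [set z] \in K by exact: K1.
have adjy : adjK [set y] [set lam y].
  by rewrite /adjK !Ky m0 imset_set1 !eqxx orbT.
apply/andP/idP => [[KB]|]; last first.
  rewrite !inE => /orP[]/eqP->; rewrite ?Ky ?eqxx //; split=> //.
  by rewrite /component (root_connect adjK_connect_sym) connect1 // adjK_sym.
rewrite /component (root_connect adjK_connect_sym) adjK_connect_sym.
have cl : closed adjK [set [set y]; [set lam y]].
  apply: intro_closed => [|A A' /and3P[KA KA' adj]]; first exact: adjK_connect_sym.
  have eA : nested A A' -> A = A' by move=> nA; apply: nested_card_eq; rewrite ?sgl.
  case/orP: adj => [/eA<- //|/andP[_ /eqP->]].
  by rewrite !inE => /orP[]/eqP->; rewrite imset_set1 ?lamK eqxx ?orbT.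
by move=> con; rewrite -(closed_connect cl con) !inE eqxx.
Qed.

(** Extend [C] to a full chain. If the added member is not the facet, the two completions exchange
    adjacent letters of a word. If it is, they are the two facets at the ridge in [C], or, for m =
    0, the two points of an orbit of [lam]. *)
Lemma codim1_chain_extensions kap C : kap \in K -> component kap = kap -> good_chain kap C -> #|C| = m ->
  #|[set B | (B \notin C) && good_chain kap (B |: C)]| = 2.
Proof.
move=> Kk ck gC cC; have [l [ul sl Kl gl sC]] := good_chain_extend Kk ck gC.
have [A0 lA0 CA0] : exists2 A0, A0 \in prefixes l & A0 \notin C.
  have : ~~ (prefixes l \subset C).
    by apply/negP=> /subset_leq_card; rewrite card_prefixes // sl cC ltnn.
  by case/subsetPn => A0; exists A0.
have eC : C = prefixes l :\ A0.
  apply/eqP; rewrite eqEcard; apply/andP; split.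
    by apply/subsetP=> A CA; rewrite !inE (contraNneq _ CA0) => [|<-//]; move: (subsetP sC _ CA); rewrite inE.
  by have := cardsD1 A0 (prefixes l); rewrite lA0 card_prefixes // sl cC add1n => -[<-].
have [k [lek k0 eA0]] : exists k, [/\ k <= m.+1, 0 < k & A0 = [set x in take k l]].
  move: lA0; rewrite inE => /andP[nA0 /(is_prefixP _ ul)[k lek eA0]].
  exists k; rewrite -sl; split=> //; rewrite lt0n.
  by apply: contraNneq nA0 => k0; rewrite eA0 k0 take0; apply/eqP/setP=> x; rewrite !inE.
have compl : component [set x in l] = kap.
  have /good_chainP[_ h _] := gl; apply: h; rewrite inE K_nonempty //=.
  exact: is_prefix_self.
move: lek; rewrite leq_eqVlt => /predU1P[ek|]; last first.
  rewrite ltnS => lekm.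
  (* The missing segment has length k <= m, so it ends between two consecutive letters v and w. *)
  have [x [v [w [y [el sx]]]]] : exists x v w y, l = x ++ v :: w :: y /\ (size x).+1 = k.
    have s1 : k.-1 < size l by lia.
    have s2 : k < size l by lia.
    have [v0 _] : exists v0, v0 \in l by case: (l) s1 => // v0 l0 _; exists v0; exact: mem_head.
    exists (take k.-1 l), (nth v0 l k.-1), (nth v0 l k), (drop k.+1 l).
    rewrite size_take s1 prednK //; split=> //.
    by rewrite -(drop_nth v0 s2) -{3}(prednK k0) -(drop_nth v0 s1) cat_take_drop.
  have eA0' : A0 = [set z in rcons x v].
    by rewrite eA0 el -sx -cat_rcons takel_cat ?size_rcons // take_oversize ?size_rcons.
  have ul' := ul; rewrite el in ul'.
  have cdim := codim1_extensions _ ul'; rewrite -el -eA0' -eC in cdim.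
  have sxy : (size x + size y).+2 = m.+1 by rewrite -sl el size_cat /= !addnS.
  have -> : [set B | (B \notin C) && good_chain kap (B |: C)] = [set A0; [set z in rcons x w]].
    apply/setP=> B; rewrite inE -cdim sxy; apply/andP/and4P => [[nB /good_chainP[KB _ nBC]]|[nz nB nBC cB]].
      have {}KB : B \in K by apply: KB; rewrite setU11.
      by split=> //; [apply: K_nonempty|have /andP[] := K_card KB].
    split=> //; have sBl : B \subset [set x in l].
      have : B \in [set A0; [set z in rcons x w]] by rewrite -cdim nz nB nBC sxy cB.
      rewrite in_set2 => /orP[]/eqP->.
        by apply: prefix_sub; move: lA0; rewrite inE => /andP[].
      apply/subsetP=> z; rewrite el !inE mem_rcons inE mem_cat !inE.
      by case/orP=> ->; rewrite ?orbT.
    have KB : B \in K by apply: K_sub Kl sBl nz.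
    have /good_chainP[KC compC _] := gC.
    apply/good_chainP; split=> // A; rewrite in_setU1 => /predU1P[->|CA] //; first exact: KC.
      by rewrite -compl; apply: component_nested; rewrite // /nested sBl.
    exact: compC.
  rewrite cards2 eA0'; case: eqP => // /setP/(_ v); rewrite !inE !mem_rcons mem_head inE.
  by move: ul'; rewrite cat_uniq /= !inE !negb_or => /and3P[_ /andP[/negPf-> _] /andP[/andP[/negPf-> _] _]].
(* From here on the missing member is the whole facet, and any completion of [C] adds a facet. *)
have eA0l : A0 = [set x in l] by rewrite eA0 ek -sl take_size.
have nBfull B : B \in K -> #|B| = m.+1 -> B \notin C.
  move=> KB cB; apply: contra CA0 => CB.
  suff -> : A0 = B by [].
  apply/esym/eqP; rewrite eqEcard eA0l card_set_uniq // sl cB leqnn andbT.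
  by have := subsetP sC _ CB; rewrite inE => /andP[_ /prefix_sub].
have Bfull B : B \in K -> B \notin C -> all_nested (B |: C) -> #|B| = m.+1.
  move=> KB nB /all_nestedP nBC; apply/eqP; apply: contraNT nB => neB.
  have /andP[B0 Bm] := K_card KB.
  have lt : #|B| < m.+1 by rewrite ltn_neqAle neB.
  have cB : #|[set x in take #|B| l]| = #|B|.
    by rewrite card_set_uniq ?take_uniq // size_take sl lt.
  have inC : [set x in take #|B| l] \in C.
    rewrite eC !inE -card_gt0 cB B0 is_prefix_take // andbT andbT.
    by apply: contra neB => /eqP eB; rewrite -cB eB eA0l card_set_uniq // sl.
  suff -> : B = [set x in take #|B| l] by [].
  by apply: nested_card_eq; rewrite ?cB //; apply: nBC; rewrite ?setU11 // setU1r.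
have [m0|m0] := posnP m.
  have [_ K1 _] := hK; have [y ey] : exists y, kap = [set y].
    by apply/cards1P; have := K_card Kk; rewrite m0; case: #|kap| => [|[]].
  have C0 : C = set0 by apply/eqP; rewrite -cards_eq0 cC m0.
  have -> : [set B | (B \notin C) && good_chain kap (B |: C)] = [set [set y]; [set lam y]].
    apply/setP=> B; rewrite -component_dim0 // -ey ck inE C0 inE /= setU0.
    apply/good_chainP/andP => [[h1 h2 _]|[KB /eqP cB]].
      by rewrite h1 ?h2 ?set11.
    split; try by move=> A /set1P->.
    by apply/all_nestedP=> A A' /set1P-> /set1P->; apply: nested_refl.
  by rewrite cards2 (inj_eq set1_inj) eq_sym lam_neq.
(* For m > 0 the chain contains the ridge [R], which is its largest member. *)
pose R := [set x in take m l].
have cR : #|R| = m by rewrite card_set_uniq ?take_uniq // size_take sl ltnSn.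
have CR : R \in C.
  rewrite eC !inE -card_gt0 cR m0 is_prefix_take // andbT andbT eA0l.
  by apply/eqP=> /(congr1 (fun A : {set V} => #|A|)); rewrite cR card_set_uniq // sl; lia.
have /good_chainP[KC compC nC] := gC.
rewrite -(K_ridge (KC _ CR) cR); apply: eq_card => B; rewrite !inE.
apply/andP/and3P => [[nB /good_chainP[KB _ nBC]]|[KB sRB /eqP cB]].
  have {}KB : B \in K by apply: KB; rewrite setU11.
  have cB := Bfull _ KB nB nBC; rewrite KB cB eqxx; split=> //.
  apply: nested_card_leq; last by rewrite cR cB.
  by have /all_nestedP := nBC; apply; rewrite ?setU11 // setU1r.
have sCR A : A \in C -> A \subset R.
  move=> CA; apply: nested_card_leq; first by have /all_nestedP := nC; apply.
  rewrite cR -ltnS -cC.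
  have : A \in prefixes l :\ A0 by rewrite -eC.
  rewrite !inE => /and3P[neA _ pA]; rewrite ltnS cC.
  have le := subset_leq_card (prefix_sub pA); rewrite card_set_uniq // sl in le.
  rewrite -ltnS ltn_neqAle le andbT; apply: contra neA => /eqP cA.
  by rewrite eA0l eqEcard prefix_sub // card_set_uniq // sl cA leqnn.
split; first exact: nBfull.
have cB' : component B = kap by rewrite -(compC _ CR); apply: component_nested; rewrite ?(KC _ CR) // nested_sym /nested sRB.
apply/good_chainP; split.
- by move=> A; rewrite in_setU1 => /predU1P[->|/KC].
- by move=> A; rewrite in_setU1 => /predU1P[->|/compC].
apply/all_nestedP=> A A'; rewrite !in_setU1 => /predU1P[->|CA] /predU1P[->|CA'].
- exact: nested_refl.
- by rewrite nested_sym /nested (subset_trans (sCR _ CA')).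
- by rewrite /nested (subset_trans (sCR _ CA)).
- by have /all_nestedP := nC; apply.
Qed.

Lemma prefixes_rcons (l : seq V) v : uniq (rcons l v) -> prefixes l \subset prefixes (rcons l v).
Proof.
rewrite rcons_uniq => /andP[_ ul]; apply/subsetP=> A; rewrite !inE => /andP[-> pA] /=.
rewrite /is_prefix -cats1 takel_cat //.
by rewrite -(card_set_uniq ul) subset_leq_card // prefix_sub.
Qed.

Lemma codim1_inter C C' (D : {set {set V}}) : #|C| = m.+1 -> #|C'| = m.+1 -> C != C' -> D \subset C -> D \subset C' ->
  #|D| = m -> #|C :&: C'| = m.
Proof.
move=> cC cC' ne sD sD' cD; apply/eqP; rewrite eqn_leq; apply/andP; split; last first.
  by rewrite -{1}cD subset_leq_card // subsetI sD.
rewrite -ltnS -cC; apply: proper_card; rewrite properE subsetIl subsetI subxx /=.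
by apply: contra ne => sCC'; rewrite eqEcard sCC' cC cC' leqnn.
Qed.

(** * Connectedness of the full chains containing a given chain *)

Section FullChains.

Variables (kap : {set V}) (C : {set {set V}}) (H : {set {set V}} -> int).
Hypotheses (Kk : kap \in K) (ck : component kap = kap) (gC : good_chain kap C).
Definition full_chain C' := [&& good_chain kap C', #|C'| == m.+1 & C \subset C'].
Hypothesis H_adj : forall C1 C2, full_chain C1 -> full_chain C2 -> #|C1 :&: C2| = m -> H C1 = H C2.

Lemma full_prefixes l : uniq l -> size l = m.+1 -> [set x in l] \in K -> component [set x in l] = kap ->
  {in C, forall A, is_prefix l A} -> full_chain (prefixes l).
Proof.
move=> ul sl Kl cl pl; rewrite /full_chain prefixes_good // card_prefixes // sl eqxx /=.
have /good_chainP[KC _ _] := gC.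
by apply/subsetP=> A CA; rewrite inE pl // K_nonempty ?KC.
Qed.

(** Both chains are words in the letters of [R] with the members of [C] as initial segments;
    [bubble_sort] connects them through such words. *)
Lemma full_chain_same_top C1 C2 R : full_chain C1 -> full_chain C2 -> R \in C1 -> R \in C2 ->
  #|R| = m.+1 -> H C1 = H C2.
Proof.
move=> f1 f2 R1 R2 cR; have /and3P[g1 /eqP c1 s1] := f1; have /and3P[g2 /eqP c2 s2] := f2.
have [l1 [u1 sz1 K1 e1]] := full_chain_seq Kk ck g1 c1.
have [l2 [u2 sz2 K2 e2]] := full_chain_seq Kk ck g2 c2.
have /good_chainP[_ comp1 _] := g1.
have top l : uniq l -> size l = m.+1 -> R \in prefixes l -> R = [set x in l].
  move=> ul sl; rewrite inE => /andP[_ pR]; apply/eqP; rewrite eqEcard prefix_sub //.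
  by rewrite card_set_uniq // sl cR leqnn.
have eR1 : R = [set x in l1] by apply: top; rewrite -?e1.
have eR2 : R = [set x in l2] by apply: top; rewrite -?e2.
have pC l : C \subset prefixes l -> {in C, forall A, is_prefix l A}.
  by move=> sl A CA; have := subsetP sl _ CA; rewrite inE => /andP[].
rewrite e1 e2; apply: (@bubble_sort _ _ C l2 (fun l => H (prefixes l))) => //; last 2 first.
- by apply: pC; rewrite -e1.
- by apply: pC; rewrite -e2.
- move=> x v w y p12 p1 p2; have ul : uniq (x ++ v :: w :: y) by rewrite (perm_uniq p12).
  have pvw : perm_eq (x ++ w :: v :: y) l2.
    exact: perm_trans (perm_swap _ _ _ _) p12.
  have ul' : uniq (x ++ w :: v :: y) by rewrite (perm_uniq pvw).
  have setE l : perm_eq l l2 -> [set z in l] = R.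
    by move=> /perm_mem pl; rewrite eR2; apply/setP=> z; rewrite !inE pl.
  apply: H_adj; last first.
    rewrite swap_codim1 //; apply/eqP; rewrite -eqSS -sz2 -(perm_size p12) size_cat /= !addnS.
    by [].
  - apply: full_prefixes => //; rewrite ?(perm_size pvw) // setE //; first by rewrite eR1.
    exact: comp1.
  - apply: full_prefixes => //; rewrite ?(perm_size p12) // setE //; first by rewrite eR1.
    exact: comp1.
apply: uniq_perm => // z; move/setP/(_ z): eR2; rewrite eR1 !inE; exact.
Qed.

(** By the previous lemma only the facet matters. If [C] is not empty, the facets above its largest
    member are connected through ridges by normality. If it is empty, one moves through the
    component, passing between nested simplices by normality at the smaller one. *)
Lemma full_chains_connected C1 C2 : full_chain C1 -> full_chain C2 -> H C1 = H C2.
Proof.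
move=> f1 f2; have /and3P[g1 /eqP c1 s1] := f1; have /and3P[g2 /eqP c2 s2] := f2.
have topP C' : full_chain C' -> exists R, [/\ R \in C', R \in K, #|R| = m.+1, component R = kap &
    {in C', forall A, A \subset R}].
  move=> /and3P[g' /eqP c' _]; have [l [ul sl Kl e]] := full_chain_seq Kk ck g' c'.
  have lC' : [set x in l] \in C' by rewrite e inE K_nonempty //= is_prefix_self.
  exists [set x in l]; have /good_chainP[_ h _] := g'; rewrite lC' Kl card_set_uniq // h //; split=> //.
  by move=> A; rewrite e inE => /andP[_ /prefix_sub].
(* The value of [H] on the full chains with facet [R]; [set0] is a default value for sets [R] in no
   full chain. *)
pose Hf R := H (odflt set0 [pick C' | full_chain C' && (R \in C')]).
have HfE C' R : full_chain C' -> R \in C' -> #|R| = m.+1 -> H C' = Hf R.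
  move=> f' R' cR; rewrite /Hf; case: pickP => [C'' /andP[f'' R'']|/(_ C')]; last by rewrite f' R'.
  exact: full_chain_same_top f' f'' R' R'' cR.
have [R1 [CR1 KR1 cR1 k1 t1]] := topP _ f1; have [R2 [CR2 KR2 cR2 k2 t2]] := topP _ f2.
rewrite (HfE _ _ f1 CR1 cR1) (HfE _ _ f2 CR2 cR2).
have ridge R B B' : R \in K -> {in C, forall A, A \subset R} -> component R = kap -> #|R| = m ->
    B \in K -> B' \in K -> R \subset B -> R \subset B' -> #|B| = m.+1 -> #|B'| = m.+1 -> Hf B = Hf B'.
  move=> KR sCR compR cR KB KB' sB sB' cB cB'.
  have [l [ul el gl sl]] := good_chain_seq gC KR sCR compR.
  have szl : size l = m by rewrite -card_set_uniq // el.
  have ext F : F \in K -> R \subset F -> #|F| = m.+1 -> exists l',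
      [/\ full_chain (prefixes l'), F \in prefixes l' & prefixes l \subset prefixes l'].
    move=> KF sF cF; have /properP[_ [v vF vR]] : R \proper F by rewrite properEcard sF cF cR leqnn.
    have uv : uniq (rcons l v) by rewrite rcons_uniq ul andbT; move: vR; rewrite -el inE.
    have ev : [set x in rcons l v] = F.
      apply/eqP; rewrite eqEcard card_set_uniq // size_rcons szl cF leqnn andbT.
      apply/subsetP=> x; rewrite inE mem_rcons inE => /predU1P[-> //|xl].
      by apply: (subsetP sF); rewrite -el inE.
    exists (rcons l v); split; last exact: prefixes_rcons.
      apply: full_prefixes; rewrite ?size_rcons ?szl ?ev //.
        by rewrite -compR; apply: component_nested; rewrite // nested_sym /nested sF.
      move=> A CA; have := subsetP (prefixes_rcons uv) _ (subsetP sl _ CA).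
      by rewrite inE => /andP[].
    by rewrite inE K_nonempty //= -ev is_prefix_self.
  have [l1 [fl1 Bl1 sl1]] := ext B KB sB cB; have [l2 [fl2 Bl2 sl2]] := ext B' KB' sB' cB'.
  rewrite -(HfE _ _ fl1 Bl1 cB) -(HfE _ _ fl2 Bl2 cB').
  have [-> //|ne] := eqVneq (prefixes l1) (prefixes l2).
  have /and3P[_ /eqP cl1 _] := fl1; have /and3P[_ /eqP cl2 _] := fl2.
  apply: H_adj => //; apply: codim1_inter sl1 sl2 _ => //.
  by rewrite card_prefixes.
have starc S : S \in K -> component S = kap -> {in C, forall A, A \subset S} ->
    forall B B', B \in K -> B' \in K -> S \subset B -> S \subset B' ->
    #|B| = m.+1 -> #|B'| = m.+1 -> Hf B = Hf B'.
  move=> KS compS sCS; apply: K_star_connected => // R B B' KR sSR cR KB KB' sB sB'.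
  apply: ridge cR _ _ sB sB' => //; first by move=> A /sCS sAS; apply: subset_trans sSR.
  by rewrite -compS; apply: component_nested; rewrite // nested_sym /nested sSR.
have [S [KS compS sCS CS]] := good_chain_top Kk ck gC.
have [C0|nC] := eqVneq C set0; last first.
  have CS' := CS nC.
  by apply: (starc S) => //; [apply: t1; apply: (subsetP s1)|apply: t2; apply: (subsetP s2)].
have [m0|m0] := posnP m.
  rewrite -(HfE _ _ f1 CR1 cR1) -(HfE _ _ f2 CR2 cR2).
  have [-> //|ne] := eqVneq C1 C2.
  by apply: H_adj => //; apply: codim1_inter (sub0set _) (sub0set _) _; rewrite ?cards0.
have C_sub A : {in C, forall B, B \subset A} by move=> B; rewrite C0 inE.
(* The simplices all of whose facets have the value of [R1]. Passing to a larger simplex leaves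
   fewer facets; for a smaller one, its connected star contains a facet of the old one. *)
pose P := [set B : {set V} | [forall F in K, (component B == kap) && (B \subset F) && (#|F| == m.+1) ==> (Hf F == Hf R1)]].
have cl : closed adjK P.
  apply: intro_closed => [|B B' /and3P[KB KB' ad] PB]; first exact: adjK_connect_sym.
  have nBB' : nested B B' by move: ad; rewrite (gtn_eqF m0) orbF.
  have compE := component_nested KB KB' nBB'.
  rewrite inE; apply/forall_inP=> F KF; apply/implyP=> /andP[/andP[/eqP compB' sF] /eqP cF].
  have PBE F' : F' \in K -> B \subset F' -> #|F'| = m.+1 -> Hf F' = Hf R1.
    move=> KF' sF' cF'; move: PB; rewrite inE => /forall_inP/(_ F' KF')/implyP.
    by rewrite compE compB' sF' cF' !eqxx => /(_ isT)/eqP.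
  case/orP: nBB' => sBB'.
    by apply/eqP; apply: PBE => //; apply: subset_trans sF.
  have [F' [KF' sF' cF']] := K_facet KB.
  rewrite -(PBE F') // eq_sym; apply/eqP; apply: (starc B') => //.
  exact: subset_trans sF'.
have P1 : R1 \in P.
  rewrite inE; apply/forall_inP=> F KF; apply/implyP=> /andP[/andP[_ sF] /eqP cF].
  suff -> : F = R1 by [].
  by apply/esym/eqP; rewrite eqEcard sF cF cR1 leqnn.
have con : connect adjK R1 R2.
  by rewrite -(root_connect adjK_connect_sym) -/(component R1) -/(component R2) k1 k2.
have : R2 \in P by rewrite -(closed_connect cl con).
rewrite inE => /forall_inP/(_ R2 KR2)/implyP; rewrite k2 subxx cR2 !eqxx => /(_ isT)/eqP.
by [].
Qed.

End FullChains.

End SimplicialPseudomanifold.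

(** * Orientation of the subdivision *)

Section SubdivisionOrientation.

Context {disp : Order.disp_t} {T : finPOrderType disp}.
Variables (n : nat) (o : n.+1.-tuple T -> bool).
Implicit Types (u : n.+1.-tuple T) (t : n.+1.-tuple (sd T)).

Lemma flag_lt u (k l : 'I_n.+1) : is_flag u -> (tnth u k < tnth u l)%O = (k < l).
Proof.
move=> /is_flagP[le_u dim_u]; apply/idP/idP => [|lt_kl].
  by apply: contraTltn => le_lk; apply/negP=> /lt_le_trans/(_ (le_u _ _ le_lk)); rewrite ltxx.
rewrite lt_neqAle le_u ?(ltnW lt_kl) // andbT.
by apply: contraTneq lt_kl => e; have := dim_u k; rewrite e dim_u => ->; rewrite ltnn.
Qed.

Lemma flag_inj u : is_flag u -> injective (tnth u).
Proof.
by move=> /is_flagP[_ dim_u] k l e; apply/val_inj; rewrite /= -(dim_u k) e dim_u.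
Qed.

Lemma flag_set_inj u u' : is_flag u -> is_flag u' -> [set a in u] = [set a in u'] -> u = u'.
Proof.
move=> /andP[su _] /andP[su' _] e; apply/val_inj; apply: lt_sorted_eq su su' _ => a.
by move/setP/(_ a): e; rewrite !inE.
Qed.

Lemma card_flag_set u : is_flag u -> #|[set a in u]| = n.+1.
Proof.
move=> /andP[su _].
by rewrite cardsE (card_uniqP (lt_sorted_uniq su)) size_tuple.
Qed.

Lemma sd_orientationE u t : is_flag u -> [set a in u] = val (tnth t ord_max) ->
  sd_orientation o t = o u (+) odd #|inversions t|.
Proof.
move=> fu eu; apply/existsP/idP => [[v /and3P[fv /eqP ev]]|H].
  by rewrite (@flag_set_inj u v) // eu ev.
by exists u; rewrite fu eu eqxx.
Qed.

Lemma inversions_flag u u' t t' : is_flag u -> is_flag u' ->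
  (forall i, val (tnth t i) \subset [set a in u]) ->
  (forall i, val (tnth t' i) \subset [set a in u']) ->
  (forall i k, (tnth u' k \in val (tnth t' i)) = (tnth u k \in val (tnth t i))) ->
  #|inversions t'| = #|inversions t|.
Proof.
have inv_card u1 t1 : is_flag u1 -> (forall i, val (tnth t1 i) \subset [set a in u1]) ->
    #|inversions t1| = #|[set kl : 'I_n.+1 * 'I_n.+1 | [&& kl.1 < kl.2,
      [exists i, tnth u1 kl.1 \in val (tnth t1 i)] &
      [exists i, (tnth u1 kl.2 \in val (tnth t1 i)) && (tnth u1 kl.1 \notin val (tnth t1 i))]]]|.
  move=> fu1 sub; rewrite -(card_imset _ (_ : injective (fun kl => (tnth u1 kl.1, tnth u1 kl.2)))); last first.
    by move=> [k l] [k' l'] /= [/(flag_inj fu1)-> /(flag_inj fu1)->].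
  have has_ex (Q : pred (sd T)) : has Q t1 = [exists i, Q (tnth t1 i)].
    by apply/hasP/existsP => [[C /tnthP[i ->] QC]|[i Qi]]; [exists i|exists (tnth t1 i); rewrite ?mem_tnth].
  apply: eq_card => -[a b]; rewrite inE !has_ex /=.
  apply/and3P/imsetP => [[lt_ab /existsP[i ai] /existsP[j /andP[bj naj]]]|[[k l]]].
    have /tnthP[k ek] : a \in u1 by move/subsetP/(_ a ai): (sub i); rewrite inE.
    have /tnthP[l el] : b \in u1 by move/subsetP/(_ b bj): (sub j); rewrite inE.
    rewrite ek el in lt_ab ai bj naj *; exists (k, l) => //; rewrite inE -(flag_lt _ _ fu1) lt_ab /=.
    by apply/andP; split; apply/existsP; [exists i|exists j; rewrite bj].
  by rewrite inE -(flag_lt _ _ fu1) /= => /and3P[lt ex1 ex2] [-> ->].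
move=> fu fu' sub sub' e; rewrite (inv_card u t) // (inv_card u' t') //.
apply: eq_card => kl; rewrite !inE; congr [&& _, _ & _];
  by apply: eq_existsb => i; rewrite !e.
Qed.

Definition sd_tower t : Prop :=
  (forall i j : 'I_n.+1, i <= j -> val (tnth t i) \subset val (tnth t j)) /\
  (forall i : 'I_n.+1, #|val (tnth t i)| = i.+1).

(** A tower adds one element at each place, and the change at [i] exchanges the elements entering at
    [i] and [i.+1]. Only this pair gains or loses the status of an inversion. *)
Lemma sd_swap_inversions t v (i : 'I_n.+1) : i < n -> sd_tower t -> sd_tower v ->
  differ_only_at i t v -> odd #|inversions v| = ~~ odd #|inversions t|.
Proof.
move=> lt_in [le_t card_t] [le_v card_v] dtv.
have lt_i1 : i.+1 < n.+1 by [].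
pose i1 := Ordinal lt_i1.
have same j : j != i -> tnth v j = tnth t j by move=> ne; have := dtv j; rewrite ne => /eqP->.
have vi1 : tnth v i1 = tnth t i1 by apply: same; rewrite -val_eqE /= gtn_eqF.
have neq_i : tnth t i != tnth v i by have := dtv i; rewrite eqxx => /negbT.
set S := val (tnth t i1).
have cS : #|S| = i.+2 by rewrite card_t.
have drop_one (w : n.+1.-tuple (sd T)) : sd_tower w -> tnth w i1 = tnth t i1 ->
    exists2 y, y \in S & val (tnth w i) = S :\ y.
  move=> [le_w card_w] ew; have sw : val (tnth w i) \subset S by rewrite /S -ew le_w /=.
  have /cards1P[y ey] : #|S :\: val (tnth w i)| == 1.
    by rewrite cardsD (setIidPr sw) cS card_w subSn // subnn.
  exists y; first by have := set11 y; rewrite -ey inE => /andP[].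
  by rewrite -ey setDDr setDv set0U; apply/esym/setIidPr.
have [y Sy ety] := drop_one t (conj le_t card_t) erefl.
have [x Sx evx] := drop_one v (conj le_v card_v) vi1.
have neq_xy : x != y by apply: contra neq_i => /eqP exy; rewrite -val_eqE ety evx exy.
(* Every inversion other than the exchanged pair survives; the statement is symmetric so as to be
   used in both directions. *)
have side (w w' : n.+1.-tuple (sd T)) a b : sd_tower w -> sd_tower w' ->
    (forall j, j != i -> tnth w' j = tnth w j) -> val (tnth w i1) = S ->
    val (tnth w i) = S :\ b -> val (tnth w' i) = S :\ a -> a != b -> a \in S -> b \in S ->
    forall p, p \in inversions w -> p != (b, a) -> p \in inversions w'.
  move=> [le_w card_w] [le_w' card_w'] eww' eS ewb ewa neab Sa Sb [p1 p2].
  rewrite !inE /= => /and3P[-> /hasP[C1 /tnthP[j1 ->] p1j] /hasP[C2 /tnthP[j2 ->] /andP[p2j np1j]]] /= nep.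
  apply/andP; split.
    have [e|ne] := eqVneq j1 i; last by apply/hasP; exists (tnth w j1); rewrite // -eww' ?mem_tnth.
    apply/hasP; exists (tnth w' i1); first exact: mem_tnth.
    rewrite eww' ?eS -?val_eqE /= ?gtn_eqF //.
    by move: p1j; rewrite e ewb inE => /andP[].
  have [e|ne] := eqVneq j2 i; last first.
    by apply/hasP; exists (tnth w' j2); rewrite ?mem_tnth // eww' // p2j np1j.
  move: p2j np1j; rewrite e ewb !inE => /andP[nep2 Sp2] /nandP[|np1S]; last first.
    apply/hasP; exists (tnth w' i1); first exact: mem_tnth.
    by rewrite eww' ?eS -?val_eqE /= ?gtn_eqF // Sp2.
  rewrite negbK => /eqP ep1; have nep2a : p2 != a.
    by apply: contra nep => /eqP->; rewrite ep1.
  have [i0|i0] := posnP i.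
    have : 2 < #|S|.
      have : [set a; b; p2] \subset S by rewrite !subUset !sub1set Sa Sb Sp2.
      move/subset_leq_card; apply: leq_trans.
      by rewrite -setUA cardsU1 !inE cards2 negb_or neab (eq_sym a) nep2a eq_sym nep2.
    by rewrite cS i0.
  (* The member at place i - 1 lacks exactly the two exchanged elements of the member at i + 1, so
     it contains [p2] and not [p1]. *)
  have lt_i' : i.-1 < n.+1 by rewrite (leq_ltn_trans (leq_pred i)).
  pose i' := Ordinal lt_i'; have ne' : i' != i by rewrite -val_eqE /= ltn_eqF // prednK.
  apply/hasP; exists (tnth w' i'); first exact: mem_tnth.
  rewrite eww' //; have -> : val (tnth w i') = S :\ b :\ a.
    apply/eqP; rewrite eqEcard; apply/andP; split.
      apply/subsetP=> z zw; have zb := subsetP (le_w i' i (leq_pred i)) z zw.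
      have := subsetP (le_w' i' i (leq_pred i)) z; rewrite eww' // => /(_ zw) za.
      by move: zb za; rewrite ewb ewa !inE => /andP[-> ->] /andP[->].
    rewrite card_w /= prednK //.
    have c1 := cardsD1 b S; have c2 := cardsD1 a (S :\ b).
    rewrite Sb cS add1n in c1; rewrite !inE neab Sa add1n /= in c2.
    by move: c1; rewrite c2 => -[->].
  by rewrite !inE nep2 nep2a Sp2 ep1 eqxx andbF.
have tt : sd_tower t by []. have tv : sd_tower v by [].
have sub_tv : forall p, p \in inversions t -> p != (y, x) -> p \in inversions v.
  by apply: (side t v x y).
have sub_vt : forall p, p \in inversions v -> p != (x, y) -> p \in inversions t.
  apply: (side v t y x) => //; rewrite ?vi1 1?eq_sym //.
  by move=> j ne; rewrite same.
have nyx a b (w : n.+1.-tuple (sd T)) : sd_tower w -> val (tnth w i1) = S ->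
    val (tnth w i) = S :\ b -> a \in S -> a != b -> (a, b) \notin inversions w.
  move=> [le_w card_w] eS ewb Sa neab; rewrite inE /=; apply/and3P=> -[_ _ /hasP[C /tnthP[j ->] /andP[bj naj]]].
  have [le_ji|lt_ij] := leqP j i.
    by have := subsetP (le_w _ _ le_ji) _ bj; rewrite ewb setD11.
  have := subsetP (le_w i1 j lt_ij) a; rewrite eS => /(_ Sa); exact/negP.
have yxI a b (w : n.+1.-tuple (sd T)) : val (tnth w i1) = S -> val (tnth w i) = S :\ b ->
    a \in S -> b \in S -> a != b -> (b < a)%O -> (b, a) \in inversions w.
  move=> eS ewb Sa Sb neab lt_ba; rewrite inE /= lt_ba /=; apply/andP; split; apply/hasP.
    by exists (tnth w i1); rewrite ?mem_tnth ?eS.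
  by exists (tnth w i); rewrite ?mem_tnth // ewb !inE neab Sa eqxx.
have comp_xy : (x >=< y)%O.
  have /andP[/forall_inP/(_ _ Sx)/forall_inP/(_ _ Sy) h _] := valP (tnth t i1).
  exact: h.
have veS : val (tnth v i1) = S by rewrite vi1.
have nxy_t := nyx x y t tt erefl ety Sx neq_xy.
have nyx_v : (y, x) \notin inversions v by apply: nyx; rewrite // eq_sym.
case: (comparable_ltgtP comp_xy) => [lt_xy|lt_yx|exy].
- have xy_v : (x, y) \in inversions v by apply: yxI; rewrite // eq_sym.
  have -> : inversions v = (x, y) |: inversions t.
    apply/setP=> p; rewrite in_setU1; have [->//|ne] := eqVneq p (x, y).
    apply/idP/idP => [/sub_vt|pt]; first exact.
    apply: sub_tv => //; apply: contraTneq pt => ->; rewrite inE /=.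
    by rewrite (lt_gtF lt_xy).
  by rewrite cardsU1 nxy_t.
- have yx_t : (y, x) \in inversions t by apply: yxI.
  have -> : inversions t = (y, x) |: inversions v.
    apply/setP=> p; rewrite in_setU1; have [->//|ne] := eqVneq p (y, x).
    apply/idP/idP => [/sub_tv|pt]; first exact.
    apply: sub_vt => //; apply: contraTneq pt => ->; rewrite inE /=.
    by rewrite (lt_gtF lt_yx).
  by rewrite cardsU1 nyx_v negbK.
- by rewrite exy eqxx in neq_xy.
Qed.

Lemma tower_sub t i : sd_tower t -> val (tnth t i) \subset val (tnth t ord_max).
Proof. by move=> [le_t _]; apply: le_t; rewrite -ltnS. Qed.

Lemma sd_orientation_flip u u' t t' : is_flag u -> is_flag u' -> sd_tower t -> sd_tower t' ->
  [set a in u] = val (tnth t ord_max) -> [set a in u'] = val (tnth t' ord_max) ->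
  (forall i k, (tnth u' k \in val (tnth t' i)) = (tnth u k \in val (tnth t i))) ->
  o u' = ~~ o u -> sd_orientation o t' = ~~ sd_orientation o t.
Proof.
move=> fu fu' tt tt' eu eu' mem ou; rewrite (sd_orientationE fu eu) (sd_orientationE fu' eu') ou.
rewrite (@inversions_flag u u' t t') ?addNb // => i; rewrite ?eu ?eu'; exact: tower_sub.
Qed.

Lemma sd_orientation_swap u t v (i : 'I_n.+1) : i < n -> is_flag u -> sd_tower t -> sd_tower v ->
  [set a in u] = val (tnth t ord_max) -> differ_only_at i t v ->
  sd_orientation o v = ~~ sd_orientation o t.
Proof.
move=> lt_in fu tt tv eu dtv.
have emax : tnth v ord_max = tnth t ord_max.
  have := dtv ord_max; rewrite [ord_max != i](_ : _ = true) => [/eqP->//|].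
  by rewrite -val_eqE /= gtn_eqF.
have eu' : [set a in u] = val (tnth v ord_max) by rewrite emax.
rewrite (sd_orientationE fu eu) (sd_orientationE fu eu') (sd_swap_inversions lt_in tt tv dtv).
by rewrite addbN.
Qed.

(** The two top simplices share the member at place n - 1, so their underlying flags differ in one
    element, where [o] changes sign; the order in which places are filled is the same. *)
Lemma sd_orientation_last u u' t v : is_orientation o -> 0 < n -> is_flag u -> is_flag u' ->
  sd_tower t -> sd_tower v ->
  [set a in u] = val (tnth t ord_max) -> [set a in u'] = val (tnth v ord_max) ->
  differ_only_at ord_max t v -> sd_orientation o v = ~~ sd_orientation o t.
Proof.
move=> ori n0 fu fu' tt tv eu eu' dtv; have [le_t card_t] := tt; have [le_v card_v] := tv.
have [_ dim_u] := is_flagP _ fu; have [_ dim_u'] := is_flagP _ fu'.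
have same j : j != ord_max -> tnth v j = tnth t j by move=> ne; have := dtv j; rewrite ne => /eqP->.
have lt_p : n.-1 < n.+1 by rewrite (leq_ltn_trans (leq_pred n)).
pose p := Ordinal lt_p; have nep : p != ord_max by rewrite -val_eqE /= ltn_eqF // prednK.
set B := val (tnth t p); have vB : val (tnth v p) = B by rewrite same.
have cB : #|B| = n by rewrite card_t /= prednK.
have sBt : B \subset [set a in u] by rewrite eu tower_sub.
have sBv : B \subset [set a in u'] by rewrite eu' -vB tower_sub.
have same_dim k : (tnth u k \in B) || (tnth u' k \in B) -> tnth u k = tnth u' k.
  case/orP=> kB.
    have := subsetP sBv _ kB; rewrite inE => /tnthP[l el].
    have := dim_u k; by rewrite el dim_u' => /val_inj->.
  have := subsetP sBt _ kB; rewrite inE => /tnthP[l el].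
  have := dim_u' k; by rewrite el dim_u => /val_inj->.
have inB k : (tnth u' k \in B) = (tnth u k \in B).
  by apply/idP/idP => kB; [rewrite same_dim ?kB ?orbT|rewrite -same_dim ?kB].
have [x ux] : exists x, [set a in u] :\: B = [set x].
  by apply/cards1P; rewrite cardsD (setIidPr sBt) card_flag_set // cB subSnn.
have /setDP[xu xB] : x \in [set a in u] :\: B by rewrite ux set11.
move: xu; rewrite inE => /tnthP[j ej].
have outB k : (tnth u k \notin B) = (k == j).
  apply/idP/eqP => [kB|->]; last by rewrite -ej.
  have : tnth u k \in [set a in u] :\: B by rewrite !inE kB mem_tnth.
  by rewrite ux => /set1P; rewrite ej => /(flag_inj fu).
have neq_top : val (tnth t ord_max) != val (tnth v ord_max).
  by have := dtv ord_max; rewrite eqxx val_eqE => ->.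
have d : differ_only_at j u u'.
  move=> k; rewrite -outB negbK; apply/eqP/idP => [e|kB]; last by apply: same_dim; rewrite kB.
  apply: contraNT neq_top; rewrite outB => /eqP ekj; rewrite -eu -eu'; apply/eqP.
  apply/setP=> a; rewrite !inE; apply/tnthP/tnthP => -[l ->]; exists l.
    have [->|nlj] := eqVneq l j; first by rewrite -ekj.
    by apply: same_dim; move: nlj; rewrite -outB negbK => ->.
  have [->|nlj] := eqVneq l j; first by rewrite -ekj.
  by apply/esym/same_dim; move: nlj; rewrite -outB negbK => ->.
apply: (sd_orientation_flip fu fu' tt tv eu eu') => [i k|]; last exact: ori d.
have [->|ne] := eqVneq i ord_max; first by rewrite -eu -eu' !inE !mem_tnth.
rewrite same //.
have sub_i : val (tnth t i) \subset B.
  apply: le_t; rewrite /= -ltnS prednK // ltn_neqAle -ltnS ltn_ord andbT.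
  exact: ne.
have [kB|nkB] := boolP (tnth u k \in B); first by rewrite (same_dim k) ?kB.
have n1 : tnth u k \notin val (tnth t i) by apply: contra nkB => /(subsetP sub_i).
have n2 : tnth u' k \notin val (tnth t i).
  by apply: contra nkB => /(subsetP sub_i); rewrite inB.
by rewrite (negPf n1) (negPf n2).
Qed.

End SubdivisionOrientation.

(** The top consists of m + 1 nested simplices with at most m + 1 vertices, hence of one simplex of
    each size. *)
Lemma tower_flag (m : nat) (V : finType) (K : {set {set V}}) (t : m.+1.-tuple (sd (simplex K))) :
  simplicial_complex K -> {in K, forall A : {set V}, #|A| <= m.+1} -> sd_tower t ->
  exists2 u : m.+1.-tuple (simplex K), is_flag u & [set a in u] = val (tnth t ord_max).
Proof.
move=> hK K_le [_ card_t]; set C := val (tnth t ord_max).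
have cC : #|C| = m.+1 by rewrite card_t.
pose C' := [set val a | a in C].
have cC' : #|C'| = m.+1 by rewrite card_imset ?cC //; apply: val_inj.
have nC' : all_nested C'.
  have /andP[/forall_inP chC _] := valP (tnth t ord_max).
  by apply/all_nestedP=> _ _ /imsetP[a aC ->] /imsetP[b bC ->]; apply: (forall_inP (chC a aC)).
have [|M C'M maxM] := all_nested_max _ nC'; first by rewrite -card_gt0 cC'.
have KM : M \in K by case/imsetP: C'M => a _ ->; apply: valP.
have [l [ul el pl]] := nested_prefix_seq nC' maxM.
have sz : size l <= m.+1 by rewrite -card_set_uniq // el K_le.
have eC' : C' = prefixes l.
  apply/eqP; rewrite eqEcard cC' card_prefixes // sz andbT; apply/subsetP=> A C'A.
  rewrite inE pl // andbT; case/imsetP: C'A => a _ ->; exact: K_nonempty (valP a).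
have szl : size l = m.+1 by rewrite -card_prefixes // -eC'.
have ck (k : 'I_m.+1) : #|[set x in take k.+1 l]| = k.+1.
  by rewrite card_set_uniq ?take_uniq // size_take_min szl; apply/minn_idPl.
have Ck (k : 'I_m.+1) : [set x in take k.+1 l] \in C'.
  by rewrite eC' inE is_prefix_take // -card_gt0 ck.
have Kk (k : 'I_m.+1) : [set x in take k.+1 l] \in K.
  by case/imsetP: (Ck k) => a _ ->; apply: valP.
exists [tuple Simplex (Kk k) | k < m.+1].
  apply/(simplex_flagP hK); split=> [i j le_ij|i]; rewrite !tnth_mktuple /= ?ck //.
  apply: nested_card_leq; last by rewrite !ck ltnS.
  by move/all_nestedP: nC'; apply.
apply/eqP; rewrite eqEcard; apply/andP; split.
  apply/subsetP=> a; rewrite inE => /tnthP[k ->]; rewrite tnth_mktuple.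
  by have /imsetP[b bC eb] := Ck k; rewrite (_ : Simplex _ = b) //; apply/val_inj.
rewrite cC cardsE; have /card_uniqP-> : uniq [tuple Simplex (Kk k) | k < m.+1]; last by rewrite size_tuple.
rewrite map_inj_uniq ?enum_uniq // => i j /(congr1 val)/= e; apply/val_inj/eq_add_S.
by rewrite /= -(ck i) e ck.
Qed.

(** * States and frames *)

(** The complements of [D] and of its image have equal size and are matched in the order of their
    enumerations. *)
Lemma perm_extension (V : finType) (D : {set V}) (f : V -> V) : {in D &, injective f} ->
  exists s : {perm V}, {in D, s =1 f}.
Proof.
move=> inj_f; pose E1 := enum (~: D); pose E2 := enum (~: (f @: D)).
have szE : size E1 = size E2.
  rewrite -!cardE; have := cardsC D; have := cardsC (f @: D).
  by rewrite card_in_imset // => <- /addnI.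
pose g v := if v \in D then f v else nth v E2 (index v E1).
have E1P v : v \notin D -> index v E1 < size E2.
  by move=> nv; rewrite -szE index_mem mem_enum inE.
have gN v : v \notin D -> g v \in ~: (f @: D).
  by move=> nv; rewrite /g (negPf nv) -mem_enum mem_nth ?E1P.
have inj_g : injective g.
  move=> v w; have [vD|vD] := boolP (v \in D); have [wD|wD] := boolP (w \in D).
  - by rewrite /g vD wD; apply: inj_f.
  - move=> e; have := gN w wD; rewrite -e /g vD inE; case/negP; exact: imset_f.
  - move=> e; have := gN v vD; rewrite e /g wD inE; case/negP; exact: imset_f.
  rewrite /g (negPf vD) (negPf wD) (set_nth_default w v) ?E1P // => /eqP.
  rewrite nth_uniq ?E1P ?enum_uniq // => /eqP.
  move=> e; rewrite -(@nth_index _ v v E1) ?mem_enum ?inE // e.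
  by rewrite nth_index // mem_enum inE.
by exists (perm inj_g) => v vD; rewrite permE /g vD.
Qed.

Section States.

Local Open Scope group_scope.

Variables (m : nat) (V : finType) (K : {set {set V}}).
Hypothesis hK : simplicial_complex K.
Hypothesis hY : pseudomanifold (simplex K) m.
Variable oY : m.+1.-tuple (simplex K) -> bool.
Variable lam : V -> V.
Hypothesis lamK : involutive lam.
Variable chi : V -> V -> V.
Hypothesis hchi : forall y, star_antiiso oY y (lam y) (chi y).
Hypothesis hchiV : forall y, {in cover (vertex_star K y), cancel (chi y) (chi (lam y))}.
Implicit Types (A B : {set V}) (f : {perm V}) (p : {perm {perm V}}).

(** * Permutations extending the star maps, and twists *)

Lemma star_refl y : y \in cover (vertex_star K y).
Proof.
have [_ K1 _] := hK; apply/bigcupP; exists [set y]; rewrite ?set11 // inE K1 /=.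
by apply/exists_inP; exists [set y]; rewrite ?K1 ?set11 ?subxx.
Qed.

Lemma chi_star y v : v \in cover (vertex_star K y) -> chi y v \in cover (vertex_star K (lam y)).
Proof.
have [_ im _ _] := hchi y; case/bigcupP => s ys sv; apply/bigcupP; exists (chi y @: s).
  by rewrite -im; apply: imset_f.
exact: imset_f.
Qed.

(** An extension of [chi y] from the star of [y] to a permutation. It is chosen to be an involution
    when [lam y = y], since [gam_lam] must hold there as well. *)
Definition chi_perm y : {perm V} :=
  odflt 1 [pick s : {perm V} | [forall v in cover (vertex_star K y), s v == chi y v]
                               && ((lam y == y) ==> (s^-1 == s))].

Lemma chi_permP y : {in cover (vertex_star K y), chi_perm y =1 chi y} /\
  (lam y = y -> (chi_perm y)^-1 = chi_perm y).
Proof.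
rewrite /chi_perm; case: pickP => [s /andP[/forall_inP s1 /implyP s2]|no] /=.
  by split=> [v /s1/eqP //|/eqP/s2/eqP].
have [inj_chi _ _ _] := hchi y.
have [ly|nly] := eqVneq (lam y) y; last first.
  have [s es] := perm_extension inj_chi; have := no s; rewrite (negPf nly) andbT.
  by case/negP; apply/forall_inP=> v vy; apply/eqP/es.
pose g v := if v \in cover (vertex_star K y) then chi y v else v.
have gK : involutive g.
  move=> v; rewrite /g; case: (boolP (v \in _)) => vy; last by rewrite (negPf vy).
  by have := chi_star vy; rewrite ly => ->; have := hchiV vy; rewrite ly.
have := no (perm (inv_inj gK)); case/negP; apply/andP; split.
  by apply/forall_inP=> v vy; rewrite permE /g vy.
apply/implyP=> _; apply/eqP/permP=> v; apply: (@perm_inj _ (perm (inv_inj gK))).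
by rewrite permKV !permE gK.
Qed.

(** Of [y] and [lam y], the first in the enumeration gets its chosen extension and the other the
    inverse, so that [gam_lam] holds on all of V and not only on the stars. *)
Definition gam y : {perm V} :=
  if enum_rank y <= enum_rank (lam y) then chi_perm y else (chi_perm (lam y))^-1.

Lemma gam_chi y : {in cover (vertex_star K y), gam y =1 chi y}.
Proof.
move=> v vy; rewrite /gam; case: ifP => _; first by have [->] := chi_permP y.
have [h _] := chi_permP (lam y); apply: (@perm_inj _ (chi_perm (lam y))).
by rewrite permKV h ?hchiV // chi_star.
Qed.

Lemma gam_lam y : gam (lam y) = (gam y)^-1.
Proof.
rewrite /gam lamK; case: (ltngtP (enum_rank y) (enum_rank (lam y))) => // [_|e].
  by rewrite invgK.
have ey : lam y = y by apply/esym/enum_rank_inj/val_inj.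
by rewrite ey; have [_ ->] := chi_permP y.
Qed.

Lemma gam_y y : gam y y = lam y.
Proof. by rewrite gam_chi ?star_refl //; have [_ _ ->] := hchi y. Qed.

Definition twist_fun (a : V) f : {perm V} := f * gam (f a).

(** The twisted frame takes [a] to [lam (f a)], so the second twist multiplies by the inverse of the
    first factor. *)
Lemma twist_funK a : involutive (twist_fun a).
Proof. by move=> f; rewrite /twist_fun permM gam_y gam_lam mulgK. Qed.

Definition twist a : {perm {perm V}} := perm (inv_inj (twist_funK a)).

Lemma twistE a f : twist a f = f * gam (f a).
Proof. by rewrite permE. Qed.

Lemma twistV a : (twist a)^-1 = twist a.
Proof.
by apply/permP=> f; apply: (@perm_inj _ (twist a)); rewrite permKV !permE twist_funK.
Qed.

(* Here f^-1 * p f is the map of simplices f B |-> (p f) B.                    *)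
Definition reverses p A : Prop := forall f (t : m.+1.-tuple (simplex K)),
  is_flag t -> f @: A \subset val (tnth t ord_max) ->
  exists t' : m.+1.-tuple (simplex K), [/\ is_flag t',
    forall i, val (tnth t' i) = (f^-1 * p f) @: val (tnth t i) & oY t' = ~~ oY t].

(** As [a] is in [A], a flag whose top contains [f @: A] lies in the star of [f a], where
    [gam (f a)] is the given anti-isomorphism. *)
Lemma twist_reverses a A : a \in A -> reverses (twist a) A.
Proof.
move=> aA f t ft sA; have [le_t card_t] := (simplex_flagP hK t).1 ft.
set y := f a; have yt : y \in val (tnth t ord_max) by apply: (subsetP sA); apply: imset_f.
have t_star i : val (tnth t i) \in vertex_star K y.
  rewrite inE (valP (tnth t i)); apply/exists_inP; exists (val (tnth t ord_max)).
    exact: valP.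
  by rewrite yt le_t // -ltnS.
have t_cover i v : v \in val (tnth t i) -> v \in cover (vertex_star K y).
  by move=> vt; apply/bigcupP; exists (val (tnth t i)).
have [inj_chi im _ rev] := hchi y.
have mulE : f^-1 * twist a f = gam y by rewrite twistE mulKg.
have gE i : gam y @: val (tnth t i) = chi y @: val (tnth t i).
  by apply: eq_in_imset => v /t_cover vy; apply: gam_chi.
have K' i : gam y @: val (tnth t i) \in K.
  have : gam y @: val (tnth t i) \in vertex_star K (lam y) by rewrite gE -im imset_f.
  by rewrite inE => /andP[].
exists [tuple Simplex (K' i) | i < m.+1]; rewrite mulE.
have tE i : val (tnth [tuple Simplex (K' i) | i < m.+1] i) = gam y @: val (tnth t i).
  by rewrite tnth_mktuple.
split=> //; last by apply: rev ft t_star _ => i; rewrite tE gE.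
apply/(simplex_flagP hK); split=> [i j leij|i]; rewrite !tE ?imsetS ?le_t //.
by rewrite card_imset ?card_t //; apply: perm_inj.
Qed.

(** The conjugate is a composite of three reversals: each one is applied at the frame reached so
    far, whose image of [A] is still in the top simplex. *)
Lemma reverses_conj a p A : a \in A -> reverses p A -> reverses (p ^ twist a) A.
Proof.
move=> aA rp f t ft sA.
have next (g2 : {perm V}) (t1 : m.+1.-tuple (simplex K)) :
    (forall i, val (tnth t1 i) = (f^-1 * g2) @: val (tnth t i)) -> g2 @: A \subset val (tnth t1 ord_max).
  move=> ->; apply: subset_trans (imsetS _ sA); rewrite -imset_comp.
  by apply/subsetP=> _ /imsetP[x Ax ->]; apply/imsetP; exists x; rewrite //= permM permK.
have tA := twist_reverses aA; have [t1 [f1 e1 o1]] := tA f t ft sA.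
have s1 := next _ _ e1; have [t2 [f2 e2 o2]] := rp _ t1 f1 s1.
have e2' i : val (tnth t2 i) = (f^-1 * p (twist a f)) @: val (tnth t i).
  rewrite e2 e1 -imset_comp; apply: eq_imset => x /=.
  by rewrite -permM -mulgA mulKVg.
have s2 := next _ _ e2'.
have [t3 [f3 e3 o3]] := tA _ t2 f2 s2.
exists t3; split=> // [i|]; last by rewrite o3 o2 o1 negbK.
rewrite e3 e2' -imset_comp conjgE twistV !permM; apply: eq_imset => x /=.
by rewrite -permM -mulgA mulKVg.
Qed.

(** * States and the involutions on them *)

Definition twists B := <<[set twist a | a in B]>>.

Lemma twistsS A B : A \subset B -> twists A \subset twists B.
Proof. by move=> sAB; apply/genS/imsetS. Qed.

Lemma reverses_conj_twists q p A : q \in twists A -> reverses p A -> reverses (p ^ q) A.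
Proof.
case/gen_prodgP => n [c Ac ->] {q}; elim: n c Ac p => [|n IH] c Ac p rp.
  by rewrite big_ord0 conjg1.
rewrite big_ord_recl conjgM; apply: IH => [i|]; first exact: Ac.
by have /imsetP[a aA ->] := Ac ord0; apply: reverses_conj.
Qed.

(** The component at B is confined to [twists B], so that conjugating by it preserves
    [reverses _ B]. *)
Definition states := {x : {ffun {set V} -> {perm {perm V}}} * {set {set V}}
                        | [forall B, x.1 B \in twists B]}.
Implicit Types s : states.

Definition frames s B := (val s).1 B.
Definition bits s : {set {set V}} := (val s).2.
(* Every move multiplies the component of setT, which thus yields the frame.  *)
Definition frame s : {perm V} := frames s setT 1.

Definition push s A : {perm {perm V}} :=
  if [pick a in A] is Some a then twist a ^ frames s A else 1.

Lemma frames_twists s B : frames s B \in twists B.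
Proof. by have /forallP := valP s; apply. Qed.

Lemma push_twists s A : push s A \in twists A.
Proof.
rewrite /push; case: pickP => [a aA|_]; last exact: group1.
by rewrite groupJ ?frames_twists // mem_gen // imset_f.
Qed.

Definition shift_pair A s : {ffun {set V} -> {perm {perm V}}} * {set {set V}} :=
  ([ffun B : {set V} => if A \subset B then frames s B * push s A else frames s B], symd [set A] (bits s)).

Fact shift_subproof A s : [forall B, (shift_pair A s).1 B \in twists B].
Proof.
apply/forallP=> B; rewrite ffunE; case: ifP => [sAB|_]; last exact: frames_twists.
by rewrite groupM ?frames_twists // (subsetP (twistsS sAB)) ?push_twists.
Qed.

Definition shift A s : states := exist _ (shift_pair A s) (shift_subproof A s).

Lemma frames_shift A s B :
  frames (shift A s) B = if A \subset B then frames s B * push s A else frames s B.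
Proof. by rewrite /frames /= ffunE. Qed.

Lemma bits_shift A s : bits (shift A s) = symd [set A] (bits s).
Proof. by []. Qed.

Lemma frame_shift A s : frame (shift A s) = push s A (frame s).
Proof. by rewrite /frame frames_shift subsetT permM. Qed.

(** The involution at [B] is a conjugate by the component at [B], so multiplying this component on
    the right conjugates the involution. *)
Lemma push_shift A s B : push (shift A s) B = if A \subset B then push s B ^ push s A else push s B.
Proof.
rewrite {1}/push frames_shift {2 4}/push; case: pickP => [b _|_]; last by rewrite conj1g if_same.
by case: ifP => _; rewrite ?conjgM.
Qed.

Lemma pushK s A : push s A * push s A = 1.
Proof.
rewrite /push; case: pickP => [a _|_]; last by rewrite mulg1.
by rewrite -conjMg -{1}twistV mulVg conj1g.
Qed.

Lemma states_ext s s' : frames s =1 frames s' -> bits s = bits s' -> s = s'.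
Proof.
move=> ef eb; apply/val_inj; rewrite [LHS]surjective_pairing [RHS]surjective_pairing.
by congr pair => //; apply/ffunP.
Qed.

(** The involution [push s A] is conjugated only by itself, so the second move multiplies by the
    same element of order two. *)
Lemma shiftK A : involutive (shift A).
Proof.
move=> s; apply: states_ext => [B|].
  rewrite !frames_shift push_shift subxx conjgE mulKg; case: (A \subset B) => //.
  by rewrite -mulgA pushK mulg1.
by rewrite !bits_shift symdK.
Qed.

(** In either order the components above [B] are multiplied by [push s B * push s A]: doing A first
    turns the factor for B into its conjugate by [push s A]. *)
Lemma shiftC A B s : A \subset B -> shift A (shift B s) = shift B (shift A s).
Proof.
have [-> //|neAB sAB] := eqVneq A B.
have nBA : (B \subset A) = false by apply: contraNF neAB => sBA; rewrite eqEsubset sAB.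
apply: states_ext => [C|]; last first.
  by rewrite !bits_shift; apply/setP=> D; rewrite !in_symd addbCA.
rewrite !frames_shift !push_shift nBA sAB; have [sBC|nBC] := boolP (B \subset C).
  rewrite (subset_trans sAB sBC) conjgE -!mulgA; congr (_ * _); by rewrite mulKVg.
by [].
Qed.

Lemma push_reverses s A : A != set0 -> reverses (push s A) A.
Proof.
move=> nA; rewrite /push; case: pickP => [a aA|no]; last by case/set0Pn: nA => a; rewrite no.
by apply: reverses_conj_twists; rewrite ?frames_twists //; apply: twist_reverses.
Qed.

(** The conjugating element lies in the cyclic group generated by [twist a], hence commutes with it.
    This keeps the prescribed star maps at the vertices. *)
Lemma push_set1 s a : push s [set a] = twist a.
Proof.
rewrite /push; case: pickP => [b /set1P->|/(_ a)]; last by rewrite set11.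
apply/conjg_fixP/commgP/commute_sym.
have := frames_twists s [set a]; rewrite /twists imset_set1 => /cycleP[n ->].
exact/commute_sym/commuteX.
Qed.

Lemma frame_shift1 s a : frame (shift [set a] s) = frame s * gam (frame s a).
Proof. by rewrite frame_shift push_set1 twistE. Qed.

Lemma frame_shift_flag s A (t : m.+1.-tuple (simplex K)) : A != set0 ->
  is_flag t -> frame s @: A \subset val (tnth t ord_max) ->
  exists t' : m.+1.-tuple (simplex K), [/\ is_flag t',
    forall i, val (tnth t' i) = ((frame s)^-1 * frame (shift A s)) @: val (tnth t i) & oY t' = ~~ oY t].
Proof. by move=> nA ft sA; rewrite frame_shift; apply: push_reverses. Qed.

Lemma imset_perm_mulV f g B : (f^-1 * g) @: (f @: B) = g @: B.
Proof. by rewrite -imset_comp; apply: eq_imset => x /=; rewrite permM permK. Qed.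

Lemma frame_shift_K s A B : A != set0 -> A \subset B -> frame s @: B \in K ->
  frame (shift A s) @: B \in K.
Proof.
move=> nA sAB KB; have [F [KF sF cF]] := K_facet hK hY KB.
have [t ft et] := flag_of_facet hK KF cF.
have [|t' [ft' et' _]] := frame_shift_flag nA ft (_ : frame s @: A \subset _).
  by rewrite et (subset_trans _ sF) ?imsetS.
apply: (K_sub hK (valP (tnth t' ord_max))); last first.
  have := K_nonempty hK KB; rewrite -!card_gt0 !card_imset //; exact: perm_inj.
by rewrite et' et -(imset_perm_mulV (frame s)) imsetS.
Qed.

Lemma states_inhabited : 0 < #|{: states}|.
Proof.
have s0 : states.
  by exists ([ffun=> 1], set0); apply/forallP=> B; rewrite ffunE group1.
by apply/card_gt0P; exists s0.
Qed.

End States.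

(** * The cubic pseudo-manifold *)

Section ImageFamilies.

Local Open Scope group_scope.

Variable V : finType.
Implicit Types (f : {perm V}) (A B : {set V}) (C : {set {set V}}).

Definition img f C : {set {set V}} := [set f @: A | A : {set V} in C].

Lemma imset_permK f A : f^-1 @: (f @: A) = A.
Proof. by rewrite -imset_comp (eq_imset _ (g := id)) ?imset_id // => x /=; rewrite permK. Qed.

Lemma imset_permKV f A : f @: (f^-1 @: A) = A.
Proof. by rewrite -imset_comp (eq_imset _ (g := id)) ?imset_id // => x /=; rewrite permKV. Qed.

Lemma imset_perm_inj f : injective (fun A : {set V} => f @: A).
Proof. exact: (@can_inj _ _ _ (fun A : {set V} => f^-1 @: A) (imset_permK f)). Qed.

Lemma imset_perm_sub f A B : (f @: A \subset f @: B) = (A \subset B).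
Proof.
apply/idP/idP => [|/imsetS->//] /(imsetS f^-1).
by rewrite !imset_permK.
Qed.

Lemma mem_img f A C : (f @: A \in img f C) = (A \in C).
Proof. by rewrite mem_imset //; apply: imset_perm_inj. Qed.

Lemma imgK f C : img f^-1 (img f C) = C.
Proof.
by rewrite /img -imset_comp (eq_imset _ (g := id)) ?imset_id // => A /=; rewrite imset_permK.
Qed.

Lemma imgKV f C : img f (img f^-1 C) = C.
Proof.
by rewrite /img -imset_comp (eq_imset _ (g := id)) ?imset_id // => A /=; rewrite imset_permKV.
Qed.

Lemma card_img f C : #|img f C| = #|C|.
Proof. by rewrite card_imset //; apply: imset_perm_inj. Qed.

Lemma imgI f C C' : img f (C :&: C') = img f C :&: img f C'.
Proof. by rewrite /img imsetI // => A B _ _; apply: imset_perm_inj. Qed.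

Lemma img_sub f C C' : (img f C \subset img f C') = (C \subset C').
Proof.
apply/subsetP/subsetP => sC A => [CA|/imsetP[B CB ->]]; last by rewrite mem_img sC.
by rewrite -(mem_img f) sC // mem_img.
Qed.

Lemma nested_imset f A B : nested (f @: A) (f @: B) = nested A B.
Proof. by rewrite /nested !imset_perm_sub. Qed.

End ImageFamilies.

(** * The complex X built from states with commuting involutions *)

Section Realization.

Local Open Scope group_scope.

Variables (m : nat) (V : finType) (K : {set {set V}}).
Hypothesis hK : simplicial_complex K.
Hypothesis hY : pseudomanifold (simplex K) m.
Variable oY : m.+1.-tuple (simplex K) -> bool.
Hypothesis hoY : is_orientation oY.
Variable lam : V -> V.
Hypothesis lamK : involutive lam.
Variable chi : V -> V -> V.
Hypothesis chi_y : forall y, chi y y = lam y.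
Hypothesis reverse0 : m = 0 -> forall y (t u : m.+1.-tuple (simplex K)),
  (forall i, val (tnth t i) = [set y]) -> (forall i, val (tnth u i) = [set lam y]) -> oY u = ~~ oY t.

Variables (S : finType) (fr : S -> {perm V}) (bits : S -> {set {set V}}) (shift : {set V} -> S -> S).
Hypothesis shiftK : forall A, involutive (shift A).
Hypothesis shiftC : forall (A B : {set V}) s, A \subset B -> shift A (shift B s) = shift B (shift A s).
Hypothesis bits_shift : forall A s, bits (shift A s) = symd [set A] (bits s).
Hypothesis fr_flag : forall s (A : {set V}) (t : m.+1.-tuple (simplex K)), A != set0 ->
  is_flag t -> fr s @: A \subset val (tnth t ord_max) ->
  exists t' : m.+1.-tuple (simplex K), [/\ is_flag t',
    forall i, val (tnth t' i) = ((fr s)^-1 * fr (shift A s)) @: val (tnth t i) & oY t' = ~~ oY t].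
Hypothesis fr_K : forall s (A B : {set V}), A != set0 -> A \subset B -> fr s @: B \in K ->
  fr (shift A s) @: B \in K.
Hypothesis fr_chi : forall s a v, v \in cover (vertex_star K (fr s a)) ->
  fr (shift [set a] s) ((fr s)^-1 v) = chi (fr s a) v.

Implicit Types (s : S) (A B : {set V}) (C : {set {set V}}).

Local Notation cc := (component m K lam).

Lemma lam_neq : m = 0 -> forall y, lam y != y.
Proof.
move=> m0 y; have [_ K1 _] := hK; apply/eqP=> e.
pose t := [tuple of nseq m.+1 (Simplex (K1 y))].
have te i : val (tnth t i) = [set y] by rewrite tnth_nseq.
by have := reverse0 m0 te (u := t); rewrite e => /(_ te); case: (oY t).
Qed.

Definition vertex_ok (p : {set V} * S) : bool := (p.1 \in K) && (cc p.1 == p.1).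

(** The vertices of X. A vertex has a connected link, except possibly for m = 0, so each state gives
    one vertex per component; the component is named by its root. *)
Definition Q := {p : {set V} * S | vertex_ok p}.
Implicit Types q : Q.

Definition vcomp q : {set V} := (val q).1.
Definition vstate q : S := (val q).2.
Definition vframe q : {perm V} := fr (vstate q).

Lemma vcomp_K q : vcomp q \in K. Proof. by have /andP[] := valP q. Qed.
Lemma vcomp_root q : cc (vcomp q) = vcomp q. Proof. by have /andP[_ /eqP] := valP q. Qed.

Lemma Q_ext q q' : vcomp q = vcomp q' -> vstate q = vstate q' -> q = q'.
Proof.
by move=> e1 e2; apply/val_inj; rewrite [LHS]surjective_pairing [RHS]surjective_pairing -/(vcomp q) -/(vstate q) e1 e2.
Qed.

Lemma Q_exists B s : B \in K -> exists2 q, vcomp q = cc B & vstate q = s.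
Proof.
move=> KB; have h : vertex_ok (cc B, s) by rewrite /vertex_ok /= component_in //= component_root.
by exists (exist (fun p => is_true (vertex_ok p)) _ h).
Qed.

Definition qdirs q : {set {set V}} := [set A : {set V} | (vframe q @: A \in K) && (cc (vframe q @: A) == vcomp q)].

(** The component is computed anew, since an anti-isomorphism may lead to the star of a vertex in
    another component. For [A] in [qdirs q] the pair is admissible and the default [q] does not
    occur. *)
Definition qflip A q : Q := insubd q (cc (fr (shift A (vstate q)) @: A), shift A (vstate q)).

Lemma qdirsP q A : reflect (vframe q @: A \in K /\ cc (vframe q @: A) = vcomp q) (A \in qdirs q).
Proof. by rewrite inE; apply: (iffP andP) => -[? /eqP]. Qed.

Lemma qdirs_nonempty q A : A \in qdirs q -> A != set0.
Proof.
case/qdirsP=> KA _; have := K_nonempty hK KA.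
by apply: contraNneq => ->; rewrite imset0.
Qed.

Lemma qflipE q A : A \in qdirs q ->
  vcomp (qflip A q) = cc (fr (shift A (vstate q)) @: A) /\ vstate (qflip A q) = shift A (vstate q).
Proof.
move=> qA; have [KA cA] := qdirsP _ _ qA.
have h : vertex_ok (cc (fr (shift A (vstate q)) @: A), shift A (vstate q)).
  rewrite /vertex_ok /= component_root // eqxx andbT component_in //.
  exact: fr_K (qdirs_nonempty qA) (subxx A) KA.
by rewrite /vcomp /vstate /qflip insubdK.
Qed.

Lemma qflipK q A : A \in qdirs q -> qflip A (qflip A q) = q.
Proof.
move=> qA; have [k1 s1] := qflipE qA; have [KA cA] := qdirsP _ _ qA.
have qA' : A \in qdirs (qflip A q).
  apply/qdirsP; rewrite /vframe s1 k1; split=> //.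
  exact: fr_K (qdirs_nonempty qA) (subxx A) KA.
have [k2 s2] := qflipE qA'; apply: Q_ext; last by rewrite s2 s1 shiftK.
by rewrite k2 s1 shiftK.
Qed.

Lemma shift_nested A B s : A != set0 -> B != set0 -> nested A B -> fr s @: A \in K -> fr s @: B \in K ->
  fr (shift A s) @: B \in K /\ cc (fr (shift A s) @: B) = cc (fr (shift A s) @: A).
Proof.
move=> nA nB nAB KA KB.
have KA' : fr (shift A s) @: A \in K by apply: fr_K.
have KB' : fr (shift A s) @: B \in K.
  case/orP: nAB => sAB; first exact: fr_K.
  apply: K_sub KA' _ _ => //; first exact: imsetS.
  by rewrite imset_eq0.
by split=> //; apply: component_nested => //; rewrite nested_imset nested_sym.
Qed.

Lemma qdirs_flip q A B : A \in qdirs q -> B \in qdirs q -> nested A B -> B \in qdirs (qflip A q).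
Proof.
move=> qA qB nAB; have [k1 s1] := qflipE qA; apply/qdirsP; rewrite /vframe s1 k1.
have [KA _] := qdirsP _ _ qA; have [KB _] := qdirsP _ _ qB.
exact: shift_nested (qdirs_nonempty qA) (qdirs_nonempty qB) nAB KA KB.
Qed.

Lemma qflipC q A B : A \in qdirs q -> B \in qdirs q -> nested A B ->
  qflip A (qflip B q) = qflip B (qflip A q).
Proof.
move=> qA qB nAB; have nBA : nested B A by rewrite nested_sym.
have [k1 s1] := qflipE qA; have [k2 s2] := qflipE qB.
have qA' := qdirs_flip qB qA nBA; have qB' := qdirs_flip qA qB nAB.
have [k3 s3] := qflipE qA'; have [k4 s4] := qflipE qB'.
have es : shift A (shift B (vstate q)) = shift B (shift A (vstate q)).
  by case/orP: nAB => sAB; [rewrite shiftC|rewrite -shiftC].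
have qB'' := qdirs_flip qA' (qdirs_flip qB qB (nested_refl B)) nAB.
have [_ kB] := qdirsP _ _ qB''.
apply: Q_ext; last by rewrite s3 s4 s1 s2.
by rewrite -kB k4 /vframe s3 s1 s2 es.
Qed.

Definition qbits q := bits (vstate q).

Lemma qbits_flip q A : A \in qdirs q -> qbits (qflip A q) = symd [set A] (qbits q).
Proof. by move=> qA; have [_ e] := qflipE qA; rewrite /qbits e bits_shift. Qed.

Definition sys : flip_system :=
  @FlipSystem Q {set V} qdirs (@nested V) qbits qflip (@nested_refl V)
    qflipK qdirs_flip qflipC qbits_flip.

Local Notation X := (cell sys).

(** The frame at [q] turns labels into simplices and preserves inclusions; every local question
    about X becomes one about chains of simplices. *)
Lemma cliqueE q C : @clique sys q C = good_chain m K lam (vcomp q) (img (vframe q) C).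
Proof.
apply/cliqueP/good_chainP => [[dC cC]|[KC cC nC]]; split.
- by move=> _ /imsetP[A CA ->]; have /qdirsP[] := dC A CA.
- by move=> _ /imsetP[A CA ->]; have /qdirsP[] := dC A CA.
- by apply/all_nestedP=> _ _ /imsetP[A CA ->] /imsetP[B CB ->]; rewrite nested_imset; apply: cC.
- by move=> A CA; apply/qdirsP; rewrite KC ?cC // mem_img.
- move=> A B CA CB; rewrite /= -(nested_imset (vframe q)).
  by move/all_nestedP: nC; apply; rewrite mem_img.
Qed.

Lemma clique_card q C : @clique sys q C -> #|C| <= m.+1.
Proof.
rewrite cliqueE -(card_img (vframe q)).
exact: (good_chain_card hK hY lamK (vcomp_K q) (vcomp_root q)).
Qed.

Lemma clique_extend q C : @clique sys q C ->
  exists C', [/\ @clique sys q C', #|C'| = m.+1 & C \subset C'].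
Proof.
rewrite cliqueE => gC.
have [l [ul sl _ gl sC]] := good_chain_extend hK hY lamK (vcomp_K q) (vcomp_root q) gC.
exists (img (vframe q)^-1 (prefixes l)); rewrite cliqueE imgKV card_img card_prefixes // sl; split=> //.
by rewrite -(imgK (vframe q) C) /img imsetS.
Qed.

Lemma X_dim_le (c : X) : cell_dim c <= m.+1.
Proof. by rewrite cell_dimE; have [x cx] := cell_nonempty c; have [/clique_card] := cell_cube cx. Qed.

Lemma X_pure (c : X) : exists2 d : X, (c <= d)%O & cell_dim d = m.+1.
Proof.
have [x cx] := cell_nonempty c; have [cl _] := cell_cube cx.
have [C [clC cC sC]] := clique_extend cl; have [d dx ed] := exists_cell clC.
by exists d; [rewrite (cell_leE _ cx) dx ed|rewrite cell_dimE ed].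
Qed.

(** At a vertex of [c], the larger cells correspond to the simplices which complete the chain of
    [c]. *)
Lemma X_two (c : X) : (cell_dim c).+1 = m.+1 ->
  #|[set d : X | (c <= d)%O && (cell_dim d == m.+1)]| = 2.
Proof.
rewrite cell_dimE => -[cC]; have [x cx] := cell_nonempty c; have [cl _] := cell_cube cx.
have gC := cl; rewrite cliqueE in gC; set C := cdirs c in cl gC cC.
have cC' : #|img (vframe x) C| = m by rewrite card_img.
rewrite -(codim1_chain_extensions hK hY lamK lam_neq (vcomp_K x) (vcomp_root x) gC cC').
set E := [set B | _].
have EP B : B \in E -> B \notin img (vframe x) C /\ @clique sys x ((vframe x)^-1 @: B |: C).
  rewrite inE => /andP[nB gB]; split=> //; rewrite cliqueE /img imsetU1 imset_permKV.
  exact: gB.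
pose f B : X := mkcell c x ((vframe x)^-1 @: B |: C).
rewrite -(card_in_imset (f := f) (D := mem E)) => [|B B' /EP[nB clB] /EP[nB' clB'] ef]; last first.
  have [_ e1] := mkcellP c clB; have [_ e2] := mkcellP c clB'.
  have e : (vframe x)^-1 @: B |: C = (vframe x)^-1 @: B' |: C by rewrite -e1 -e2 -/(f B) ef.
  have : (vframe x)^-1 @: B \in (vframe x)^-1 @: B' |: C by rewrite -e setU11.
  rewrite in_setU1 => /predU1P[/imset_perm_inj //|h].
  by rewrite -[B](imset_permKV (vframe x)) mem_img h in nB.
apply: eq_card => d; rewrite inE; apply/andP/imsetP => [[le_cd /eqP dimd]|[B EB ->]].
  have := le_cd; rewrite (cell_leE _ cx) -/C => /andP[dx sC].
  have [cld _] := cell_cube dx; rewrite cell_dimE in dimd.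
  have /cards1P[A eA] : #|cdirs d :\: C| == 1%N.
    by rewrite cardsD (setIidPr sC) dimd cC subSnn.
  have /setDP[dA CA] : A \in cdirs d :\: C by rewrite eA set11.
  have eC : cdirs d = A |: C by rewrite -eA setUC -{1}(setIidPr sC) setID.
  exists (vframe x @: A).
    rewrite inE mem_img CA /=.
    by have := cld; rewrite cliqueE eC /img imsetU1.
  have clA : @clique sys x ((vframe x)^-1 @: (vframe x @: A) |: C) by rewrite imset_permK -eC.
  have [fx ef] := mkcellP c clA; apply: (cell_eq dx fx).
  by rewrite ef imset_permK eC.
have [nB clB] := EP _ EB; have [fx ef] := mkcellP c clB.
rewrite (cell_leE _ cx) fx ef subsetU1 cell_dimE ef cardsU1 cC; split=> //.
suff -> : (vframe x)^-1 @: B \notin C by rewrite add1n.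
by rewrite -(mem_img (vframe x)) imset_permKV.
Qed.

Lemma X_star_connected (a : X) : star_connected m.+1 a.
Proof.
have [x ax] := cell_nonempty a; have [cl _] := cell_cube ax.
apply: (star_connected_cell ax) => H full H_adj C1 C2 f1 f2.
have gC := cl; rewrite cliqueE in gC.
pose H' C := H (img (vframe x)^-1 C).
have fullE C : full (img (vframe x)^-1 C) = full_chain m K lam (vcomp x) (img (vframe x) (cdirs a)) C.
  rewrite /full /full_chain cliqueE imgKV card_img; congr [&& _, _ & _].
  by rewrite -{2}(imgKV (vframe x) C) img_sub.
have e C : C = img (vframe x)^-1 (img (vframe x) C) by rewrite imgK.
rewrite (e C1) (e C2) in f1 f2 *; rewrite -!/(H' _); rewrite !fullE in f1 f2.
apply: (full_chains_connected hK hY hoY lamK (vcomp_K x) (vcomp_root x) gC _ f1 f2).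
move=> D1 D2; rewrite -!fullE => h1 h2 cI; apply: H_adj => //.
by rewrite -imgI card_img.
Qed.

(** * Orientation of X *)

Definition chain q C : {set simplex K} := [set a : simplex K | (vframe q)^-1 @: val a \in C].

Lemma chainP q C a : reflect (exists2 A, A \in C & val a = vframe q @: A) (a \in chain q C).
Proof.
rewrite inE; apply: (iffP idP) => [Ca|[A CA ->]]; last by rewrite imset_permK.
by exists ((vframe q)^-1 @: val a); rewrite ?imset_permKV.
Qed.

Lemma chain_ex q C A : @clique sys q C -> A \in C -> exists2 a, a \in chain q C & val a = vframe q @: A.
Proof.
move=> /cliqueP[dC _] CA; have /qdirsP[KA _] := dC A CA.
by have [a ea] := simplex_of KA; exists a => //; apply/chainP; exists A.
Qed.

Lemma val_chain q C : @clique sys q C -> [set val a | a in chain q C] = img (vframe q) C.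
Proof.
move=> cl; apply/setP=> B; apply/imsetP/imsetP => [[a /chainP[A CA ea] ->]|[A CA ->]].
  by exists A.
by have [a Ca ea] := chain_ex cl CA; exists a.
Qed.

Lemma card_chain q C : @clique sys q C -> #|chain q C| = #|C|.
Proof.
move=> cl; rewrite -(card_img (vframe q) C) -(val_chain cl) card_imset //; exact: val_inj.
Qed.

Lemma chain_is_chain q C : @clique sys q C -> C != set0 -> is_chain (chain q C) && (chain q C != set0).
Proof.
move=> cl nC; rewrite -!card_gt0 card_chain // card_gt0 nC andbT.
apply/forall_inP=> a /chainP[A CA ea]; apply/forall_inP=> b /chainP[B CB eb].
rewrite /Order.comparable !simplex_leE ea eb -[_ || _]/(nested _ _) nested_imset.
by have [_ cC] := cliqueP _ _ cl; apply: cC.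
Qed.

Lemma chain_inj q C C' : @clique sys q C -> @clique sys q C' -> chain q C = chain q C' -> C = C'.
Proof.
move=> cl cl' e; rewrite -[C](imgK (vframe q)) -[C'](imgK (vframe q)).
by rewrite -(val_chain cl) -(val_chain cl') e.
Qed.

Lemma chainS q C C' : C \subset C' -> chain q C \subset chain q C'.
Proof. by move=> /subsetP sC; apply/subsetP=> a; rewrite !inE; apply: sC. Qed.

Definition chains q (t : m.+2.-tuple X) (r : m.+1.-tuple (sd (simplex K))) : bool :=
  (q \in val (tnth t ord0)) &&
  [forall i, val (tnth r i) == chain q (cdirs (tnth t (lift ord0 i)))].

(** A flag with vertex q, stripped of q, is a flag of the link, that is, of Y', and is given its
    sign there. By [oXE] the choices of q and r do not matter. *)
Definition oX (t : m.+2.-tuple X) : bool :=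
  [exists q, exists r, chains q t r && sd_orientation oY r].

Lemma oXE q t r : cdirs (tnth t ord0) = set0 -> chains q t r -> oX t = sd_orientation oY r.
Proof.
move=> t0 /andP[qt /forallP er]; apply/existsP/idP => [[q' /existsP[r' /andP[/andP[qt' /forallP er'] ot]]]|ot].
  have eq : q' = q.
    have := cell_vertex qt t0; move: qt'; move=> /[swap] ->; by rewrite inE => /eqP.
  suff -> : r = r' by [].
  apply: eq_from_tnth => i; apply/val_inj.
  by rewrite (eqP (er i)) (eqP (er' i)) eq.
exists q; apply/existsP; exists r; rewrite ot andbT /chains qt.
exact/forallP.
Qed.

Lemma X_flag_facts (t : m.+2.-tuple X) q : is_flag t -> q \in val (tnth t ord0) ->
  [/\ cdirs (tnth t ord0) = set0, forall i, q \in val (tnth t i),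
      forall i, @clique sys q (cdirs (tnth t i)),
      forall i : 'I_m.+2, #|cdirs (tnth t i)| = i &
      forall i j : 'I_m.+2, i <= j -> cdirs (tnth t i) \subset cdirs (tnth t j)].
Proof.
move=> /is_flagP[le_t dim_t] qt.
have qi i : q \in val (tnth t i) by apply: (subsetP (le_t ord0 i (leq0n i))).
have ci i : #|cdirs (tnth t i)| = i by rewrite -cell_dimE dim_t.
split=> //; first by apply/eqP; rewrite -cards_eq0 ci.
  by move=> i; have [] := cell_cube (qi i).
by move=> i j /le_t; rewrite (cell_leE _ (qi i)) => /andP[].
Qed.

Lemma chains_exist (t : m.+2.-tuple X) q : is_flag t -> q \in val (tnth t ord0) ->
  exists2 r, chains q t r & sd_tower r.
Proof.
move=> ft qt; have [_ _ cl ct mon] := X_flag_facts ft qt.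
have h i : is_chain (chain q (cdirs (tnth t (lift ord0 i)))) && (chain q (cdirs (tnth t (lift ord0 i))) != set0).
  by apply: chain_is_chain; rewrite // -card_gt0 ct.
exists [tuple Sd (h i) | i < m.+1].
  by rewrite /chains qt; apply/forallP=> i; rewrite tnth_mktuple.
split=> [i j le_ij|i]; rewrite !tnth_mktuple /=; first by apply/chainS/mon.
by rewrite card_chain // ct.
Qed.

Lemma K_le : {in K, forall A : {set V}, #|A| <= m.+1}.
Proof. by move=> A /(K_card hK hY)/andP[]. Qed.

(** Inside one link the sign is that of the subdivision, which changes at every step; across an edge
    the chains keep their labels while the frame changes by an orientation-reversing map. *)
Lemma oX_orientation : is_orientation oX.
Proof.
move=> _ i t u ft fu dtu.
have [q qt] := cell_nonempty (tnth t ord0).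
have [t0 qti clt ct mon] := X_flag_facts ft qt.
have [r rt tr] := chains_exist ft qt; rewrite (oXE t0 rt).
have [_ /forallP er] := andP rt; have [w fw ew] := tower_flag hK K_le tr.
case: (unliftP ord0 i) => [j ij|i0]; last first.
  (* The vertex changes, necessarily to the other end of the first edge, whose label is called [A]
     below. *)
  have [q' qu] := cell_nonempty (tnth u ord0).
  have [u0 qui clu cu su] := X_flag_facts fu qu.
  have [r' ru tr'] := chains_exist fu qu; rewrite (oXE u0 ru).
  have [_ /forallP er'] := andP ru.
  have same j : tnth u (lift ord0 j) = tnth t (lift ord0 j).
    have ne : lift ord0 j != ord0 by rewrite eq_sym neq_lift.
    by have := dtu (lift ord0 j); rewrite i0 ne => /eqP->.
  have /cards1P[A eA] : #|cdirs (tnth t (lift ord0 ord0))| == 1%N by rewrite ct.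
  have Aj j : A \in cdirs (tnth t (lift ord0 j)).
    by apply: (subsetP (mon (lift ord0 ord0) _ _)); rewrite ?eA ?set11.
  have Aq : A \in qdirs q.
    have [dC _] := cliqueP _ _ (clt (lift ord0 ord0)); apply: dC; exact: Aj.
  have neq : q' <> q.
    move=> e; have := dtu ord0; rewrite i0 eqxx => /negP[]; apply/eqP.
    by apply: (cell_eq qt); rewrite ?t0 ?u0 // -e.
  have eq' : q' = qflip A q.
    have [cl1 e1] := cell_cube (qti (lift ord0 ord0)).
    have := qui (lift ord0 ord0); rewrite same e1 eA => /cubeP[T].
    rewrite subset1 => /orP[]/eqP->; last by rewrite flips0 => /neq.
    by rewrite /flips enum_set1.
  have [k1 s1] := qflipE Aq.
  have eg : vframe q' = fr (shift A (vstate q)) by rewrite /vframe eq' s1.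
  have sA : fr (vstate q) @: A \subset val (tnth w ord_max).
    have [a aC ea] := chain_ex (clt (lift ord0 ord_max)) (Aj ord_max).
    rewrite -/(vframe q) -ea; move: aC; rewrite -(eqP (er ord_max)) -ew inE => /tnthP[k ->].
    by have [le_w _] := (simplex_flagP hK w).1 fw; apply: le_w; rewrite -ltnS.
  have [v [fv ev ov]] := fr_flag (qdirs_nonempty Aq) fw sA.
  have mem l k : (tnth v k \in val (tnth r' l)) = (tnth w k \in val (tnth r l)).
    rewrite (eqP (er l)) (eqP (er' l)) !inE same ev -/(vframe q) -eg.
    suff -> : (vframe q')^-1 @: (((vframe q)^-1 * vframe q') @: val (tnth w k)) = (vframe q)^-1 @: val (tnth w k) by [].
    by rewrite -imset_comp; apply: eq_imset => x /=; rewrite permM permK.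
  apply: (sd_orientation_flip fw fv tr tr' ew _ mem ov).
  apply/eqP; rewrite eqEcard (card_flag_set fv); apply/andP; split.
    by apply/subsetP=> a; rewrite inE => /tnthP[k ->]; rewrite mem -ew inE mem_tnth.
  by have [_ ->] := tr'.
(* The vertex stays, and the two flags of its link differ in one place. *)
have tu0 : tnth t ord0 = tnth u ord0 by apply/eqP; rewrite dtu ij neq_lift.
have qu := qt; rewrite tu0 in qu.
have [u0 qui clu cu su] := X_flag_facts fu qu.
have [r' ru tr'] := chains_exist fu qu; rewrite (oXE u0 ru).
have [_ /forallP er'] := andP ru; have [w' fw' ew'] := tower_flag hK K_le tr'.
have drr' : differ_only_at j r r'.
  move=> k; have := dtu (lift ord0 k); rewrite ij (inj_eq (@lift_inj _ ord0)) => <-.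
  apply/eqP/eqP => [e|e].
    apply: (cell_eq (qti _) (qui _)); apply: (chain_inj (clt _) (clu _)).
    by rewrite -(eqP (er k)) -(eqP (er' k)) e.
  by apply/val_inj; rewrite (eqP (er k)) (eqP (er' k)) e.
have [lt_jm|le_mj] := ltnP j m; first exact: sd_orientation_swap lt_jm fw tr tr' ew drr'.
have ej : j = ord_max by apply/val_inj/eqP; rewrite /= eqn_leq le_mj -ltnS ltn_ord.
rewrite ej in drr'; have [m0|m0] := posnP m; last first.
  exact: sd_orientation_last hoY m0 fw fw' tr tr' ew ew' drr'.
(* For m = 0 the two edges at the vertex correspond to y and [lam y], whose orientations are
   opposite by [reverse0]. *)
have imax (k : 'I_m.+1) : k = ord_max.
  apply/val_inj/eqP; rewrite /= eqn_leq -ltnS ltn_ord.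
  by apply: leq_trans (_ : m <= 0) (leq0n _); rewrite m0.
have [y ey] : exists y, val (tnth w ord_max) = [set y].
  by apply/cards1P; have [_ ->] := (simplex_flagP hK w).1 fw; rewrite m0.
have mem0 (w0 : m.+1.-tuple (simplex K)) (r0 : m.+1.-tuple (sd (simplex K))) :
    [set a in w0] = val (tnth r0 ord_max) -> forall k, tnth w0 k \in val (tnth r0 ord_max).
  by move=> <- k; rewrite inE mem_tnth.
apply: (sd_orientation_flip fw fw' tr tr' ew ew') => [l k|].
  by rewrite (imax l) !mem0.
have cckap (a : simplex K) C : @clique sys q C -> a \in chain q C -> cc (val a) = vcomp q.
  by move=> /cliqueP[dC _] /chainP[A CA ->]; have /qdirsP[] := dC A CA.
have cw : cc (val (tnth w ord_max)) = vcomp q.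
  by apply: cckap (clt (lift ord0 ord_max)) _; rewrite -(eqP (er _)) mem0.
have cw' : cc (val (tnth w' ord_max)) = vcomp q.
  by apply: cckap (clu (lift ord0 ord_max)) _; rewrite -(eqP (er' _)) mem0.
have := component_dim0 hK hY lamK y (val (tnth w' ord_max)) m0.
rewrite (valP (tnth w' ord_max)) cw' -ey cw eqxx in_set2 => /esym/orP[/eqP e|/eqP e].
  have eww' : w' = w.
    by apply: eq_from_tnth => k; apply/val_inj; rewrite (imax k) e.
  have := drr' ord_max; rewrite eqxx => /negP[]; apply/eqP/val_inj.
  by rewrite -ew -ew' eww'.
by apply: (reverse0 m0 (y := y)) => k; rewrite (imax k).
Qed.

Lemma X_pseudomanifold : pseudomanifold X m.+1.
Proof.
split=> [c|c|a]; [exact: X_pure|exact: X_two|].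
apply: (local_homology_of_star_connected oX_orientation X_dim_le X_two); last exact: X_star_connected.
have [d le_ad dimd] := X_pure a.
have [c c0|t ft td] := flag_exists _ dimd.
  rewrite !cell_dimE in c0 *; have /card_gt0P[A cA] := c0.
  have [x cx] := cell_nonempty c; have [b [xb eb le_bc]] := cell_face cx (subsetDl _ [set A] : cdirs c :\ A \subset _).
  have eD := cardsD1 A (cdirs c); rewrite cA add1n in eD.
  exists b; last by rewrite cell_dimE eb eD.
  rewrite lt_neqAle le_bc andbT; apply: contraTneq cA => <-.
  by rewrite eb setD11.
by exists t; rewrite flag_over_last // td.
Qed.

(** * Identification of the links with copies of the subdivision *)

Local Notation L := (links X).

Lemma link_chain (p : L) : is_chain (chain (lq p) (ldir p)) && (chain (lq p) (ldir p) != set0).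
Proof. exact: chain_is_chain (ldir_clique p) (ldir_nonempty p). Qed.

Definition Phi (p : L) : copies (sd (simplex K)) S := (Sd (link_chain p), vstate (lq p)).

Lemma chain_ofE (p : L) : chain_of (Phi p).1 = img (vframe (lq p)) (ldir p).
Proof. by rewrite -(val_chain (ldir_clique p)); apply: eq_imset. Qed.

Lemma vcomp_link (p : L) A : A \in ldir p -> cc (vframe (lq p) @: A) = vcomp (lq p).
Proof. by have /cliqueP[dC _] := ldir_clique p; move=> /dC/qdirsP[]. Qed.

(** The state gives the frame, and the simplex that the frame assigns to a common label determines
    the component. *)
Lemma lq_of_common_dir (p p' : L) : vstate (lq p) = vstate (lq p') ->
  (exists2 A, A \in ldir p & A \in ldir p') -> lq p = lq p'.
Proof.
move=> es [A pA p'A]; apply: Q_ext => //.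
by rewrite -(vcomp_link pA) -(vcomp_link p'A) /vframe es.
Qed.

Lemma Phi_le (p p' : L) : (Phi p <= Phi p')%O = (p <= p')%O.
Proof.
rewrite links_leE -[LHS]/((chain (lq p) (ldir p) \subset chain (lq p') (ldir p')) && (vstate (lq p) == vstate (lq p'))).
apply/andP/andP => [[sC /eqP es]|[/eqP eq sd']]; last by rewrite eq chainS.
have sub : ldir p \subset ldir p'.
  rewrite -(img_sub (vframe (lq p))) -(val_chain (ldir_clique p)) /vframe es -/(vframe (lq p')).
  rewrite -(val_chain (ldir_clique p')); exact: imsetS.
split=> //; apply/eqP/lq_of_common_dir => //.
by have /set0Pn[A pA] := ldir_nonempty p; exists A; rewrite ?(subsetP sub).
Qed.

Lemma Phi_inj : injective Phi.
Proof. by move=> p p' e; apply/le_anti; rewrite -!Phi_le e lexx. Qed.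

Lemma Phi_onto (c : copies (sd (simplex K)) S) : exists p, Phi p = c.
Proof.
case: c => D s; have /andP[/forall_inP chD /set0Pn[a0 Da0]] := valP D.
have [q kq sq] := Q_exists s (valP a0).
pose C := [set (fr s)^-1 @: val (a : simplex K) | a in val D].
have gE (a : simplex K) : vframe q @: ((fr s)^-1 @: val a) = val a by rewrite /vframe sq imset_permKV.
have clC : @clique sys q C.
  rewrite cliqueE; apply/good_chainP.
  have iC B : B \in img (vframe q) C -> exists2 a : simplex K, a \in val D & B = val a.
    by case/imsetP=> _ /imsetP[a Da ->] ->; exists a; rewrite ?gE.
  have nD (a b : simplex K) : a \in val D -> b \in val D -> nested (val a) (val b).
    by move=> Da Db; have /forall_inP := chD a Da; apply.
  split; first by move=> _ /iC[a _ ->]; apply: valP.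
    by move=> _ /iC[a Da ->]; rewrite kq; apply: component_nested; rewrite ?nD //; apply: valP.
  by apply/all_nestedP=> _ _ /iC[a Da ->] /iC[b Db ->]; apply: nD.
have nC : C != set0 by apply/set0Pn; exists ((fr s)^-1 @: val a0); apply: imset_f.
have [p ep ed] := link_exists clC nC.
exists p; rewrite /Phi; congr pair; last by rewrite ep sq.
apply/val_inj; rewrite /= ep ed; apply/setP=> a; rewrite inE /vframe sq.
apply/imsetP/idP => [[b Db /imset_perm_inj/val_inj->] //|Da].
by exists a.
Qed.

Lemma Phi_bij : bijective Phi.
Proof.
apply: inj_card_bij Phi_inj _.
rewrite -(card_codom Phi_inj); apply/subset_leq_card/subsetP=> c _.
by have [p <-] := Phi_onto c; apply: codom_f.
Qed.

Lemma Phi_oriented : oriented_iso (links_orientation oX) (copies_orientation (sd_orientation oY)) Phi.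
Proof.
split; [exact: Phi_bij|exact: Phi_le|].
move=> t /is_flagP[le_t _]; rewrite /copies_orientation /links_orientation; symmetry.
have same i : lq (tnth t i) = lq (tnth t ord0).
  by have := le_t ord0 i (leq0n i); rewrite links_leE => /andP[/eqP].
have th : thead t = tnth t ord0 by [].
have [e0 ev] := link_vertexE (thead t).
apply: (@oXE (lq (thead t))); rewrite ?tnth0 //.
apply/andP; split; first by rewrite tnth0 ev set11.
apply/forallP=> i; rewrite !tnth_map /= tnthS tnth_map.
by rewrite -/(ldir _) same.
Qed.

(** * The edge involution and the transport on the copies *)

Lemma singleton_link (z : L) B : chain_of (Phi z).1 = [set B] ->
  exists A, [/\ ldir z = [set A], vframe (lq z) @: A = B & A \in qdirs (lq z)].
Proof.
rewrite chain_ofE => e; have /cards1P[A eA] : #|ldir z| == 1%N by rewrite -(card_img (vframe (lq z))) e cards1.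
exists A; split=> //; first by move: e; rewrite eA /img imset_set1 => /set1_inj.
by have /cliqueP[dC _] := ldir_clique z; apply: dC; rewrite eA set11.
Qed.

Lemma Phi_reverse (z : L) A : ldir z = [set A] ->
  [/\ chain_of (Phi (reverse_edge z)).1 = [set fr (shift A (vstate (lq z))) @: A],
      (Phi (reverse_edge z)).2 = shift A (vstate (lq z)) & vframe (lq (reverse_edge z)) = fr (shift A (vstate (lq z)))].
Proof.
move=> ez; have [rq rd] := reverse_edgeE ez.
have qA : A \in qdirs (lq z) by have /cliqueP[dC _] := ldir_clique z; apply: dC; rewrite ez set11.
have [k1 s1] := qflipE qA.
have gE : vframe (lq (reverse_edge z)) = fr (shift A (vstate (lq z))) by rewrite /vframe rq s1.
by rewrite chain_ofE rd /img imset_set1 gE; split=> //; rewrite /= rq s1.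
Qed.

(** An edge has the same label at both ends, and frames are bijections, so both simplices have as
    many vertices as the label. *)
Lemma W_reverse j (z : L) : (Phi z).1 \in W (simplex K) j -> (Phi (reverse_edge z)).1 \in W (simplex K) j.
Proof.
rewrite inE => /existsP[a /andP[/eqP ea /eqP dima]].
have [|A [ez eA qA]] := @singleton_link z (val a); first by rewrite /chain_of -[sd_set _]/(val _) ea imset_set1.
have [ec es eg] := Phi_reverse ez.
have /cards1P[b eb] : #|val (Phi (reverse_edge z)).1| == 1%N.
  rewrite -(card_imset _ (@val_inj _ _ (simplex K))) -[[set _ | _ in _]]/(chain_of (Phi (reverse_edge z)).1).
  by rewrite ec cards1.
rewrite inE; apply/existsP; exists b; rewrite eb eqxx /= -dima !simplex_dim //.
have vb : val b = fr (shift A (vstate (lq z))) @: A.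
  have : val b \in chain_of (Phi (reverse_edge z)).1 by apply: imset_f; rewrite -[sd_set _]/(val _) eb set11.
  by rewrite ec => /set1P.
by rewrite vb -eA !card_imset //; apply: perm_inj.
Qed.

Lemma copy_vertex_link (z : L) (y : V) s : is_copy_vertex (Phi z) y s ->
  exists a, [/\ ldir z = [set [set a]], vframe (lq z) a = y & [set a] \in qdirs (lq z)].
Proof.
move=> [/singleton_link[A [ez eA qA]] _].
have /cards1P[a ea] : #|A| == 1%N by rewrite -(card_imset _ (@perm_inj _ (vframe (lq z)))) eA cards1.
by exists a; rewrite -ea; split=> //; apply: set1_inj; rewrite -eA ea imset_set1.
Qed.

Lemma fr_shift_vertex q a v : v \in cover (vertex_star K (vframe q a)) ->
  fr (shift [set a] (vstate q)) ((vframe q)^-1 v) = chi (vframe q a) v.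
Proof. exact: fr_chi. Qed.

Lemma cover_star y B : B \in K -> y \in B -> {subset B <= cover (vertex_star K y)}.
Proof.
move=> KB yB v vB; apply/bigcupP; exists B => //; rewrite inE KB /=.
by apply/exists_inP; exists B; rewrite ?yB ?subxx.
Qed.

Lemma vertex_reverse (z : L) (y : V) s : is_copy_vertex (Phi z) y s ->
  exists s1, is_copy_vertex (Phi (reverse_edge z)) (lam y) s1.
Proof.
move=> /copy_vertex_link[a [ez ea qA]]; have [ec es eg] := Phi_reverse ez.
exists (Phi (reverse_edge z)).2; split=> //; rewrite ec imset_set1.
have [_ K1 _] := hK.
have := @fr_shift_vertex (lq z) a (vframe (lq z) a) (cover_star (K1 _) (set11 _) (set11 _)).
by rewrite permK ea chi_y => ->.
Qed.

(** The transport keeps labels, and on the star of y the new frame is the old one followed by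
    [chi y]; so the simplices named by the labels are moved by [chi y]. *)
Lemma transport_chi (z : L) (y : V) s s1 : is_copy_vertex (Phi z) y s ->
  is_copy_vertex (Phi (reverse_edge z)) (lam y) s1 ->
  forall w w' : L, w \in star z ->
    (edge_transport z w w' <->
       chain_of (Phi w').1 = [set chi y @: (a : {set V}) | a in chain_of (Phi w).1] /\ (Phi w').2 = s1).
Proof.
move=> cz [_ es1] w w' wz; have [a [ez ea qA]] := copy_vertex_link cz.
rewrite (edge_transportE w' ez wz); have [ec es eg] := Phi_reverse ez.
have es1' : s1 = shift [set a] (vstate (lq z)) by rewrite -es1 es.
have [k1 sf] := qflipE qA.
move: wz; rewrite inE => /existsP[p /andP[]]; rewrite !links_leE => /andP[/eqP zp szp] /andP[/eqP wp swp].
have wzq : lq w = lq z by rewrite wp zp.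
have pa : [set a] \in ldir p by apply: (subsetP szp); rewrite ez set11.
(* The labels of [w] are nested with {a}, as both belong to the clique of [p]; hence their simplices
   lie in the star of y. *)
have cov B : B \in ldir w -> {subset vframe (lq z) @: B <= cover (vertex_star K y)}.
  move=> wB; have pB := subsetP swp B wB; have /cliqueP[dC cC] := ldir_clique p.
  have [KB _] := qdirsP _ _ (dC B pB); have [Ka _] := qdirsP _ _ (dC _ pa).
  rewrite -zp in KB Ka; move=> v vB; have ya : y \in vframe (lq z) @: [set a] by rewrite imset_set1 ea set11.
  case/orP: (cC B [set a] pB pa) => sub.
    by apply: (cover_star Ka ya); apply: (subsetP (imsetS _ sub)).
  by apply: (cover_star KB) => //; apply: (subsetP (imsetS _ sub)).
have chiE B : B \in ldir w -> chi y @: (vframe (lq w) @: B) = fr (shift [set a] (vstate (lq z))) @: B.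
  move=> wB; rewrite wzq -imset_comp; apply: eq_in_imset => b bB /=.
  have bc : vframe (lq z) b \in cover (vertex_star K (vframe (lq z) a)) by rewrite ea (cov B) // imset_f.
  by rewrite -ea -(fr_shift_vertex bc) permK.
have imE : [set chi y @: (a : {set V}) | a in chain_of (Phi w).1] = img (fr (shift [set a] (vstate (lq z)))) (ldir w).
  rewrite chain_ofE /img -imset_comp; apply: eq_in_imset => B wB /=; exact: chiE.
rewrite imE es1' chain_ofE /=; split=> [[eq ed]|[e1 e2]].
  by rewrite eq ed /vframe sf.
(* Conversely, the state gives the frame, the frame gives back the labels, and one label gives the
   component, hence the vertex. *)
have ed : ldir w' = ldir w by move: e1; rewrite /vframe e2 => e; rewrite -[LHS](imgK (fr (shift [set a] (vstate (lq z))))) e imgK.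
split=> //; apply: Q_ext; last by rewrite e2 sf.
have /set0Pn[B wB] := ldir_nonempty w; have w'B : B \in ldir w' by rewrite ed.
rewrite -(vcomp_link w'B); have /cliqueP[dC cC] := ldir_clique p.
have pB := subsetP swp B wB.
have qB : B \in qdirs (qflip [set a] (lq z)).
  by apply: qdirs_flip; rewrite // ?zp; [exact: dC|exact: cC].
have [_ <-] := qdirsP _ _ qB.
by rewrite /vframe e2 sf.
Qed.

End Realization.

(** A point is a flag of its own star, and the anti-isomorphism takes it to [lam y]. *)
Lemma star_antiiso_dim0 (m : nat) (V : finType) (K : {set {set V}})
    (oY : m.+1.-tuple (simplex K) -> bool) (lam : V -> V) (chi : V -> V -> V) :
  simplicial_complex K -> (forall y, star_antiiso oY y (lam y) (chi y)) ->
  m = 0 -> forall y (t u : m.+1.-tuple (simplex K)),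
  (forall i, val (tnth t i) = [set y]) -> (forall i, val (tnth u i) = [set lam y]) -> oY u = ~~ oY t.
Proof.
move=> hK hchi m0 y t u et eu; have [_ _ chi_y rev] := hchi y; have [_ K1 _] := hK.
have i0 (i : 'I_m.+1) : nat_of_ord i = 0.
  by apply/eqP; rewrite -leqn0 -[X in _ <= X]m0 -ltnS.
apply: rev => [|i|i].
- apply/(simplex_flagP hK); split=> [i j _|i]; first by rewrite !et.
  by rewrite et cards1 i0.
- rewrite et inE K1 /=; apply/exists_inP; exists [set y]; rewrite ?K1 //.
  by rewrite set11 subxx.
- by rewrite et eu imset_set1 chi_y.
Qed.

Theorem theorem2p3 (m : nat) (V : finType) (K : {set {set V}})
    (hK : simplicial_complex K)
    (hY : pseudomanifold (simplex K) m)
    (oY : m.+1.-tuple (simplex K) -> bool)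
    (hoY : is_orientation oY)
    (lam : V -> V) (hlam : involutive lam)
    (chi : V -> V -> V)
    (hchi : forall y : V, star_antiiso oY y (lam y) (chi y))
    (hchiV : forall y : V,
       {in cover (vertex_star K y), cancel (chi y) (chi (lam y))}) :
  exists (disp : Order.disp_t) (X : finPOrderType disp)
         (oX : m.+2.-tuple X -> bool) (S : finType)
         (Phi : links X -> copies (sd (simplex K)) S),
    [/\ cubic_cell_complex X, pseudomanifold X m.+1, is_orientation oX,
        (0 < #|S|)%N
      & oriented_iso (links_orientation oX)
          (copies_orientation (sd_orientation oY)) Phi]
    /\
    [/\
      (forall (j : nat) (z : links X), (1 <= j <= m.+1)%N ->
         (Phi z).1 \in W (simplex K) j ->
         (Phi (reverse_edge z)).1 \in W (simplex K) j),
      (forall (z : links X) (y : V) (s : S),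
         is_copy_vertex (Phi z) y s ->
         exists s1 : S, is_copy_vertex (Phi (reverse_edge z)) (lam y) s1)
    & (forall (z : links X) (y : V) (s s1 : S),
         is_copy_vertex (Phi z) y s ->
         is_copy_vertex (Phi (reverse_edge z)) (lam y) s1 ->
         forall w w' : links X, w \in star z ->
           (edge_transport z w w' <->
              chain_of (Phi w').1
                = [set chi y @: (a : {set V}) | a in chain_of (Phi w).1]
              /\ (Phi w').2 = s1))].
Proof.
have chi_y y : chi y y = lam y by have [] := hchi y.
have rev0 := star_antiiso_dim0 hK hchi.
pose S : finType := states hK hlam hchi hchiV.
have fr_flag (s : S) := frame_shift_flag (s := s).
have fr_K (s : S) := frame_shift_K hY (s := s).
have fr_chi (s : S) a v : v \in cover (vertex_star K (frame s a)) ->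
    frame (shift [set a] s) (((frame s)^-1)%g v) = chi (frame s a) v.
  by move=> sv; rewrite frame_shift1 permM permKV; apply: gam_chi.
have shK A : involutive (shift A : S -> S) := @shiftK _ _ _ _ _ _ _ _ _ _ A.
have shC (A B : {set V}) (s : S) := @shiftC _ _ _ _ _ _ _ _ _ _ A B s.
have bitsE (A : {set V}) (s : S) := bits_shift A s.
pose X := cell (sys m hK hlam shK shC bitsE fr_K).
exists cell_display, X, (fun t : m.+2.-tuple X => oX oY t), S, (fun p : links X => Phi p).
split; split.
- exact: cells_cubic.
- exact: X_pseudomanifold fr_flag _.
- exact: (oX_orientation hY hoY rev0 fr_flag).
- exact: states_inhabited.
- exact: Phi_oriented.
- by move=> j z _; apply: W_reverse.
- by move=> z y s; apply: vertex_reverse.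
- by move=> z y s s1; apply: transport_chi.
Qed.
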